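(* Let $v=v(t_0,t_1,\bar t_1,t_2,\bar t_2,\dots)$ be the function of the harmonic moments of closed analytic curves described in the context. Then $v$ has the following Taylor expansion in the variables $t_k,\bar t_k$ ($k\ge 1$), with $t_0>0$ as a parameter: $$v=\tfrac12 t_0^2\log t_0-\tfrac34 t_0^2+\sum_{k,\bar k\ge 1}\ \sum_{\substack{1\le i_1<\dots<i_k\\ 1\le \bar i_1<\dots<\bar i_{\bar k}}}\ \sum_{\substack{n_1,\dots,n_k\ge1\\ \bar n_1,\dots,\bar n_{\bar k}\ge 1}}\frac{1}{n_1!\cdots n_k!\,\bar n_1!\cdots\bar n_{\bar k}!}\,N_i\!\left(\begin{matrix} i_1\dots i_k\\ n_1\dots n_k\end{matrix}\Big|\begin{matrix}\bar i_1\dots\bar i_{\bar k}\\ \bar n_1\dots\bar n_{\bar k}\end{matrix}\right)t_0^{\,i-(\sum_{j=1}^k n_j+\sum_{j=1}^{\bar k}\bar n_j)+2}\;t_{i_1}^{n_1}\cdots t_{i_k}^{n_k}\,\bar t_{\bar i_1}^{\,\bar n_1}\cdots\bar t_{\bar i_{\bar k}}^{\,\bar n_{\bar k}},$$ where in each term $i=\sum_{j=1}^k n_j i_j$; where $N_i(\cdots)=0$ if $i\ne\sum_{j=1}^k n_j i_j$ or $i\neq\sum_{j=1}^{\bar k}\bar n_j\bar i_j$; and where otherwise $$N_i\!\left(\begin{matrix} i_1\dots i_k\\ n_1\dots n_k\end{matrix}\Big|\begin{matrix}\bar i_1\dots\bar i_{\bar k}\\ \bar n_1\dots\bar n_{\bar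 k}\end{matrix}\right)=N_i(i_1,\dots,i_1,i_2,\dots,i_2,\dots,i_k,\dots,i_k\,|\,\bar i_1,\dots,\bar i_1,\dots,\bar i_{\bar k},\dots,\bar i_{\bar k}),$$ each $i_j$ occurring $n_j$ times and each $\bar i_j$ occurring $\bar n_j$ times in the list on the right, the numbers $N_i(\cdot|\cdot)$ being the combinatorial numbers defined in the context. The equality is understood as equality of formal power series in $t_k,\bar t_k$ ($k\ge1$), the coefficients being functions of $t_0>0$.
   Context: **The function $v$.** Let $\gamma\subset\mathbb C$ be a closed analytic curve with interior $D_+\ni 0$ and exterior $D_-$. Put $$t_0=\frac1\pi\int_{D_+}d^2z,\qquad t_k=-\frac1{\pi k}\int_{D_-}z^{-k}d^2z=\frac1{2\pi i k}\oint_\gamma z^{-k}\,\bar z\,dz\quad(k\ge1)$$ ($\gamma$ counterclockwise; the contour integral is the definition when the area integral does not converge absolutely), and let $\bar t_k$ be the complex conjugate of $t_k$. The quantities $t_0,t_k,\bar t_k$ are regarded as independent coordinates on the space of such curves, and $\partial_0=\partial/\partial t_0$, $\partial_k=\partial/\partial t_k$, $\bar\partial_k=\partial/\partial\bar t_k$. The function $v$ (the logarithm of the tau-function of analytic curves) has partial derivatives of all orders and satisfies $$\partial_0v=\frac2\pi\int_{D_+}\log|z|\,d^2z,\qquad \partial_kv=\frac1\pi\int_{D_+}z^kd^2z=\frac{1}{2\pi i}\oint_\gamma z^k\,\bar z\,dz,\qquad \bar\partial_kv=\overline{\partial_kv}\quad(k\ge1),$$ normalized so that its value at $t_k=\bar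 t_k=0$ $(k\ge1)$ tends to $0$ as $t_0\to0^+$. It is a known fact, taken as a standing property of $v$, that it satisfies the dispersionless Hirota equations of the 2D Toda hierarchy (formal identities in $z^{-1},\xi^{-1},\bar z^{-1},\bar\xi^{-1}$): $$(z-\xi)e^{D(z)D(\xi)v}=ze^{-\partial_0D(z)v}-\xi e^{-\partial_0D(\xi)v},$$ $$(\bar z-\bar\xi)e^{\bar D(\bar z)\bar D(\bar\xi)v}=\bar ze^{-\partial_0\bar D(\bar z)v}-\bar\xi e^{-\partial_0\bar D(\bar\xi)v},$$ $$1-e^{-D(z)\bar D(\bar\xi)v}=\frac1{z\bar\xi}e^{\partial_0(\partial_0+D(z)+\bar D(\bar\xi))v},$$ where $D(z)=\sum_{k\ge1}\frac{z^{-k}}k\partial_k$ and $\bar D(\bar z)=\sum_{k\ge1}\frac{\bar z^{-k}}k\bar\partial_k$. **Combinatorial numbers.** All indices below are positive integers unless stated otherwise. (1) For integers $r_1,\dots,r_m\ge0$, $P_{ij}(r_1,\dots,r_m)$ is the number of ordered tuples $(a_1,\dots,a_m)$ of integers with $a_1+\dots+a_m=i$ and $1\le a_q\le r_q$ for all $q$ (used with $r_1+\dots+r_m+m=i+j$). (2) For $p_1+\dots+p_m=i+j$, $p_q\ge1$: $$T_{ij}(p_1,\dots,p_m)=\sum_{k\ge1}\ \sum_{\substack{n_1+\dots+n_k=m\\ n_r\ge1}}\frac{(-1)^{m+1}}{k}\,\frac1{n_1!\cdots n_k!}\,P_{ij}(p_1+\dots+p_{q_1}-1,\ p_{q_1+1}+\dots+p_{q_2}-1,\dots,\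 p_{q_{k-1}+1}+\dots+p_{q_k}-1),\quad q_r=n_1+\dots+n_r.$$ (3) For $k\ge2$ and $s_q,\ell_q\ge1$ with $s_1+\dots+s_m=i_1+\dots+i_k$ and $\ell_1+\dots+\ell_m=m+k-2$, define $T_{i_1\dots i_k}\binom{s_1\dots s_m}{\ell_1\dots\ell_m}$ recursively. For $k=2$ it equals $T_{i_1i_2}(s_1,\dots,s_m)$ if $\ell_1=\dots=\ell_m=1$, and $0$ otherwise. For $k\ge3$, $$T_{i_1\dots i_k}\binom{s_1\dots s_m}{\ell_1\dots\ell_m}=\sum_{\substack{1\le a\le b\le m\\ s>0,\ \ell>0}}T_{i_1\dots i_{k-1}}\binom{s_1\dots s_{a-1}\ \ s\ \ s_{b+1}\dots s_m}{\ell_1\dots\ell_{a-1}\ \ \ell\ \ \ell_{b+1}\dots\ell_m}\,T_{s,i_k}(s_a,\dots,s_b)\,\frac{\ell!}{(\ell_a-1)!\cdots(\ell_b-1)!},$$ where $s=s_a+\dots+s_b-i_k$, $\ell=(\ell_a-1)+\dots+(\ell_b-1)$, and only pairs $(a,b)$ for which $s>0$ and $\ell>0$ contribute. (4) $N_i(i_1,\dots,i_k|\bar i_1,\dots,\bar i_{\bar k})$ for $k,\bar k\ge1$: it is $0$ unless $i_1+\dots+i_k=i=\bar i_1+\dots+\bar i_{\bar k}$. If these equalities hold and $k\ge2$, then $$N_i(i_1,\dots,i_k|\bar i_1,\dots,\bar i_{\bar k})=\sum_{m\ge1}\ \sum_{\substack{s_1+\dots+s_m=i_1+\dots+i_k\\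 \ell_1+\dots+\ell_m=m+k-2\\ s_q,\ell_q\ge1}}i_1\cdots i_k\,\bar i_1\cdots\bar i_{\bar k}\;T_{i_1\dots i_k}\binom{s_1\dots s_m}{\ell_1\dots\ell_m}\,S,$$ $$S=\sum_{n_1+\dots+n_m=\bar k}\ \sum\ \frac{(s_1-1)!\cdots(s_m-1)!}{(s_1-n_1+1-\ell_1)!\cdots(s_m-n_m+1-\ell_m)!},$$ the inner sum in $S$ being over all ways to distribute the labelled entries $\bar i_1,\dots,\bar i_{\bar k}$ (equal values at different positions count as distinct) into an ordered sequence of $m$ blocks, the $p$-th having $n_p$ entries with sum $s_p$; a term with a factorial of a negative integer in the denominator is $0$. If the equalities hold and $k=1$, then $N_i(i_1|\bar i_1,\dots,\bar i_{\bar k})=\bar i_1\cdots\bar i_{\bar k}\,\frac{i!}{(i-\bar k+1)!}$. *)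

(* Defs.v *)
From HB Require Import structures.
From mathcomp Require Import all_boot all_order all_algebra.
From mathcomp Require Import all_classical all_reals all_analysis.
From mathcomp Require Import complex.

Set Implicit Arguments.
Unset Strict Implicit.
Unset Printing Implicit Defensive.

Import Order.TTheory GRing.Theory Num.Theory.
Import numFieldNormedType.Exports.

Local Open Scope classical_set_scope.
Local Open Scope ring_scope.
Local Open Scope complex_scope.

(** * Closed analytic curves and their harmonic moments

    The plane is [R[i]] for complex arithmetic and [R * R] for topology and
    Lebesgue measure.  A curve is a 2pi-periodic parametrisation
    [g : R -> R[i]]. *)
Section Curves.
Context {R : realType}.
Local Notation C := R[i].
Implicit Types (g : R -> C) (f : R -> R).

Definition real_analytic f : Prop :=
  forall s0 : R, exists (a : nat -> R) (e : R), 0 < e /\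
    forall s, `|s - s0| < e -> pseries a (s - s0) @ \oo --> f s.

Definition velocity g (s : R) : C :=
  derive1 (fun u => complex.Re (g u)) s +i*
  derive1 (fun u => complex.Im (g u)) s.

(** [contour_integral g h] is the integral of [h z dz] along [g], where [h]
    may depend on [z] and its conjugate. *)
Definition contour_integral g (h : C -> C) : C :=
  let w s := h (g s) * velocity g s in
  (\int[lebesgue_measure]_(s in `[0, 2 * pi]) complex.Re (w s)) +i*
  (\int[lebesgue_measure]_(s in `[0, 2 * pi]) complex.Im (w s)).

Definition trace g : set (R * R) :=
  [set (complex.Re (g s), complex.Im (g s)) | s in [set: R]].

(** The domain D_+ bounded by the curve. *)
Definition interior_domain g : set (R * R) :=
  [set z | ~ trace g z /\ bounded_set (connected_component (~` trace g) z)].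

(** The last clause (winding number 1 about 0) says that 0 lies in D_+ and that
    the curve is run counterclockwise. *)
Definition closed_analytic_curve g : Prop :=
  [/\ real_analytic (fun s => complex.Re (g s))
        /\ real_analytic (fun s => complex.Im (g s)),
      forall s, g (s + 2 * pi) = g s,
      forall s s' : R, 0 <= s < 2 * pi -> 0 <= s' < 2 * pi -> g s = g s' -> s = s',
      forall s, velocity g s != 0 &
      ~ trace g (0, 0)
        /\ contour_integral g (fun z => z^-1) = 2 * pi%:C * 'i%C].

Definition area_integral (D : set (R * R)) (f : R * R -> R) : R :=
  \int[(lebesgue_measure \x lebesgue_measure)%E]_(z in D) f z.

(** The moments t_0 (index 0, a real number) and t_k (index k >= 1).  For
    k = 1, 2 the area integral over D_- does not converge absolutely, so t_k is
    given by the contour integral for all k. *)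
Definition moment g (k : nat) : C :=
  if k is 0 then (pi^-1 * area_integral (interior_domain g) (fun=> 1))%:C
  else (2 * pi%:C * 'i%C * k%:R)^-1 * contour_integral g (fun z => z ^- k * z^*%C).

Definition circle (r : R) : R -> C := fun s => (r * cos s) +i* (r * sin s).

(** [X] is a space of closed analytic curves, containing all circles about 0,
    on which the moments are independent coordinates: a curve in [X] is
    determined by its moments, and any finite set of moments can be varied
    freely, the others being kept fixed. *)
Definition moments_are_coordinates (X : set (R -> C)) : Prop :=
  [/\ forall g, X g -> closed_analytic_curve g,
      forall r : R, 0 < r -> X (circle r),
      forall g h, X g -> X h -> moment g = moment h ->
        interior_domain g = interior_domain h &
      forall g (n : nat), X g -> exists2 e : R, 0 < e &
        forall q : nat -> C,
          complex.Im (q 0%N) = 0 ->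
          (forall k, (k <= n)%N -> `|q k - moment g k| < e%:C) ->
          (forall k, (n < k)%N -> q k = moment g k) ->
          exists2 h, X h & moment h = q].

End Curves.

(** * Partial derivatives with respect to the moments

    A point [p : nat -> R[i]] has coordinates t_0 = p 0 (a real number for the
    moments of a curve) and t_k = p k.  With t_k = x + i y,
      d/dt_k = (d/dx - i d/dy)/2   and   d/d(conj t_k) = (d/dx + i d/dy)/2. *)
Section PartialDerivatives.
Context {R : realType}.
Local Notation C := R[i].
Local Notation point := (nat -> C).
Implicit Types (F v : point -> C) (p : point).

Definition move p (k : nat) (w : C) (s : R) : point :=
  fun j => if j == k then p j + s%:C * w else p j.

Definition derivable_along F p k (w : C) : Prop :=
  derivable (fun s : R => complex.Re (F (move p k w s))) 0 1 /\
  derivable (fun s : R => complex.Im (F (move p k w s))) 0 1.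

Definition derivative_along F p k (w : C) : C :=
  derive1 (fun s : R => complex.Re (F (move p k w s))) 0 +i*
  derive1 (fun s : R => complex.Im (F (move p k w s))) 0.

(** Variables: [(false, k)] is t_k and [(true, k)] its conjugate; both
    [(false, 0)] and [(true, 0)] are t_0. *)
Definition variable := (bool * nat)%type.

Definition partial (x : variable) F : point -> C := fun p =>
  let: (c, k) := x in
  let dx := derivative_along F p k 1 in
  let dy := derivative_along F p k 'i in
  if k == 0%N then dx
  else if c then 2^-1 * (dx + 'i%C * dy) else 2^-1 * (dx - 'i%C * dy).

Definition partials (xs : seq variable) v : point -> C := foldr partial v xs.

(** All iterated partial derivatives exist on [U] and, as for any smooth
    function, do not depend on the order of differentiation. *)
Definition has_all_partials (U : set point) v : Prop :=
  (forall xs p k, U p ->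
     derivable_along (partials xs v) p k 1 /\
     (k != 0%N -> derivable_along (partials xs v) p k 'i)) /\
  (forall xs ys p, U p -> perm_eq xs ys -> partials xs v p = partials ys v p).

End PartialDerivatives.

(** * The function v *)
Section LogTau.
Context {R : realType}.
Local Notation C := R[i].
Local Notation point := (nat -> C).
Implicit Types (X : set (R -> C)) (v : point -> C).

Definition origin (t0 : R) : point := fun k => if k is 0 then t0%:C else 0.

Definition log_tau_derivatives X v : Prop :=
  forall g, X g ->
    partial (false, 0%N) v (moment g) =
      (2 / pi * area_integral (interior_domain g)
         (fun z => ln (Num.sqrt (z.1 ^+ 2 + z.2 ^+ 2))))%:C /\
    forall k, (0 < k)%N ->
      partial (false, k) v (moment g) =
        (2 * pi%:C * 'i%C)^-1 * contour_integral g (fun z => z ^+ k * z^*%C) /\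
      partial (true, k) v (moment g) = (partial (false, k) v (moment g))^*.

Definition log_tau_normalized v : Prop :=
  complex.Re `|v (origin t0)| @[t0 --> 0^'+] --> (0 : R).

End LogTau.

(** * Formal power series in two variables and the Hirota equations *)
Section Hirota.
Context {R : realType}.
Local Notation C := R[i].
Local Notation point := (nat -> C).

(** [f a b] is the coefficient of x^a y^b. *)
Definition series2 := nat -> nat -> C.
Implicit Types f g : series2.

Definition const2 (c : C) : series2 :=
  fun a b => if (a == 0%N) && (b == 0%N) then c else 0.

Definition mul2 f g : series2 := fun a b =>
  \sum_(i < a.+1) \sum_(j < b.+1) f i j * g (a - i)%N (b - j)%N.

Definition mulx f : series2 := fun a b => if a is a'.+1 then f a' b else 0.
Definition muly f : series2 := fun a b => if b is b'.+1 then f a b' else 0.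

Definition cexp (z : C) : C :=
  (expR (complex.Re z))%:C * (cos (complex.Im z) +i* sin (complex.Im z)).

(** e^f = e^(f_00) * sum_n (f - f_00)^n / n!; powers with n > a + b do not
    contribute to the coefficient of x^a y^b. *)
Definition exp2 f : series2 := fun a b =>
  cexp (f 0%N 0%N) *
  \sum_(n < (a + b).+1)
     (n`!%:R)^-1 * iter n (mul2 (f - const2 (f 0%N 0%N))) (const2 1) a b.

(** With D_false(z) = D(z) = sum_(k >= 1) z^-k / k d/dt_k, and D_true the same
    with conjugate variables:
    [D0x c v p] is d_0 D_c v as a series in x (where x stands for z^-1),
    [D0y c v p] is d_0 D_c v as a series in y,
    [DD c c' v p] is D_c D_c' v, with D_c a series in x and D_c' one in y. *)
Definition D0x (c : bool) (v : point -> C) (p : point) : series2 := fun a b =>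
  if (0 < a)%N && (b == 0%N)
  then a%:R^-1 * partials [:: (false, 0%N); (c, a)] v p else 0.

Definition D0y (c : bool) (v : point -> C) (p : point) : series2 := fun a b =>
  if (a == 0%N) && (0 < b)%N
  then b%:R^-1 * partials [:: (false, 0%N); (c, b)] v p else 0.

Definition DD (c c' : bool) (v : point -> C) (p : point) : series2 := fun a b =>
  if (0 < a)%N && (0 < b)%N
  then (a%:R * b%:R)^-1 * partials [:: (c, a); (c', b)] v p else 0.

(** For [c = false], with x = z^-1 and y = xi^-1,
      (z - xi) e^(D(z)D(xi)v) = z e^(-d_0 D(z)v) - xi e^(-d_0 D(xi)v)
    multiplied by x y; for [c = true], its conjugate. *)
Definition hirota_same (c : bool) (v : point -> C) (p : point) : Prop :=
  muly (exp2 (DD c c v p)) - mulx (exp2 (DD c c v p)) =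
  muly (exp2 (- D0x c v p)) - mulx (exp2 (- D0y c v p)).

Definition hirota_mixed (v : point -> C) (p : point) : Prop :=
  const2 1 - exp2 (- DD false true v p) =
  mulx (muly (exp2 (const2 (partials [:: (false, 0%N); (false, 0%N)] v p)
                    + D0x false v p + D0y true v p))).

Definition dispersionless_hirota (U : set point) (v : point -> C) : Prop :=
  forall p, U p -> [/\ hirota_same false v p, hirota_same true v p
                     & hirota_mixed v p].

End Hirota.

(** * The combinatorial numbers *)
Section Numbers.
Local Open Scope nat_scope.

(** All sequences of [k] positive integers with sum [n]. *)
Definition compositions (n k : nat) : seq (seq nat) :=
  [seq c <- [seq map val (tval t) | t : k.-tuple 'I_n.+1]
     | all (fun x => 0 < x) c && (sumn c == n)].

(** In [Pnum] and [Tnum] the index [j] is determined by the other arguments: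
    sumn r + size r = i + j and sumn p = i + j. *)
Definition Pnum (i j : nat) (r : seq nat) : nat :=
  size [seq c <- compositions i (size r) | all2 leq c r].

Definition Tnum (i j : nat) (p : seq nat) : rat :=
  let m := size p in
  (\sum_(1 <= k < m.+1) \sum_(n <- compositions m k)
     (-1) ^+ m.+1 / k%:R * (\prod_(x <- n) x`!)%:R^-1
     * (Pnum i j [seq (sumn b).-1 | b <- reshape n p])%:R)%R.

(** [Trev] takes the lower indices in reverse order, since the recursion
    removes the last one.  Positions start at 0, and [slice a b] is the block
    of the positions a, ..., b - 1. *)
Definition slice (a b : nat) (s : seq nat) : seq nat := drop a (take b s).

Fixpoint Trev (I s l : seq nat) {struct I} : rat :=
  match I with
  | [:: i2; i1] => if all (pred1 1) l then Tnum i1 i2 s else 0%R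
  | ik :: ((_ :: _ :: _) as I') =>
      (\sum_(0 <= a < size s) \sum_(a.+1 <= b < (size s).+1)
         let s' := (sumn (slice a b s) - ik)%N in
         let l' := sumn [seq x.-1 | x <- slice a b l] in
         if (0 < s')%N && (0 < l')%N then
           Trev I' (take a s ++ s' :: drop b s) (take a l ++ l' :: drop b l)
           * Tnum s' ik (slice a b s)
           * (l'`!%:R / (\prod_(x <- slice a b l) (x.-1)`!)%:R)
         else 0)%R
  | _ => 0%R
  end.

Definition Tmulti (I s l : seq nat) : rat := Trev (rev I) s l.

(** The quantity S: [d] sends each position of [J] to the index of its block,
    and [n p] is the size of the block [p]. *)
Definition Snum (J s l : seq nat) : rat :=
  let m := size s in
  (\sum_(d : {ffun 'I_(size J) -> 'I_m}
         | [forall p, (\sum_(q | d q == p) nth 0%N J q)%N == nth 0%N s p])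
     let n (p : 'I_m) := #|[pred q | d q == p]| in
     if [forall p : 'I_m, (n p + nth 0%N l p <= (nth 0%N s p).+1)%N] then
       (\prod_(p < m) ((nth 0%N s p).-1)`!)%:R
       / (\prod_(p < m) ((nth 0%N s p).+1 - (n p + nth 0%N l p))`!)%:R
     else 0)%R.

Definition Nnum (i : nat) (I J : seq nat) : rat :=
  if (sumn I == i) && (sumn J == i) then
    match I with
    | [::] => 0%R
    | [:: _] => ((\prod_(j <- J) j)%:R * (i`!%:R / ((i.+1 - size J)`!)%:R))%R
    | _ =>
      (\sum_(1 <= m < i.+1) \sum_(s <- compositions i m)
         \sum_(l <- compositions (m + size I - 2) m)
           (\prod_(j <- I) j)%:R * (\prod_(j <- J) j)%:R
           * Tmulti I s l * Snum J s l)%R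
    end
  else 0%R.

(** A monomial t_(i_1)^(n_1) ... t_(i_k)^(n_k) with 1 <= i_1 < ... < i_k and
    n_j >= 1 is the list of the pairs (i_j, n_j). *)
Definition is_monomial (m : seq (nat * nat)) : bool :=
  sorted ltn (unzip1 m) && all (fun x => (0 < x.1) && (0 < x.2)) m.

(** i_1, ..., i_1, ..., i_k, ..., i_k with each i_j occurring n_j times. *)
Definition spread (m : seq (nat * nat)) : seq nat :=
  flatten [seq nseq x.2 x.1 | x <- m].

Definition weight (m : seq (nat * nat)) : nat := \sum_(x <- m) x.2 * x.1.
Definition degree (m : seq (nat * nat)) : nat := \sum_(x <- m) x.2.
Definition factorials (m : seq (nat * nat)) : nat := \prod_(x <- m) x.2`!.

End Numbers.

(** * The Taylor series at t_k = 0 (k >= 1)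

    A formal power series in the t_k and their conjugates assigns a coefficient
    to each pair of monomials [m] (in the t_k) and [mb] (in the conjugates). *)
Section Expansion.
Context {R : realType}.
Local Notation C := R[i].

Definition taylor_coef (v : (nat -> C) -> C) (t0 : R) (m mb : seq (nat * nat))
    : C :=
  (factorials m * factorials mb)%:R^-1 *
  partials ([seq (false, k) | k <- spread m] ++ [seq (true, k) | k <- spread mb])
    v (origin t0).

Definition expansion_coef (t0 : R) (m mb : seq (nat * nat)) : C :=
  match m, mb with
  | [::], [::] => (2^-1 * t0 ^+ 2 * ln t0 - 3 / 4 * t0 ^+ 2)%:C
  | _ :: _, _ :: _ =>
      (factorials m * factorials mb)%:R^-1
      * ratr (Nnum (weight m) (spread m) (spread mb))
      * (t0 ^ ((weight m)%:Z - (degree m + degree mb)%:Z + 2))%:C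
  | _, _ => 0
  end.

End Expansion.

(* Main.v *)
From HB Require Import structures.
Require Import Defs.
From mathcomp Require Import all_boot all_order all_algebra.
From mathcomp Require Import all_classical all_reals all_analysis.
From mathcomp Require Import measurable_realfun.
From mathcomp Require Import complex.
From mathcomp Require Import ring lra zify.

(** The first Hirota equation determines e^(D(z)D(xi)v); expanding its logarithm
    gives d_i d_j v = ij sum_p T_ij(p) prod_q w(p_q, 1), where w(s, l) stands for
    d_0^l d_s v / s.  A further derivative d_i hits one factor w(s, l), and
    d_i w(s, l) = d_0^l (d_i d_s v) / s is expanded by the same formula; with the
    Leibniz rule for d_0^l this is the recursion that defines T_(i_1 ... i_k), so
    d_I v = (prod I) sum T_I(s; l) prod_q w(s_q, l_q).

    On the line t_k = 0 (k >= 1), whose points are the moments of the circles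
    about 0, integration gives d_k v = 0 and d_0 v = t_0 ln t_0 - t_0.  There the
    mixed Hirota equation reduces to d_i dbar_j v = delta_ij i t_0^i.  Now apply
    dbar_J to the expansion of d_I v and restrict to the line.  A factor w(s, l)
    without a dbar vanishes.  One that receives a block B of J contributes, by the
    conjugate expansion in which only the words of length 1 survive,
    (prod B) (s-1)! / (s - |B| + 1 - l)! t_0^(s - |B| + 1 - l) if B has sum s and
    0 otherwise.  Summing over the distributions of J into blocks yields S. *)

Set Implicit Arguments.
Unset Strict Implicit.
Unset Printing Implicit Defensive.

Import Order.TTheory GRing.Theory Num.Theory.
Import numFieldNormedType.Exports.
Local Open Scope ring_scope.

(** * Sums over words and compositions *)

(** Two features of the setting shape the proof. The operator [partial] is total, so the sum and
    product rules are available only for differentiable functions, and the order of differentiation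
    is known to be immaterial only for iterated derivatives of v itself. The recursion, however, is
    pure algebra. It is therefore proved in an arbitrary commutative ring with additive maps d that
    obey the Leibniz rule and kill rational constants, and with an element v whose iterated
    derivatives are independent of the order. The ring used in the end consists of the restrictions
    to the set of moments of the differential polynomials in v. The second obstacle is bookkeeping:
    T_I is defined by contracting blocks in two rows of varying length with prescribed sums. All
    such sums become sums over free words of pairs (s, l) in a bounded alphabet, with coefficients
    extended by 0. The bound N only has to be large enough, so it stays the same throughout an
    induction. The factors 1/k and 1/n_r! in T_ij are those of the logarithm and of the exponentials
    e^(-d_0 D v), and P_ij comes from the quotients (x^c - y^c)/(x - y) left by the division by z -
    xi. *)

Section Compositions.
Local Open Scope nat_scope.

Lemma leq_sumn (x : nat) s : x \in s -> x <= sumn s.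
Proof.
elim: s => //= y s IH; rewrite inE => /orP[/eqP->|/IH h]; first exact: leq_addr.
exact: leq_trans h (leq_addl _ _).
Qed.

Lemma mem_compositions n k c : (c \in compositions n k) =
  [&& size c == k, all (fun x => 0 < x) c & sumn c == n].
Proof.
rewrite mem_filter; apply/andP/and3P => [[/andP[p s] /mapP[t _ ct]]|[z p s]].
  by split=> //; rewrite ct size_map size_tuple.
split; first by rewrite p s.
have lt x : x \in c -> x < n.+1.
  by move=> /leq_sumn; rewrite (eqP s).
have szt : size (map (fun x => inord x : 'I_n.+1) c) == k by rewrite size_map.
have -> : c = map val (tval (Tuple szt : k.-tuple 'I_n.+1)).
  rewrite /= -map_comp -[LHS]map_id; apply/eq_in_map => x /lt xn /=.
  by rewrite inordK.
by apply: map_f; rewrite mem_enum.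
Qed.

Lemma compositions_uniq n k : uniq (compositions n k).
Proof.
apply: filter_uniq; rewrite map_inj_uniq ?enum_uniq//.
by move=> s t /(inj_map val_inj) /val_inj.
Qed.

Variable A : nmodType.

Lemma big_compositions0 n (F : seq nat -> A) :
  (\sum_(c <- compositions n 0) F c = if n == 0 then F [::] else 0)%R.
Proof.
case: eqP => [->|n0].
  rewrite (perm_big [:: [::]]) ?big_seq1//; apply: uniq_perm => //.
    exact: compositions_uniq.
  by move=> c; rewrite mem_compositions inE; case: c.
rewrite big_seq big1// => c; rewrite mem_compositions => /and3P[/eqP/size0nil->].
by move=> _ /eqP /esym.
Qed.

Lemma big_compositionsS n k (F : seq nat -> A) :
  (\sum_(c <- compositions n k.+1) F c =
   \sum_(1 <= a < n.+1) \sum_(c <- compositions (n - a)%N k) F (a :: c))%R.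
Proof.
pose E a := compositions (n - a) k.
transitivity (\sum_(c <- [seq a :: c | a <- index_iota 1 n.+1, c <- E a]) F c)%R;
  last by rewrite big_allpairs_dep.
apply: perm_big; apply: uniq_perm.
- exact: compositions_uniq.
- apply: allpairs_uniq_dep; first exact: iota_uniq.
    by move=> a _; exact: compositions_uniq.
  by move=> [a c] [b e] _ _ /= [-> ->].
- move=> c; rewrite mem_compositions; apply/and3P/allpairsPdep.
    case: c => [[]//|a c] /= [/eqP[sz] /andP[a0 p] /eqP s].
    exists a, c; split=> //; first by rewrite mem_index_iota a0 /=; lia.
    by rewrite mem_compositions sz p eqxx /=; apply/eqP; lia.
  case=> a [e [ha]]; rewrite mem_compositions => /and3P[/eqP sz p /eqP s] -> /=.
  move: ha; rewrite mem_index_iota => /andP[a0 an].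
  by split; [rewrite sz | rewrite a0 | apply/eqP; lia].
Qed.

End Compositions.

Section WordSums.
Variable A : nmodType.

(** Free words over a fixed alphabet replace compositions: concatenation, pairing and exchange of
    sums are then structural inductions, and the constraints on row sums become conditions inside
    F. *)
Fixpoint wsum (T : Type) (X : seq T) (m : nat) (F : seq T -> A) : A :=
  if m is m'.+1 then \sum_(x <- X) wsum X m' (fun z => F (x :: z)) else F [::].

Lemma eq_wsum (T : eqType) (X : seq T) m (F G : seq T -> A) :
  (forall z, size z = m -> all (mem X) z -> F z = G z) -> wsum X m F = wsum X m G.
Proof.
elim: m F G => [|m IH] F G FG /=; first exact: FG.
rewrite big_seq [RHS]big_seq; apply: eq_bigr => x xX; apply: IH => z zm zX.
by apply: FG; rewrite /= ?zm ?xX.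
Qed.

Lemma eq_wsumr (T : Type) (X : seq T) m (F G : seq T -> A) :
  F =1 G -> wsum X m F = wsum X m G.
Proof.
elim: m F G => [|m IH] F G FG /=; first exact: FG.
by apply: eq_bigr => x _; apply: IH => z; apply: FG.
Qed.

Lemma wsum0 (T : eqType) (X : seq T) m (F : seq T -> A) :
  (forall z, size z = m -> all (mem X) z -> F z = 0) -> wsum X m F = 0.
Proof.
move=> F0; rewrite (eq_wsum (G := fun=> 0))//.
by elim: m {F F0} => //= m ->; rewrite big1_eq.
Qed.

Lemma wsum_sum (T I : Type) (X : seq T) m (r : seq I) (F : I -> seq T -> A) :
  wsum X m (fun z => \sum_(i <- r) F i z) = \sum_(i <- r) wsum X m (F i).
Proof.
elim: m F => [|m IH] F //=.
under eq_bigr do rewrite IH.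
exact: exchange_big.
Qed.

Lemma wsum_cat (T : Type) (X : seq T) a b (F : seq T -> A) :
  wsum X (a + b) F = wsum X a (fun y => wsum X b (fun z => F (y ++ z))).
Proof. by elim: a F => [|a IH] F //=; apply: eq_bigr => x _; rewrite IH. Qed.

Lemma wsum_exchange (T S : Type) (X : seq T) (Y : seq S) a b
    (F : seq T -> seq S -> A) :
  wsum X a (fun y => wsum Y b (F y)) = wsum Y b (fun z => wsum X a (F^~ z)).
Proof.
elim: a F => [|a IH] F //=.
by rewrite wsum_sum; apply: eq_bigr => x _; rewrite IH.
Qed.

Lemma wsum_pair (T S : Type) (X : seq T) (Y : seq S) m (F : seq T -> seq S -> A) :
  wsum [seq (x, y) | x <- X, y <- Y] m (fun z => F (unzip1 z) (unzip2 z)) =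
  wsum X m (fun s => wsum Y m (F s)).
Proof.
elim: m F => [|m IH] F //=.
rewrite big_allpairs; apply: eq_bigr => x _.
rewrite wsum_sum; apply: eq_bigr => y _.
by rewrite (IH (fun s l => F (x :: s) (y :: l))).
Qed.

(** The parts of a composition of n are at most n, so one alphabet [iota 1 N] serves for all n <=
    N. *)
Lemma sum_compositions n k N (F : seq nat -> A) : (n <= N)%N ->
  \sum_(c <- compositions n k) F c =
  wsum (iota 1 N) k (fun c => if sumn c == n then F c else 0).
Proof.
elim: k n F => [|k IH] n F nN; first by rewrite big_compositions0/= eq_sym.
rewrite big_compositionsS /=.
have -> : iota 1 N = index_iota 1 N.+1 by rewrite /index_iota subn1.
rewrite [RHS](big_cat_nat (n := n.+1))//=.
rewrite [X in _ = _ + X]big_nat [X in _ = _ + X]big1 ?addr0; last first.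
  move=> a /andP[an _]; apply: wsum0 => z _ _.
  by case: eqP => // h; lia.
rewrite big_nat [RHS]big_nat; apply: eq_bigr => a /andP[a0 an].
rewrite IH; last by lia.
rewrite /index_iota subn1 /=.
apply: eq_wsumr => z; congr (if _ then _ else _).
by apply/eqP/eqP; lia.
Qed.

Lemma wsum_pred1 m N (F : seq nat -> A) : (0 < N)%N ->
  wsum (iota 1 N) m (fun l => if all (pred1 1%N) l then F l else 0) =
  F (nseq m 1%N).
Proof.
case: N => // N _; elim: m F => [|m IH] F //=.
rewrite big_cons /= (IH (fun z => F (1%N :: z))) big_seq big1 ?addr0// => x.
rewrite mem_iota => /andP[x1 _]; apply: wsum0 => z _ _.
by case: eqP => // h; lia.
Qed.

End WordSums.

Section WordSumsRing.
Variable A : pzSemiRingType.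

Lemma mulr_wsumr (T : Type) (X : seq T) m (F : seq T -> A) c :
  c * wsum X m F = wsum X m (fun z => c * F z).
Proof.
elim: m F => [|m IH] F //=; rewrite big_distrr /=.
by apply: eq_bigr => x _; rewrite IH.
Qed.

Lemma mulr_wsuml (T : Type) (X : seq T) m (F : seq T -> A) c :
  wsum X m F * c = wsum X m (fun z => F z * c).
Proof.
elim: m F => [|m IH] F //=; rewrite big_distrl /=.
by apply: eq_bigr => x _; rewrite IH.
Qed.

Lemma wsum_morph (B : nmodType) (h : A -> B) (T : Type) (X : seq T) m F :
  h 0 = 0 -> {morph h : x y / x + y} -> h (wsum X m F) = wsum X m (h \o F).
Proof.
move=> h0 hD; elim: m F => [|m IH] F //=.
by rewrite (big_morph h hD h0); apply: eq_bigr => x _; rewrite IH.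
Qed.

End WordSumsRing.

(** * Triangular reindexing: a length and a marked position or block against the lengths of the
    pieces *)

Section NatSums.
Variable A : nmodType.

Lemma big_nat_trim n N (F : nat -> A) : (n <= N)%N ->
  (forall k, (n <= k)%N -> F k = 0) ->
  \sum_(0 <= k < N) F k = \sum_(0 <= k < n) F k.
Proof.
move=> nN F0; rewrite (big_cat_nat (n := n))//= [X in _ + X]big_nat.
by rewrite [X in _ + X]big1 ?addr0// => k /andP[/F0].
Qed.

Lemma big_nat_triangle N (H : nat -> nat -> A) :
  (forall a e, (N < a + e + 1)%N -> H a e = 0) ->
  \sum_(0 <= m < N.+1) \sum_(0 <= q < m) H q (m - q.+1)%N =
  \sum_(0 <= a < N.+1) \sum_(0 <= e < N.+1) H a e.
Proof.
move=> H0; transitivity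
  (\sum_(0 <= m < N.+1) \sum_(0 <= q < N.+1 | (q < m)%N) H q (m - q.+1)%N).
  rewrite big_nat [RHS]big_nat; apply: eq_bigr => m /andP[_ mN].
  by rewrite (big_nat_widen _ _ N.+1) ?(ltnW mN)//.
rewrite (exchange_big_dep_nat xpredT) //=.
rewrite big_nat [RHS]big_nat; apply: eq_bigr => q /andP[_ qN].
transitivity (\sum_(q.+1 <= m < N.+1) H q (m - q.+1)%N).
  by rewrite (big_nat_widenl q.+1 0).
rewrite -{1}[q.+1]add0n big_addn subSS.
under eq_bigr => k _ do rewrite addnK.
rewrite [RHS](big_nat_trim (n := (N - q)%N)) //; first by lia.
by move=> k hk; apply: H0; lia.
Qed.

(** A word of length m with a marked block from a to b is given by the lengths of the three pieces;
    this is [big_nat_triangle] used twice. The vanishing of H beyond total length N lets the three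
    lengths run independently. *)
Lemma big_nat_triangle3 N (H : nat -> nat -> nat -> A) :
  (forall a c e, (N < a + c + e)%N -> H a c e = 0) ->
  \sum_(0 <= m < N.+1) \sum_(0 <= a < m) \sum_(a.+1 <= b < m.+1)
     H a (b - a)%N (m - b)%N =
  \sum_(0 <= a < N.+1) \sum_(0 <= e < N.+1) \sum_(0 <= c < N.+1) H a c.+1 e.
Proof.
move=> H0; pose G a k := \sum_(0 <= c < k) H a c.+1 (k - c.+1)%N.
transitivity (\sum_(0 <= m < N.+1) \sum_(0 <= a < m) G a (m - a.+1).+1).
  apply: eq_bigr => m _; rewrite big_nat [RHS]big_nat; apply: eq_bigr => a /andP[_ am].
  rewrite -{1}[a.+1]add0n big_addn subSS /G subnSK//.
  by apply: eq_bigr => c _; congr (H _ _ _); lia.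
rewrite (big_nat_triangle (H := fun a e => G a e.+1)); last first.
  by move=> a e h; rewrite /G big_nat big1// => c /andP[_ ce]; apply: H0; lia.
apply: eq_bigr => a _.
transitivity (\sum_(0 <= k < N.+2) G a k).
  have G0 : G a 0%N = 0 by rewrite /G big_geq.
  by rewrite [RHS]big_nat_recl// G0 add0r.
rewrite (big_nat_triangle (H := fun c e => H a c.+1 e)); last first.
  by move=> c e h; apply: H0; lia.
rewrite exchange_big /= (big_nat_trim (n := N.+1)) //; last first.
  by move=> k h; rewrite big1 // => i _; apply: H0; lia.
apply: eq_bigr => e _; rewrite (big_nat_trim (n := N.+1)) //.
by move=> k h; apply: H0; lia.
Qed.

End NatSums.

(** * Leibniz rules for derivations of a commutative ring *)

Definition sumpred (l : seq nat) : nat := sumn [seq x.-1 | x <- l].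

Section Derivations.
Variables (A : comPzRingType) (K : {rmorphism rat -> A}).
Variables (V : eqType) (d : V -> A -> A).
Hypothesis dD : forall x, {morph d x : f g / f + g}.
Hypothesis dM : forall x f g, d x (f * g) = d x f * g + f * d x g.
Hypothesis dK : forall x c, d x (K c) = 0.

Lemma der0 x : d x 0 = 0.
Proof. by rewrite -{1}(rmorph0 K) dK. Qed.

Lemma der_sum x (I : Type) (r : seq I) (P : pred I) (F : I -> A) :
  d x (\sum_(i <- r | P i) F i) = \sum_(i <- r | P i) d x (F i).
Proof. exact: (big_morph _ (dD x) (der0 x)). Qed.

Lemma der_wsum x (T : Type) (X : seq T) m (F : seq T -> A) :
  d x (wsum X m F) = wsum X m (fun z => d x (F z)).
Proof. exact: (wsum_morph _ _ _ (der0 x) (dD x)). Qed.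

Lemma derKM x c f : d x (K c * f) = K c * d x f.
Proof. by rewrite dM dK mul0r add0r. Qed.

Lemma der1 x : d x 1 = 0.
Proof. by rewrite -(rmorph1 K) dK. Qed.

Lemma derMn x n f : d x (f *+ n) = d x f *+ n.
Proof. by elim: n => [|n IH]; rewrite ?mulr0n ?der0// !mulrS dD IH. Qed.

Lemma iter_der0 x l : iter l (d x) 0 = 0.
Proof. by elim: l => //= l ->; rewrite der0. Qed.

Lemma iter_derKM x l c f : iter l (d x) (K c * f) = K c * iter l (d x) f.
Proof. by elim: l => //= l ->; rewrite derKM. Qed.

Lemma iter_derD x l : {morph iter l (d x) : f g / f + g}.
Proof. by move=> f g; elim: l => //= l ->; rewrite dD. Qed.

Lemma iter_derM x l f g : iter l (d x) (f * g) =
  \sum_(0 <= k < l.+1) (iter k (d x) f * iter (l - k) (d x) g) *+ 'C(l, k).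
Proof.
elim: l => [|l IH]; first by rewrite big_nat1.
rewrite iterS IH der_sum.
under eq_bigr => k _ do rewrite derMn dM mulrnDl.
rewrite big_split /= big_nat_recr//= subnn /= binn.
rewrite [X in _ + X = _]big_nat_recl//= bin0 ?subn0.
rewrite [RHS]big_nat_recl//= [X in _ = _ + X]big_nat_recr//=.
rewrite bin0 binn subnn /= addrCA; congr (_ + _).
rewrite addrAC; congr (_ + _).
rewrite -big_split /= big_nat [RHS]big_nat; apply: eq_bigr => k /andP[_ kl].
rewrite binS mulrnDr addrC; congr (_ + _).
by rewrite subSS -(subnSK kl).
Qed.

(** The multinomial Leibniz rule. A letter of t is one more than the number of derivatives that hit
    its factor: a factor w(a, 1) then becomes w(a, y) for the letter y, and the multinomial
    coefficient is the quotient of factorials in the recursion for T. *)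
Lemma iter_der_prod x N l (s : seq A) : (l < N)%N ->
  iter l (d x) (\prod_(f <- s) f) =
  wsum (iota 1 N) (size s) (fun t => if sumpred t == l then
     K (l`!%:R / (\prod_(y <- t) y.-1`!)%:R)
     * \prod_(q <- zip s t) iter q.2.-1 (d x) q.1 else 0).
Proof.
elim: s l => [|f s IH] l lN /=.
  rewrite !big_nil /sumpred /=; case: l {lN} => [|l].
    by rewrite divff// rmorph1 mulr1.
  by rewrite iterSr der1 iter_der0.
rewrite big_cons iter_derM.
have -> : iota 1 N = index_iota 1 N.+1 by rewrite /index_iota subn1.
rewrite [RHS](big_cat_nat (n := l.+2))//=.
rewrite [X in _ = _ + X]big_nat [X in _ = _ + X]big1 ?addr0; last first.
  move=> a /andP[an _]; apply: wsum0 => z _ _.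
  by rewrite /sumpred /=; case: eqP => // h; lia.
rewrite [RHS]big_add1 /= big_nat [RHS]big_nat; apply: eq_bigr => k /andP[_ kl].
rewrite IH; last by lia.
rewrite mulr_wsumr -mulr_natl mulr_wsumr.
rewrite /index_iota subn1 /=; apply: eq_wsumr => t.
rewrite /sumpred /= -/(sumpred t).
have -> : (k + sumpred t == l)%N = (sumpred t == l - k)%N by apply/eqP/eqP; lia.
case: eqP => ht; last by rewrite !mulr0.
rewrite !big_cons /= natrM.
have hb : ('C(l, k) * (k`! * (l - k)`!) = l`!)%N by rewrite bin_fact//; lia.
rewrite -(rmorph_nat K).
have P0 : (\prod_(y <- t) y.-1`!)%:R != 0 :> rat.
  by rewrite pnatr_eq0 -lt0n; apply: prodn_gt0 => i; exact: fact_gt0.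
have k0 : k`!%:R != 0 :> rat by rewrite pnatr_eq0 -lt0n fact_gt0.
have -> : l`!%:R / (k`!%:R * (\prod_(y <- t) (y.-1)`!)%:R) =
  'C(l, k)%:R * ((l - k)`!%:R / (\prod_(y <- t) (y.-1)`!)%:R) :> rat.
  rewrite -hb !natrM; field; by apply/andP.
by rewrite rmorphM; ring.
Qed.

Lemma der_prod x (s : seq A) : d x (\prod_(f <- s) f) =
  \sum_(0 <= q < size s) (\prod_(f <- take q s) f) * d x (nth 0 s q)
     * \prod_(f <- drop q.+1 s) f.
Proof.
elim: s => [|f s IH] /=; first by rewrite big_nil der1 big_geq.
rewrite big_cons dM IH [RHS]big_nat_recl//= big_nil mul1r drop0; congr (_ + _).
rewrite big_distrr /=; apply: eq_bigr => q _.
by rewrite big_cons !mulrA.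
Qed.

End Derivations.

(** * Pure derivatives from the second ones *)

Arguments wsum : simpl never.

Definition words (N : nat) : seq (nat * nat) :=
  [seq (s, l) | s <- iota 1 N, l <- iota 1 N].

Lemma mem_words N x :
  (x \in words N) = (0 < x.1 <= N)%N && (0 < x.2 <= N)%N.
Proof.
apply/allpairsP/idP => [[[a b] /= []]|].
  by rewrite !mem_iota => /andP[? ?] /andP[? ?] -> /=; lia.
case: x => a b /= h; exists (a, b); rewrite /= !mem_iota.
by split=> //; lia.
Qed.

Lemma size_words N (z : seq (nat * nat)) : all (mem (words N)) z ->
  (size z <= sumn (unzip1 z))%N /\ sumn (unzip2 z) = (sumpred (unzip2 z) + size z)%N.
Proof.
elim: z => //= -[s l] z IH /andP[]; rewrite mem_words /= => h /IH[h1 h2].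
by rewrite /sumpred /= -/(sumpred _) h2; split; lia.
Qed.

(** A word [z] of pairs (s_q, l_q) encodes the two rows of T_I, and it is
    admissible when the constraints on their sums hold. *)
Definition admissible (I : seq nat) (z : seq (nat * nat)) : bool :=
  (sumn (unzip1 z) == sumn I)%N && (sumn (unzip2 z) + 2 == size z + size I)%N.

(** [Trev] does not test the constraints on the row sums; cutting it off outside the admissible
    words allows sums over free words. *)
Definition Tcoef (I : seq nat) (z : seq (nat * nat)) : rat :=
  if admissible I z then Trev I (unzip1 z) (unzip2 z) else 0.

(** The coefficient of [\prod_(q <- y) w q] in [d_i (w (s, l)) / i], where
    [w (s, l)] is d_0^l d_s v / s; see [der_dfactor]. *)
Definition Tmerge (i s l : nat) (y : seq (nat * nat)) : rat :=
  if (sumn (unzip1 y) == s + i)%N && (sumpred (unzip2 y) == l)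
  then Tnum s i (unzip1 y) * (l`!%:R / (\prod_(q <- unzip2 y) q.-1`!)%:R)
  else 0.

(** One summand of the recursion for T, for the word cut as z1, y, z2: the block y is contracted to
    the single letter (s, l). *)
Definition Tstep (i : nat) (I : seq nat) (z1 y z2 : seq (nat * nat)) : rat :=
  let s := (sumn (unzip1 y) - i)%N in
  let l := sumpred (unzip2 y) in
  if admissible (i :: I) (z1 ++ y ++ z2) && ((0 < s)%N && (0 < l)%N) then
    Trev I (unzip1 z1 ++ s :: unzip1 z2) (unzip2 z1 ++ l :: unzip2 z2)
    * Tnum s i (unzip1 y) * (l`!%:R / (\prod_(q <- unzip2 y) q.-1`!)%:R)
  else 0.

(** A derivative d_i replaces a letter x by a word y. Given y, only the letter x = (s, l) with s =
    (sum of the s-row of y) - i and l = [sumpred] of its l-row can have produced it, so the sum has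
    at most one nonzero term, and that term is the summand of the recursion. *)
Lemma sum_Tmerge N i I (z1 y z2 : seq (nat * nat)) :
  (0 < i)%N -> all (leq 1) I -> (sumn (i :: I) <= N)%N ->
  all (mem (words N)) z1 -> all (mem (words N)) y -> all (mem (words N)) z2 ->
  \sum_(x <- words N) Tcoef I (z1 ++ x :: z2) * Tmerge i x.1 x.2 y =
  Tstep i I z1 y z2.
Proof.
move=> i0 Ipos sN h1 hy h2.
have szI : (size I <= sumn I)%N.
  by elim: I Ipos {sN} => //= j J IH /andP[j0 /IH]; lia.
have [l1 e1] := size_words h1; have [ly ey] := size_words hy.
have [l2 e2] := size_words h2; move: sN => /= sN.
pose s := (sumn (unzip1 y) - i)%N; pose l := sumpred (unzip2 y).
have admE t m : admissible I (z1 ++ (t, m) :: z2) =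
  (sumn (unzip1 z1) + t + sumn (unzip1 z2) == sumn I)%N &&
  (sumn (unzip2 z1) + m + sumn (unzip2 z2) + 2 == size z1 + 1 + size z2 + size I)%N.
  rewrite /admissible /unzip1 /unzip2 !map_cat /= !sumn_cat /= size_cat /=.
  by congr andb; apply/eqP/eqP; lia.
have admE' : admissible (i :: I) (z1 ++ y ++ z2) =
  (sumn (unzip1 z1) + sumn (unzip1 y) + sumn (unzip1 z2) == i + sumn I)%N &&
  (sumn (unzip2 z1) + l + sumn (unzip2 z2) + 2 == size z1 + 1 + size z2 + size I)%N.
  rewrite /admissible /unzip1 /unzip2 !map_cat /= !sumn_cat /= !size_cat /=.
  rewrite -!/(unzip1 _) -!/(unzip2 _) ey -/l.
  by congr andb; apply/eqP/eqP; lia.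
rewrite /Tstep -/s -/l.
case: ifP => [/andP[ha /andP[s0 l0]]|hn]; last first.
  suff H (t m : nat) : (t, m) \in words N ->
      Tcoef I (z1 ++ (t, m) :: z2) * Tmerge i t m y = 0.
    by rewrite big_seq big1// => -[t m] /H.
  rewrite /Tcoef /Tmerge /=; case: ifP => [ha|]; last by rewrite mul0r.
  case: ifP => [/andP[/eqP ht /eqP hm]|]; last by rewrite mulr0.
  rewrite mem_words /= => htm; move: ha; rewrite admE /= => /andP[/eqP a1 /eqP a2].
  case/negP: hn; rewrite admE' /s /l; lia.
move: (ha); rewrite admE' => /andP[/eqP a1 /eqP a2].
(* Admissibility forces l < [size I], so the letter lies in the alphabet. *)
have slN : (s, l) \in words N.
  move: s0 l0 a2; rewrite mem_words /= /s /l. lia.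
rewrite (bigD1_seq (s, l)) //=; last by
  apply: allpairs_uniq; rewrite ?iota_uniq// => -[? ?] [? ?] _ _ /= [-> ->].
suff H (t m : nat) : (t, m) != (s, l) ->
    Tcoef I (z1 ++ (t, m) :: z2) * Tmerge i t m y = 0.
  rewrite big1 ?addr0; last by case=> t m /H.
  rewrite /Tcoef /Tmerge admE ifT; last first.
    by move: s0; rewrite /s => s0; apply/andP; split; apply/eqP; lia.
  rewrite ifT; last first.
    by move: s0; rewrite /s /l => s0; apply/andP; split; apply/eqP => /=; lia.
  by rewrite /unzip1 /unzip2 !map_cat /= mulrA.
move=> htm; rewrite /Tcoef /Tmerge /=.
case: ifP => [|]; last by rewrite mul0r.
case: ifP => [/andP[/eqP b1 /eqP b2]|]; last by rewrite mulr0.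
by case/eqP: htm; congr pair; rewrite /s /l; lia.
Qed.

Lemma Tcoef_cons i I (z : seq (nat * nat)) : (2 <= size I)%N ->
  Tcoef (i :: I) z = \sum_(0 <= a < size z) \sum_(a.+1 <= b < (size z).+1)
     Tstep i I (take a z) (drop a (take b z)) (drop b z).
Proof.
move=> sI; rewrite /Tcoef /Tstep.
have -> : Trev (i :: I) (unzip1 z) (unzip2 z) =
  (\sum_(0 <= a < size (unzip1 z)) \sum_(a.+1 <= b < (size (unzip1 z)).+1)
         let s' := (sumn (slice a b (unzip1 z)) - i)%N in
         let l' := sumn [seq x.-1 | x <- slice a b (unzip2 z)] in
         if (0 < s')%N && (0 < l')%N then
           Trev I (take a (unzip1 z) ++ s' :: drop b (unzip1 z))
              (take a (unzip2 z) ++ l' :: drop b (unzip2 z))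
           * Tnum s' i (slice a b (unzip1 z))
           * (l'`!%:R / (\prod_(x <- slice a b (unzip2 z)) (x.-1)`!)%:R)
         else 0)%R.
  by case: I sI => [|? []].
have catE a b : (a <= b)%N -> take a z ++ drop a (take b z) ++ drop b z = z.
  by move=> ab; rewrite catA -{1}(take_takel z ab) cat_take_drop cat_take_drop.
case: ifP => ha; last first.
  rewrite big1// => a _; rewrite big_nat big1// => b /andP[ab _].
  by rewrite catE ?ha ?(ltnW ab).
rewrite size_map; apply: eq_bigr => a _.
rewrite big_nat [RHS]big_nat; apply: eq_bigr => b /andP[ab _].
rewrite catE ?(ltnW ab)// ha /= /slice /sumpred.
by rewrite /unzip1 /unzip2 !map_take !map_drop !map_take.
Qed.

Section Expansion.
Variables (A : comPzRingType) (K : {rmorphism rat -> A}).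
Variables (V : eqType) (d : V -> A -> A).
Hypothesis dD : forall x, {morph d x : f g / f + g}.
Hypothesis dM : forall x f g, d x (f * g) = d x f * g + f * d x g.
Hypothesis dK : forall x c, d x (K c) = 0.
Variables (o : V) (x : nat -> V) (v : A).
Local Notation u := (foldr d v).
Hypothesis perm_u : forall xs ys, perm_eq xs ys -> u xs = u ys.

Definition dfactor (q : nat * nat) : A :=
  K q.1%:R^-1 * u (nseq q.2 o ++ [:: x q.1]).
Local Notation w := dfactor.
Local Notation M z := (\prod_(q <- z) w q).

Hypothesis u2 : forall i j, (0 < i)%N -> (0 < j)%N -> u [:: x i; x j] =
  K (i * j)%:R * \sum_(1 <= m < (i + j).+1) \sum_(p <- compositions (i + j) m)
     K (Tnum i j p) * \prod_(a <- p) w (a, 1%N).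

Lemma iter_u l xs : iter l (d o) (u xs) = u (nseq l o ++ xs).
Proof. by elim: l => //= l ->. Qed.

Lemma iter_dfactor l q : iter l (d o) (w q) = w (q.1, (l + q.2)%N).
Proof.
by rewrite /w (iter_derKM dM dK) iter_u catA -nseqD.
Qed.

Lemma u2_wsum N i j : (0 < i)%N -> (0 < j)%N -> (i + j <= N)%N ->
  u [:: x i; x j] =
  K (i * j)%:R * \sum_(0 <= c < N.+1) wsum (iota 1 N) c.+1 (fun p =>
    if sumn p == (i + j)%N then K (Tnum i j p) * \prod_(a <- p) w (a, 1%N) else 0).
Proof.
move=> i0 j0 ijN; rewrite u2//; congr (_ * _).
rewrite (big_nat_trim (n := (i + j)%N)) ?(leqW ijN)//; last first.
  move=> k hk; apply: wsum0 => p szp hp; case: eqP => // e.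
  have : (size p <= sumn p)%N.
    elim: p hp {szp e} => //= a p IH /andP[]; rewrite mem_iota => ? /IH; lia.
  by rewrite e szp; lia.
rewrite big_add1 /=; apply: eq_bigr => m _.
by rewrite (sum_compositions _ _ ijN).
Qed.

(** The normalisation 1/s in w(s, l) cancels the factor s in [u2] and leaves i alone. This is why
    the prefactor of the expansion is the plain product of the indices. *)
Lemma der_dfactor N i s l : (0 < i)%N -> (0 < s)%N -> (s + i <= N)%N -> (l < N)%N ->
  d (x i) (w (s, l)) = K i%:R * \sum_(0 <= c < N.+1)
    wsum (words N) c.+1 (fun y => K (Tmerge i s l y) * M y).
Proof.
move=> i0 s0 siN lN; rewrite [in LHS]/w /= (derKM dM dK).
have -> : d (x i) (u (nseq l o ++ [:: x s])) = iter l (d o) (u [:: x s; x i]).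
  rewrite iter_u -/(u (x i :: nseq l o ++ [:: x s])); apply: perm_u.
  by rewrite -cat1s perm_catC -catA.
rewrite (u2_wsum s0 i0 siN) (iter_derKM dM dK) mulrA -rmorphM natrM mulKf; last first.
  by rewrite pnatr_eq0 -lt0n.
congr (_ * _).
have iD := iter_derD dD o l; have i0' := iter_der0 dK o l.
rewrite (big_morph _ iD i0'); apply: eq_bigr => c _.
rewrite (wsum_morph _ _ _ i0' iD) /words.
pose F (p t : seq nat) := if (sumn p == s + i)%N && (sumpred t == l)
  then K (Tnum s i p * (l`!%:R / (\prod_(q <- t) q.-1`!)%:R)) *
       \prod_(q <- zip p t) w q else 0.
transitivity (wsum (iota 1 N) c.+1 (fun p => wsum (iota 1 N) c.+1 (F p))).
  apply: eq_wsum => p szp hp; rewrite [LHS]/=; case: eqP => hs; last first.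
    by rewrite i0' wsum0// => t _ _; rewrite /F; case: eqP.
  rewrite (iter_derKM dM dK) -(big_map (fun a => w (a, 1%N)) xpredT id).
  rewrite (iter_der_prod dD dM dK _ _ lN) size_map szp mulr_wsumr.
  apply: eq_wsum => t szt ht; rewrite /F hs eqxx /=.
  case: ifP => _; last by rewrite mulr0.
  rewrite mulrA -rmorphM; congr (_ * _).
  have : size p = size t by rewrite szp szt.
  elim: p t ht {hp szp szt hs} => [|a p IH] [|b t] //=.
    by rewrite !big_nil.
  move=> /andP[]; rewrite mem_iota => b0 /IH{}IH [/IH e]; rewrite !big_cons e.
  rewrite iter_dfactor /=; congr (w (_, _) * _); lia.
rewrite -wsum_pair; apply: eq_wsum => z _ _; rewrite /F /Tmerge.
case: ifP => _; last by rewrite rmorph0 mul0r.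
by rewrite zip_unzip.
Qed.

Lemma der_dfactors i (z : seq (nat * nat)) : d (x i) (M z) = \sum_(0 <= q < size z)
  M (take q z) * d (x i) (w (nth (0, 0)%N z q)) * M (drop q.+1 z).
Proof.
rewrite -(big_map w xpredT id) (der_prod dM dK) size_map.
rewrite big_nat [RHS]big_nat; apply: eq_bigr => q /andP[_ qz].
by rewrite -map_take -map_drop !big_map (nth_map (0, 0)%N).
Qed.

Lemma admissible_size N I z : all (mem (words N)) z -> admissible I z ->
  (size z <= sumn I)%N.
Proof. by move=> /size_words[+ _] /andP[/eqP <- _]. Qed.

(** The head of I is the outermost derivative, hence the last index of T_I; this matches the
    reversed order of indices in [Trev]. *)
Theorem pure_expansion N I : (2 <= size I)%N -> all (leq 1) I -> (sumn I <= N)%N ->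
  u (map x I) = K (\prod_(i <- I) i)%:R *
    \sum_(0 <= m < N.+1) wsum (words N) m (fun z => K (Tcoef I z) * M z).
Proof.
elim: I => // i I IH sI /andP[i0 Ipos] sN.
have {sI} := sI; rewrite /= ltnS leq_eqVlt => /orP[|sI].
  case: I Ipos sN {IH} => [|j []]//= /andP[j0 _] sN _.
  have sN' : (j + i <= N)%N by lia.
  (* In the base case [Trev [:: i; j]] is [Tnum j i], so the two derivatives are exchanged before
     [u2] is applied. *)
  rewrite -/(u [:: x i; x j]) (perm_u (ys := [:: x j; x i])); last first.
    by rewrite (perm_catC [:: x i] [:: x j]).
  have -> : (\prod_(i <- [:: i; j]) i = j * i)%N.
    by rewrite !big_cons big_nil muln1 mulnC.
  rewrite (u2_wsum j0 i0 sN'); congr (_ * _).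
  rewrite [RHS]big_nat_recl//.
  have -> : wsum (words N) 0 (fun z => K (Tcoef [:: i; j] z) * M z) = 0.
    rewrite /wsum /Tcoef /admissible /= ifF ?rmorph0 ?mul0r//.
    by apply/negP => /andP[/eqP]; lia.
  rewrite add0r [LHS]big_nat_recr//= [X in _ + X]wsum0 ?addr0; last first.
    move=> z szz hz; case: eqP => // e.
    have : (size z <= sumn z)%N.
      by elim: z hz {szz e} => //= a p IH /andP[]; rewrite mem_iota => ? /IH; lia.
    by rewrite e szz; lia.
  apply: eq_bigr => c _.
  pose F (p t : seq nat) := if all (pred1 1%N) t then (if (sumn p == j + i)%N then
    K (Tnum j i p) * \prod_(a <- p) w (a, 1%N) else 0) else 0.
  transitivity (wsum (iota 1 N) c.+1 (fun p => wsum (iota 1 N) c.+1 (F p))).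
    apply: eq_wsumr => p; rewrite (wsum_pred1 _ (fun=> _))//; lia.
  rewrite -wsum_pair; apply: eq_wsum => z szz hz.
  have [l1 e1] := size_words hz.
  have hz2 : all (leq 1) (unzip2 z).
    apply/allP => a /mapP[q qz ->]; move/allP: hz => /(_ _ qz).
    by rewrite inE mem_words => /andP[_ /andP[]].
  have all1 : all (pred1 1%N) (unzip2 z) = (sumn (unzip2 z) == size z).
    rewrite -(size_map snd z) -/(unzip2 z).
    have szu : (size (unzip2 z) <= sumn (unzip2 z))%N.
      by elim: (unzip2 z) hz2 => //= a t IH /andP[? /IH]; lia.
    elim: (unzip2 z) hz2 szu => //= a t IH /andP[a1 ht] _.
    have szt : (size t <= sumn t)%N.
      by elim: t ht {IH} => //= b t IH /andP[? /IH]; lia.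
    by rewrite (IH ht szt) eqE /=; apply/andP/idP => [[]|] *; lia.
  rewrite /F /Tcoef /admissible /= all1.
  have -> : (sumn (unzip2 z) + 2 == size z + 2)%N = (sumn (unzip2 z) == size z)%N.
    by rewrite eqn_add2r.
  rewrite addn0 (addnC j).
  have [h1|h1] := eqVneq (sumn (unzip2 z)) (size z); last first.
    by rewrite andbF rmorph0 mul0r.
  rewrite andbT; case: eqP => h2; last by rewrite rmorph0 mul0r.
  rewrite ?all1 ?h1 ?eqxx; congr (_ * _).
  rewrite big_map big_seq [RHS]big_seq; apply: eq_bigr => -[a b] abz /=.
  have /allP/(_ b) := etrans all1 (introT eqP h1).
  by move=> /(_ (map_f snd abz)) /eqP /= ->.
have sN' : (sumn I <= N)%N by move: sN => /=; lia.
rewrite /= (IH sI Ipos sN') (derKM dM dK) big_cons natrM rmorphM.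
rewrite [K i%:R * _]mulrC -mulrA.
congr (_ * _).
rewrite (der_sum dD dK).
(* In H the letter y between z1 and z2 is the one to be differentiated; in H3 the word y is the
   block that replaces it. The lengths of the pieces are a, c and e. *)
pose H a e := wsum (words N) a (fun z1 => \sum_(y <- words N) wsum (words N) e
  (fun z2 => K (Tcoef I (z1 ++ y :: z2)) * (M z1 * d (x i) (w y) * M z2))).
pose H3 a c e := wsum (words N) a (fun z1 => wsum (words N) c (fun y =>
  wsum (words N) e (fun z2 => K (Tstep i I z1 y z2) * (M z1 * M y * M z2)))).
transitivity (\sum_(0 <= m < N.+1) \sum_(0 <= q < m) H q (m - q.+1)%N).
  apply: eq_bigr => m _; rewrite (der_wsum dD dK).
  transitivity (wsum (words N) m (fun z => \sum_(0 <= q < m)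
      K (Tcoef I z) * (M (take q z) * d (x i) (w (nth (0, 0)%N z q)) * M (drop q.+1 z)))).
    by apply: eq_wsum => z <- _; rewrite (derKM dM dK) der_dfactors big_distrr.
  rewrite wsum_sum big_nat [RHS]big_nat; apply: eq_bigr => q /andP[_ qm].
  rewrite -[in LHS](subnKC qm) addSnnS wsum_cat /H.
  apply: eq_wsum => z1 sz1 _; apply: eq_bigr => y _.
  apply: eq_wsumr => z2; rewrite take_size_cat// nth_cat sz1 ltnn subnn.
  by rewrite drop_cat sz1 ltnNge leqnSn /= subSn// subnn /= drop0.
rewrite big_nat_triangle; last first.
  move=> a e ha; apply: wsum0 => z1 sz1 hz1; rewrite big_seq big1// => y hy.
  apply: wsum0 => z2 sz2 hz2; rewrite /Tcoef ifF ?rmorph0 ?mul0r//.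
  apply/negP => /(@admissible_size N) h.
  have /h : all (mem (words N)) (z1 ++ y :: z2) by rewrite all_cat hz1 /= hz2 andbT.
  by rewrite size_cat /= sz1 sz2; lia.
transitivity (K i%:R * \sum_(0 <= m < N.+1) \sum_(0 <= a < m)
    \sum_(a.+1 <= b < m.+1) H3 a (b - a)%N (m - b)%N); last first.
  congr (_ * _); apply: eq_bigr => m _.
  transitivity (wsum (words N) m (fun z => \sum_(0 <= a < m) \sum_(a.+1 <= b < m.+1)
      K (Tstep i I (take a z) (drop a (take b z)) (drop b z)) * M z)).
    rewrite wsum_sum; apply: eq_bigr => a _.
    rewrite wsum_sum big_nat [RHS]big_nat; apply: eq_bigr => b /andP[ab bm].
    have e : m = (a + ((b - a) + (m - b)))%N by lia.
    rewrite [in RHS]e wsum_cat /H3; apply: eq_wsum => z1 sz1 _.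
    rewrite wsum_cat; apply: eq_wsum => y sy _; apply: eq_wsumr => z2.
    have sb : size (z1 ++ y) = b by rewrite size_cat sz1 sy; lia.
    rewrite take_size_cat// catA take_size_cat// drop_size_cat// drop_size_cat//.
    by rewrite !big_cat.
  apply: eq_wsum => z <- _; rewrite (Tcoef_cons _ _ sI) rmorph_sum big_distrl /=.
  by apply: eq_bigr => a _; rewrite rmorph_sum big_distrl.
rewrite big_nat_triangle3; last first.
  move=> a c e ha; apply: wsum0 => z1 sz1 hz1; apply: wsum0 => y sy hy.
  apply: wsum0 => z2 sz2 hz2; rewrite /Tstep ifF ?rmorph0 ?mul0r//.
  apply/negP => /andP[/(@admissible_size N) h _].
  have /h : all (mem (words N)) (z1 ++ y ++ z2) by rewrite !all_cat hz1 hy hz2.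
  by rewrite !size_cat /= sz1 sz2 sy; move: sN => /=; lia.
rewrite big_distrr; apply: eq_bigr => a _ /=.
rewrite big_distrr; apply: eq_bigr => e _ /=.
rewrite -wsum_sum mulr_wsumr /H.
transitivity (wsum (words N) a (fun z1 => \sum_(y0 <- words N) wsum (words N) e
  (fun z2 => K i%:R * \sum_(0 <= c < N.+1) wsum (words N) c.+1 (fun y =>
    K (Tcoef I (z1 ++ y0 :: z2) * Tmerge i y0.1 y0.2 y) * (M z1 * M y * M z2))))).
  apply: eq_wsum => z1 sz1 hz1; rewrite big_seq [RHS]big_seq.
  apply: eq_bigr => -[s l] hy0; apply: eq_wsum => z2 sz2 hz2.
  (* The bounds required by [der_dfactor] hold for letters of admissible words; for the other words
     both sides vanish. *)
  have [ha|ha] := boolP (admissible I (z1 ++ (s, l) :: z2)); last first.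
    rewrite /Tcoef (negPf ha) rmorph0 mul0r big1 ?mulr0// => c _.
    by apply: wsum0 => y _ _; rewrite mul0r rmorph0 mul0r.
  have [l1 e1] := size_words hz1; have [l2 e2] := size_words hz2.
  move: hy0; rewrite mem_words /= => /andP[/andP[s0 sN0] /andP[l0 lN0]].
  have szI : (size I <= sumn I)%N.
    by elim: (I) Ipos => //= j J IHJ /andP[j0 /IHJ]; lia.
  have [a1 a2] : (s + i <= N)%N /\ (l < N)%N.
    move: ha; rewrite /admissible /unzip1 /unzip2 !map_cat /= !sumn_cat /=.
    rewrite size_cat /= -!/(unzip1 _) -!/(unzip2 _) => /andP[/eqP b1 /eqP b2].
    by move: sN => /=; split; lia.
  rewrite (der_dfactor i0 s0 a1 a2).
  rewrite [M z1 * _]mulrCA -[_ * _ * M z2]mulrA mulrCA; congr (_ * _).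
  rewrite [M z1 * _]big_distrr big_distrl big_distrr /=; apply: eq_bigr => c _.
  rewrite mulr_wsumr mulr_wsuml mulr_wsumr; apply: eq_wsumr => y.
  by rewrite rmorphM; ring.
apply: eq_wsum => z1 sz1 hz1.
pose E y0 z2 y := K (Tcoef I (z1 ++ y0 :: z2) * Tmerge i y0.1 y0.2 y)
  * (M z1 * M y * M z2).
transitivity (\sum_(y0 <- words N) \sum_(0 <= c < N.+1) K i%:R *
  wsum (words N) c.+1 (fun y => wsum (words N) e (fun z2 => E y0 z2 y))).
  apply: eq_bigr => y0 _; rewrite -mulr_wsumr wsum_sum big_distrr /=.
  by apply: eq_bigr => c _; rewrite wsum_exchange.
rewrite exchange_big /= big_distrr; apply: eq_bigr => c _ /=.
(* With z1, y and z2 fixed, the sum over the differentiated letter y0 is the one computed by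
   [sum_Tmerge]. *)
rewrite -big_distrr -wsum_sum; congr (_ * _); apply: eq_wsum => y sy hy.
rewrite -wsum_sum; apply: eq_wsum => z2 sz2 hz2.
by rewrite -(sum_Tmerge i0 Ipos sN hz1 hy hz2) rmorph_sum big_distrl.
Qed.

End Expansion.

(** * Mixed derivatives *)

Section Distribution.
Variables (A : comPzRingType) (K : {rmorphism rat -> A}).
Variables (V : eqType) (d : V -> A -> A).
Hypothesis dD : forall x, {morph d x : f g / f + g}.
Hypothesis dM : forall x f g, d x (f * g) = d x f * g + f * d x g.
Hypothesis dK : forall x c, d x (K c) = 0.

Lemma der_bigprod (I : eqType) (r : seq I) x (g : I -> A) : uniq r ->
  d x (\prod_(p <- r) g p) =
  \sum_(q <- r) \prod_(p <- r) (if p == q then d x (g p) else g p).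
Proof.
elim: r => [|a r IH] /=; first by rewrite !big_nil (der1 dK).
move=> /andP[ar /IH{}IH]; rewrite big_cons dM IH [RHS]big_cons big_cons eqxx.
congr (_ * _ + _).
  rewrite big_seq [RHS]big_seq; apply: eq_bigr => p pr.
  by case: eqP => // pa; rewrite -pa pr in ar.
rewrite big_distrr /= big_seq [RHS]big_seq; apply: eq_bigr => q qr.
rewrite [RHS]big_cons; case: eqP => // aq; by rewrite aq qr in ar.
Qed.

Lemma der_ordprod m x (g : 'I_m -> A) : d x (\prod_(p < m) g p) =
  \sum_(q < m) \prod_(p < m) (if p == q then d x (g p) else g p).
Proof. by rewrite der_bigprod// index_enum_uniq. Qed.

Definition block m (J : seq nat) (e : {ffun 'I_(size J) -> 'I_m}) (p : 'I_m) :=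
  [seq nth 0%N J q | q : 'I_(size J) <- enum 'I_(size J) & e q == p].

(** Puts a new first entry into block q. Every distribution of [j :: J] arises from exactly one pair
    (q, e), which gives the reindexing in [foldr_der_prod]. *)
Definition consf m n (q : 'I_m) (e : {ffun 'I_n -> 'I_m}) : {ffun 'I_n.+1 -> 'I_m} :=
  [ffun i => if unlift ord0 i is Some j then e j else q].

Lemma block_consf m j J q (e : {ffun 'I_(size J) -> 'I_m}) p :
  block (J := j :: J) (consf q e) p =
  if p == q then j :: block e p else block e p.
Proof.
have hl i : consf q e (lift ord0 i) = e i.
  by rewrite ffunE liftK.
have h0 : consf q e ord0 = q by rewrite ffunE unlift_none.
rewrite /block /= enum_ordSl /= h0.
rewrite filter_map eq_sym.
have -> : [seq x <- enum 'I_(size J) | preim (lift ord0) (fun q0 => consf q e q0 == p) x]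
  = [seq x <- enum 'I_(size J) | e x == p].
  by apply: eq_filter => i /=; rewrite hl.
by case: eqP => _ /=; rewrite -map_comp.
Qed.

(** Each derivative falls on one factor. Recording which one gives a map from the positions of J to
    the factors, so equal entries at different positions are kept apart, as in the definition of
    S. *)
Lemma foldr_der_prod (X : nat -> V) m (f : 'I_m -> A) J :
  foldr d (\prod_(p < m) f p) (map X J) =
  \sum_(e : {ffun 'I_(size J) -> 'I_m})
    \prod_(p < m) foldr d (f p) (map X (block e p)).
Proof.
elim: J => [|j J IH] /=.
  rewrite (bigD1 (ffun0 (card_ord 0))) //= [X in _ = _ + X]big1 ?addr0; last first.
    by move=> e ne; case/eqP: ne; apply/ffunP => -[].
  by apply: eq_bigr => p _; rewrite /block enum_ord0.
rewrite IH (der_sum dD dK).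
transitivity (\sum_(e : {ffun 'I_(size J) -> 'I_m}) \sum_(q < m) \prod_(p < m)
    (if p == q then foldr d (f p) (map X (j :: block e p))
     else foldr d (f p) (map X (block e p)))).
  by apply: eq_bigr => e _; exact: der_ordprod.
rewrite exchange_big /= pair_big /=.
rewrite (reindex (fun qe : 'I_m * {ffun 'I_(size J) -> 'I_m} => consf qe.1 qe.2)) /=.
  apply: eq_bigr => -[q e] _; apply: eq_bigr => p _.
  by rewrite block_consf; case: eqP.
exists (fun e => (e ord0, [ffun i => e (lift ord0 i)])) => [[q e] _|e _] /=.
  rewrite ffunE unlift_none; congr pair; apply/ffunP => i.
  by rewrite !ffunE liftK.
by apply/ffunP => i; rewrite ffunE; case: unliftP => [j' ->|->//]; rewrite ffunE.
Qed.

End Distribution.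

Lemma sumn_block m J (e : {ffun 'I_(size J) -> 'I_m}) p :
  sumn (block e p) = (\sum_(q | e q == p) nth 0 J q)%N.
Proof.
by rewrite sumnE /block big_map big_filter big_enum_cond.
Qed.

Lemma size_block m J (e : {ffun 'I_(size J) -> 'I_m}) p :
  size (block e p) = #|[pred q | e q == p]|.
Proof.
rewrite /block size_map -sum1_size big_filter big_enum_cond sum1_card.
by apply: eq_card => q; rewrite !inE.
Qed.

Lemma prod_block m J (e : {ffun 'I_(size J) -> 'I_m}) :
  (\prod_(p < m) \prod_(j <- block e p) j = \prod_(j <- J) j)%N.
Proof.
rewrite (big_nth 0%N) big_mkord (partition_big e xpredT)//=.
by apply: eq_bigr => p _; rewrite /block big_map big_filter big_enum_cond.
Qed.

Lemma sum_size_block m J (e : {ffun 'I_(size J) -> 'I_m}) :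
  (\sum_(p < m) size (block e p) = size J)%N.
Proof.
rewrite -[RHS]card_ord -sum1_card (partition_big e xpredT)//=.
apply: eq_bigr => p _; rewrite size_block -sum1_card.
by apply: eq_bigl => q; rewrite !inE.
Qed.

Lemma block_pos m J (e : {ffun 'I_(size J) -> 'I_m}) p :
  all (leq 1) J -> all (leq 1) (block e p).
Proof.
move=> /allP Jp; apply/allP => a /mapP[q _ ->].
by apply: Jp; exact: mem_nth.
Qed.

Lemma Tnum_single i j : (0 < i)%N -> (0 < j)%N -> Tnum i j [:: (i + j)%N] = 1.
Proof.
move=> i0 j0; rewrite /Tnum /= big_nat1 big_compositionsS big_nat1.
rewrite big_compositions0 /= !big_cons !big_nil /= /reshape /=.
have -> : Pnum i j [:: ((i + j)%N + 0).-1] = 1%N.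
  rewrite /Pnum /=.
  have -> : compositions i 1 = [:: [:: i]].
    apply: perm_small_eq => //; apply: uniq_perm => //.
      exact: compositions_uniq.
    move=> c; rewrite mem_compositions inE; apply/and3P/eqP => [[]|->] /=.
      by case: c => [|a []]//= _ _; rewrite addn0 => /eqP ->.
    by rewrite i0 addn0 eqxx.
  by rewrite /= addn0 ifT//; lia.
by rewrite muln1 (_ : 1`! = 1)%N// expr2 mulrNN !invr1 !mulr1.
Qed.

(** A word of length 1 has a single cut, its factorials cancel, and T_ij of a one-part word is 1;
    hence T is 1 on the only admissible letter. These are the words that survive in the conjugate
    expansion. *)
Lemma Tcoef_single J s l : (2 <= size J)%N -> all (leq 1) J ->
  Tcoef J [:: (s, l)] = ((s == sumn J) && (l == (size J).-1))%:R :> rat.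
Proof.
elim: J s l => // j J IH s l; rewrite /= ltnS leq_eqVlt => /orP[|sJ].
  case: J {IH} => [|k []]//= _ /and3P[j0 k0 _].
  rewrite /Tcoef /admissible /= !addn0.
  have -> : (l + 2 == 1 + 2)%N = (l == 1)%N by rewrite eqn_add2r.
  case: eqP => [->|_] //=; case: eqP => [_|_] //=.
  by rewrite addnC Tnum_single.
move=> /andP[j0 Jp]; rewrite Tcoef_cons// big_nat1 big_nat1 /= /Tstep /=.
rewrite /sumpred /= !addn0.
have admE : admissible (j :: J) [:: (s, l)] = (s == j + sumn J)%N && (l == size J).
  by rewrite /admissible /= !addn0; congr andb; apply/eqP/eqP; lia.
rewrite admE; case: eqP => [->|]//=; case: eqP => [->|]//=.
have szJ : (0 < sumn J)%N by case: (J) Jp sJ => //= a t /andP[]; lia.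
rewrite addKn szJ /= ifT; last by lia.
have := IH (sumn J) (size J).-1 sJ Jp; rewrite /Tcoef /= ifT; last first.
  by rewrite /admissible /= !addn0 eqxx /=; lia.
move=> ->; rewrite !eqxx mul1r addnC Tnum_single// mul1r big_cons big_nil muln1.
by rewrite divff// pnatr_eq0 -lt0n fact_gt0.
Qed.

Lemma size_le_sumn J : all (leq 1) J -> (size J <= sumn J)%N.
Proof. by elim: J => //= j J IH /andP[j0 /IH]; lia. Qed.

Lemma foldr_morph (A : zmodType) (V : Type) (d : V -> A -> A) xs :
  (forall x, {morph d x : f g / f + g}) ->
  {morph foldr d^~ xs : f g / f + g}.
Proof. by move=> dD f g; elim: xs => //= x xs ->; rewrite dD. Qed.

Lemma prod_pairs (A : comPzSemiRingType) (f : nat * nat -> A) (z : seq (nat * nat)) :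
  \prod_(q <- z) f q = \prod_(p < size (unzip1 z))
     f (nth 0%N (unzip1 z) p, nth 0%N (unzip2 z) p).
Proof.
rewrite (big_nth (0, 0)%N) -(size_map fst z) -/(unzip1 z) big_mkord.
apply: eq_bigr => p _; have pz : (p < size z)%N by rewrite -(size_map fst z).
by rewrite !(nth_map (0, 0)%N)// -surjective_pairing.
Qed.

(** Why N is twice the sum: the l-row of an admissible word of length m sums to m + |I| - 2, which
    may exceed [sumn I], but both m and |I| are at most [sumn I]. *)
Lemma Nnum_words I J : (2 <= size I)%N -> all (leq 1) I -> sumn I = sumn J ->
  let N := (2 * sumn I)%N in
  Nnum (sumn I) I J = (\prod_(i <- I) i)%:R * \sum_(0 <= m < N.+1)
    wsum (words N) m (fun z => Tcoef (rev I) z *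
       ((\prod_(j <- J) j)%:R * Snum J (unzip1 z) (unzip2 z))).
Proof.
move=> sI Ipos eIJ N; rewrite /Nnum eqxx -eIJ eqxx /=.
have szI := size_le_sumn Ipos.
have sumrev : sumn (rev I) = sumn I by rewrite sumn_rev.
transitivity (\sum_(1 <= m < (sumn I).+1) \sum_(s <- compositions (sumn I) m)
    \sum_(l <- compositions (m + size I - 2) m)
   (\prod_(j <- I) j)%:R * (\prod_(j <- J) j)%:R * Tmulti I s l * Snum J s l : rat).
  by case: I sI {Ipos eIJ szI sumrev N} => [|? []].
rewrite (big_nat_trim (n := (sumn I).+1)); first last.
- move=> k hk; apply: wsum0 => z szz hz; rewrite /Tcoef ifF ?mul0r//.
  by apply/negP => /(admissible_size hz); rewrite szz sumrev; lia.
- by rewrite /N; lia.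
rewrite [X in _ = _ * X]big_nat_recl//.
have -> : wsum (words N) 0 (fun z => Tcoef (rev I) z *
       ((\prod_(j <- J) j)%:R * Snum J (unzip1 z) (unzip2 z))) = 0.
  rewrite /wsum /Tcoef ifF ?mul0r// /admissible sumrev /=.
  by apply/negP => /andP[/eqP]; lia.
rewrite add0r big_add1 big_distrr /= big_nat [RHS]big_nat.
apply: eq_bigr => m /andP[_ mI].
rewrite (@sum_compositions _ _ _ N); last by rewrite /N; lia.
pose F (s l : seq nat) := if (sumn s == sumn I) && (sumn l == m.+1 + size I - 2)%N
  then (\prod_(j <- I) j)%:R * (\prod_(j <- J) j)%:R * Tmulti I s l * Snum J s l else 0 : rat.
transitivity (wsum (iota 1 N) m.+1 (fun s => wsum (iota 1 N) m.+1 (F s))).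
  apply: eq_wsumr => s; rewrite /F; case: eqP => _ /=; last first.
    by rewrite wsum0.
  by rewrite (@sum_compositions _ _ _ N)// /N; lia.
rewrite -wsum_pair mulr_wsumr; apply: eq_wsum => z szz hz; rewrite /F /Tcoef.
have -> : admissible (rev I) z =
    (sumn (unzip1 z) == sumn I) && (sumn (unzip2 z) == m.+1 + size I - 2)%N.
  rewrite /admissible sumrev size_rev szz; congr andb.
  have e (n : nat) : (n + 2 == m.+1 + size I)%N = (n == m.+1 + size I - 2)%N.
    by apply/eqP/eqP; lia.
  exact: e.
case: ifP => _; last by rewrite mul0r mulr0.
rewrite /Tmulti; ring.
Qed.

(** * Evaluation on the line t_k = 0 *)

Section Evaluation.
Variables (A : comPzRingType) (K : {rmorphism rat -> A}).
Variables (V : eqType) (d : V -> A -> A).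
Hypothesis dD : forall x, {morph d x : f g / f + g}.
Hypothesis dM : forall x f g, d x (f * g) = d x f * g + f * d x g.
Hypothesis dK : forall x c, d x (K c) = 0.
Variables (o : V) (X : bool -> nat -> V) (v : A).
Local Notation u := (foldr d v).
Hypothesis perm_u : forall xs ys, perm_eq xs ys -> u xs = u ys.
Local Notation w c := (dfactor K d o (X c) v).
Local Notation M c z := (\prod_(q <- z) w c q).
Hypothesis u2 : forall c i j, (0 < i)%N -> (0 < j)%N -> u [:: X c i; X c j] =
  K (i * j)%:R * \sum_(1 <= m < (i + j).+1) \sum_(p <- compositions (i + j) m)
     K (Tnum i j p) * \prod_(a <- p) w c (a, 1%N).

(** [ev t] evaluates at a point of the line t_k = 0 (k >= 1).  All points are
    needed at once, as d_0 differentiates along the line. *)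
Variables (F : numFieldType) (T : Type) (tau : T -> F) (ev : T -> {rmorphism A -> F}).
Hypothesis ev_o : forall f a n, (forall t, ev t f = a * tau t ^+ n) ->
  forall t, ev t (d o f) = a *+ n * tau t ^+ n.-1.
Hypothesis ev1 : forall t c s, (0 < s)%N -> ev t (u [:: X c s]) = 0.
Hypothesis ev2 : forall t i j, (0 < i)%N -> (0 < j)%N ->
  ev t (u [:: X false i; X true j]) = if i == j then i%:R * tau t ^+ i else 0.

Lemma evK t q : ev t (K q) = ratr q.
Proof. by rewrite -[LHS]/((ev t \o K) q) (fmorph_eq_rat (ev t \o K)). Qed.

(** The truncated subtraction in the exponent is harmless, since the falling factorial vanishes for
    l > n. *)
Lemma ev_iter f a n l : (forall t, ev t f = a * tau t ^+ n) ->
  forall t, ev t (iter l (d o) f) = a *+ (n ^_ l) * tau t ^+ (n - l).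
Proof.
move=> evf; elim: l => [|l IH] t; first by rewrite ffactn0 mulr1n subn0.
by rewrite iterS (ev_o IH) ffactnSr mulrnA subnS.
Qed.

Lemma ev_dfactor t c s l : (0 < s)%N -> ev t (w c (s, l)) = 0.
Proof.
move=> s0; rewrite /dfactor rmorphM -iter_u (ev_iter (a := 0) (n := 0)).
  by rewrite mul0rn mul0r mulr0.
by move=> t'; rewrite ev1// mul0r.
Qed.

(** For two or more indices, the empty word is not admissible, so every term of the pure expansion
    contains a factor w, and these vanish on the line. *)
Lemma ev_pure t c I : (0 < size I)%N -> all (leq 1) I -> ev t (u (map (X c) I)) = 0.
Proof.
case: I => [//|i [|j I] _ Ipos].
  by case/andP: Ipos => i0 _; exact: ev1.
rewrite (pure_expansion dD dM dK perm_u (u2 c) _ Ipos (leqnn _))//.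
rewrite rmorphM rmorph_sum [X in _ * X]big1 ?mulr0// => m _.
rewrite (wsum_morph _ _ _ (rmorph0 _) (rmorphD _)) wsum0// => -[|[s l] z] _ /=.
  rewrite /Tcoef ifF ?rmorph0 ?mul0r ?rmorph0//.
  by move: Ipos => /= /and3P[i0 _ _]; rewrite /admissible /=; lia.
rewrite mem_words /= => /andP[/andP[/andP[s0 _] _] _].
by rewrite rmorphM big_cons [X in _ * X]rmorphM ev_dfactor// mul0r mulr0.
Qed.

Lemma ev_der_dfactor t i s l : (0 < i)%N -> (0 < s)%N ->
  ev t (d (X false i) (w true (s, l))) =
  if s == i then (i ^_ l)%:R * tau t ^+ (i - l) else 0.
Proof.
move=> i0 s0; rewrite /dfactor /= (derKM dM dK) rmorphM evK.
have -> : d (X false i) (u (nseq l o ++ [:: X true s])) =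
    iter l (d o) (u [:: X false i; X true s]).
  rewrite iter_u -/(u (X false i :: nseq l o ++ [:: X true s])); apply: perm_u.
  by rewrite -cat1s perm_catCA.
rewrite (ev_iter (a := if i == s then i%:R else 0) (n := i)); last first.
  by move=> t'; rewrite ev2//; case: eqP; rewrite ?mul0r.
rewrite eq_sym; case: eqP => [<-|_]; last by rewrite mul0rn mul0r mulr0.
rewrite fmorphV rmorph_nat -[s%:R *+ _]mulr_natr !mulrA mulVf ?mul1r//.
by rewrite pnatr_eq0 -lt0n.
Qed.

(** The derivatives in J are expanded by the conjugate formula and d_i comes last. It can hit only
    one factor, so a word of two or more letters keeps a vanishing one; by [Tcoef_single] the letter
    ([sumn J], |J| - 1) remains. *)
Lemma ev_single t i J : (0 < i)%N -> (0 < size J)%N -> all (leq 1) J ->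
  ev t (u (X false i :: map (X true) J)) =
  if sumn J == i then ((\prod_(j <- J) j) * i ^_ (size J).-1)%:R
                       * tau t ^+ (i.+1 - size J) else 0.
Proof.
move=> i0; case: J => [//|j [|k J] _ Jpos].
  move: Jpos; rewrite /= andbT => j0; rewrite [LHS]ev2// addn0 eq_sym.
  case: eqP => // ->; rewrite big_cons big_nil muln1 subn1 /=.
  by rewrite ffactn0 muln1.
set J' := j :: k :: J in Jpos *.
rewrite -[u _]/(d (X false i) (u (map (X true) J'))).
rewrite (pure_expansion dD dM dK perm_u (u2 true) _ Jpos (leqnn _))//.
have szJ := size_le_sumn Jpos.
rewrite (derKM dM dK) (der_sum dD dK) rmorphM rmorph_sum evK ratr_nat.
have in1 : 1%N \in index_iota 0 (sumn J').+1.
  by rewrite mem_index_iota; move: szJ; rewrite /J' /=; lia.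
rewrite (bigD1_seq 1%N in1) ?iota_uniq//=.
rewrite [X in _ + X]big1 ?addr0; last first.
  move=> m m1; rewrite (der_wsum dD dK) (wsum_morph _ _ _ (rmorph0 _) (rmorphD _)).
  apply: wsum0 => z szz hz /=; rewrite (derKM dM dK) rmorphM.
  case: z szz hz => [|[s l] [|[s' l'] z]] /= szz hz; last 2 first.
  - by rewrite -szz in m1.
  - rewrite !big_cons dM rmorphD [X in X + _]rmorphM [X in _ * X + _]rmorphM.
    rewrite [X in _ + X]rmorphM.
    move: hz; rewrite !mem_words /= => /and3P[/andP[/andP[s0 _] _]].
    move=> /andP[/andP[s1 _] _] _.
    by rewrite (ev_dfactor _ _ _ s0) (ev_dfactor _ _ _ s1) !(mul0r, mulr0, addr0).
  - by rewrite big_nil (der1 dK) rmorph0 mulr0.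
rewrite (der_wsum dD dK) (wsum_morph _ _ _ (rmorph0 _) (rmorphD _)).
rewrite /wsum /=.
have inw : (sumn J', (size J').-1) \in words (sumn J').
  by rewrite mem_words /=; move: szJ; rewrite /J' /=; lia.
rewrite (bigD1_seq (sumn J', (size J').-1)) ?inw//=; last first.
  by apply: allpairs_uniq; rewrite ?iota_uniq// => -[? ?] [? ?] _ _ /= [-> ->].
rewrite [X in _ + X]big1 ?addr0; last first.
  case=> s l hsl; rewrite (derKM dM dK) rmorphM Tcoef_single//.
  by rewrite -[_ && _]/((s, l) == (sumn J', (size J').-1)) (negPf hsl) rmorph0 rmorph0 mul0r.
rewrite (derKM dM dK) rmorphM Tcoef_single// !eqxx /= !rmorph1 mul1r.
rewrite big_cons big_nil mulr1 ev_der_dfactor//; last by move: szJ => /=; lia.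
by case: eqP => _; rewrite ?mulr0// natrM mulrA; congr (_ * _ ^+ _).
Qed.

Lemma ev_factor t s l J : (0 < s)%N -> all (leq 1) J ->
  ev t (foldr d (w false (s, l)) (map (X true) J)) =
  if sumn J == s then
    ratr (if (size J + l <= s.+1)%N then s.-1`!%:R / (s.+1 - (size J + l))`!%:R else 0)
    * (\prod_(j <- J) j)%:R * tau t ^+ (s.+1 - (size J + l))
  else 0.
Proof.
move=> s0 Jpos.
have foldrKM xs c f : foldr d (K c * f) xs = K c * foldr d f xs.
  by elim: xs => //= x xs ->; rewrite (derKM dM dK).
(* An empty block has sum 0, which is not s, so both sides vanish. *)
case: J Jpos => [|j J] Jpos.
  by rewrite /= ev_dfactor//; case: eqP s0 => // <-.
rewrite /dfactor foldrKM rmorphM evK /= -/(u _).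
set J' := j :: J in Jpos *.
have -> : d (X true j) (foldr d (u (nseq l o ++ [:: X false s])) (map (X true) J)) =
    iter l (d o) (u (X false s :: map (X true) J')).
  rewrite iter_u -foldr_cat -/(u (X true j :: _)); apply: perm_u.
  have e : perm_eq (map (X true) J' ++ nseq l o ++ [:: X false s])
      (nseq l o ++ [:: X false s] ++ map (X true) J').
    by rewrite perm_catCA perm_cat2l perm_catC.
  exact: e.
rewrite (ev_iter (a := if sumn J' == s then ((\prod_(j <- J') j) * s ^_ (size J').-1)%:R
   else 0) (n := (s.+1 - size J')%N)); last first.
  by move=> t'; rewrite ev_single//; case: eqP; rewrite ?mul0r.
have szJ := size_le_sumn Jpos.
rewrite -[(j + sumn J)%N]/(sumn J') -[(size J).+1]/(size J').
case: eqP => [hs|_]; last by rewrite mul0rn mul0r mulr0.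
rewrite subnDA mulrA; congr (_ * _).
have J0 : (0 < size J')%N by [].
(* The two falling factorials telescope to s! / (s + 1 - |J'| - l)!, and 1/s turns s! into (s - 1)!.
   If l is too large the second one is 0, in agreement with the convention on factorials of negative
   integers. *)
have key : s%:R^-1 * (s ^_ (size J').-1 * (s.+1 - size J') ^_ l)%:R =
    (if (size J' + l <= s.+1)%N then s.-1`!%:R / (s.+1 - size J' - l)`!%:R else 0) :> rat.
  have s0r : s%:R != 0 :> rat by rewrite pnatr_eq0 -lt0n.
  case: ifP => hl; last first.
    by rewrite (ffact_small (_ : s.+1 - size J' < l)%N) ?muln0 ?mulr0//; lia.
  have f0 : (s.+1 - size J' - l)`!%:R != 0 :> rat by rewrite pnatr_eq0 -lt0n fact_gt0.
  apply: (mulfI s0r); rewrite mulVKf// mulrA -natrM.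
  have -> : (s * s.-1`! = s`!)%N by rewrite -[in RHS](prednK s0) factS prednK.
  apply: (mulIf f0); rewrite divfK// -natrM; congr (_%:R).
  rewrite -mulnA ffact_fact; last by lia.
  have -> : (s.+1 - size J' = s - (size J').-1)%N by lia.
  by rewrite ffact_fact//; lia.
rewrite -key -[X in _ * X = _]mulr_natr [in RHS]rmorphM !fmorphV !rmorph_nat !natrM.
by ring.
Qed.

(** For a distribution with the right block sums the exponents s_p + 1 - n_p - l_p add up to E,
    whatever the distribution, so the power of tau factors out. If some exponent is negative, the
    distribution contributes 0 on both sides. *)
Lemma ev_distribution t (s l J : seq nat) (E : int) :
  all (leq 1) s -> size l = size s -> all (leq 1) J ->
  E = (sumn s + size s)%:Z - (size J + sumn l)%:Z ->
  ev t (foldr d (\prod_(p < size s) w false (nth 0 s p, nth 0 l p)%N) (map (X true) J))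
  = ratr ((\prod_(j <- J) j)%:R * Snum J s l) * tau t ^ E.
Proof.
move=> s0 szl Jpos hE.
rewrite (foldr_der_prod dD dM dK) rmorph_sum /= /Snum big_distrr /=.
rewrite [in RHS]big_mkcond /= rmorph_sum /= big_distrl /=.
apply: eq_bigr => e _; rewrite rmorph_prod /=.
have sp (p : 'I_(size s)) : (0 < nth 0 s p)%N.
  by move/allP: s0; apply; apply: mem_nth.
under eq_bigr => p _ do rewrite ev_factor ?sp ?block_pos// sumn_block size_block.
case: ifP => [/forallP hs|/negbT]; last first.
  rewrite negb_forall => /existsP[p hp].
  by rewrite (bigD1 p)//= (negPf hp) mul0r rmorph0 mul0r.
under eq_bigr => p _ do rewrite hs.
rewrite big_split big_split /= -natr_prod prod_block.
pose n (p : 'I_(size s)) := #|[pred q | e q == p]|.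
have hn : (\sum_(p < size s) n p = size J)%N.
  by rewrite -(sum_size_block e); apply: eq_bigr => p _; rewrite size_block.
case: ifP => [/forallP hf|/negbT]; last first.
  rewrite negb_forall => /existsP[p hp].
  by rewrite (bigD1 p)//= (negPf hp) rmorph0 !mul0r mulr0 rmorph0 mul0r.
have -> : \prod_(p < size s) ratr (if (n p + nth 0%N l p <= (nth 0%N s p).+1)%N
     then (nth 0%N s p).-1`!%:R / ((nth 0%N s p).+1 - (n p + nth 0%N l p))`!%:R else 0) =
   ratr ((\prod_(p < size s) (nth 0%N s p).-1`!)%:R
    / (\prod_(p < size s) ((nth 0%N s p).+1 - (n p + nth 0%N l p))`!)%:R) :> F.
  rewrite !natr_prod -prodfV -big_split /= rmorph_prod.
  by apply: eq_bigr => p _; rewrite /n hf.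
have -> : \prod_(p < size s) tau t ^+ ((nth 0%N s p).+1 - (n p + nth 0%N l p)) = tau t ^ E.
  rewrite prodrXr exprnP; congr (_ ^ _).
  have h1 : (\sum_(p < size s) ((nth 0%N s p).+1 - (n p + nth 0%N l p)) +
      \sum_(p < size s) (n p + nth 0%N l p) = \sum_(p < size s) (nth 0%N s p).+1)%N.
    rewrite -big_split /=; apply: eq_bigr => p _.
    by rewrite subnK// /n hf.
  have h2 : (\sum_(p < size s) (nth 0%N s p).+1 = sumn s + size s)%N.
    under eq_bigr => p _ do rewrite -addn1.
    by rewrite big_split /= sum1_card card_ord sumnE (big_nth 0%N) big_mkord.
  have h3 : (\sum_(p < size s) nth 0%N l p = sumn l)%N.
    by rewrite sumnE (big_nth 0%N) big_mkord szl.
  rewrite big_split /= hn h3 h2 in h1. by rewrite hE -h1 PoszD addrK.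
by rewrite [in RHS]rmorphM rmorph_nat [X in _ = X * _]mulrC.
Qed.

Theorem ev_mixed t I J : (0 < size I)%N -> (0 < size J)%N ->
  all (leq 1) I -> all (leq 1) J ->
  ev t (u (map (X false) I ++ map (X true) J)) =
  ratr (Nnum (sumn I) I J) * tau t ^ ((sumn I)%:Z - (size I + size J)%:Z + 2).
Proof.
move=> sI sJ Ipos Jpos.
have szI := size_le_sumn Ipos; have szJ := size_le_sumn Jpos.
move: sI; rewrite leq_eqVlt => /orP[|sI].
  (* T_I exists only for at least two indices; N with a single unbarred index is read off from
     [ev_single]. *)
  case: I Ipos szI => [|i []]//=; rewrite andbT addn0 => i0 _ _.
  rewrite -/(u (X false i :: map (X true) J)) ev_single// /Nnum /= addn0 eqxx /=.
  case: eqP => hJ; last by rewrite rmorph0 mul0r.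
  have -> : (\prod_(j <- J) j)%:R * (i`!%:R / (i.+1 - size J)`!%:R) =
     ((\prod_(j <- J) j) * i ^_ (size J).-1)%:R :> rat.
    rewrite natrM; congr (_ * _).
    have h : (i.+1 - size J = i - (size J).-1)%N by lia.
    apply: (mulIf (x := (i.+1 - size J)`!%:R)).
      by rewrite pnatr_eq0 -lt0n fact_gt0.
    rewrite divfK; last by rewrite pnatr_eq0 -lt0n fact_gt0.
    by rewrite -natrM h ffact_fact//; lia.
  rewrite ratr_nat; congr (_ * _); rewrite exprnP; congr (_ ^ _); lia.
have Ipos' : all (leq 1) (rev I) by rewrite all_rev.
set N := (2 * sumn I)%N.
have sN : (sumn (rev I) <= N)%N by rewrite sumn_rev /N; lia.
(* The barred derivatives are moved outside, to act on the expansion; the others are reversed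
   because [Tmulti] is [Trev] on the reversed list. *)
rewrite (perm_u (ys := map (X true) J ++ map (X false) (rev I))); last first.
  by rewrite perm_catC perm_cat2l map_rev perm_sym perm_rev.
rewrite foldr_cat (pure_expansion dD dM dK perm_u (u2 false) _ Ipos' sN); last first.
  by rewrite size_rev.
have foldrKM xs c f : foldr d (K c * f) xs = K c * foldr d f xs.
  by elim: xs => //= x xs ->; rewrite (derKM dM dK).
have foldr0 xs : foldr d 0 xs = 0.
  by elim: xs => //= x xs ->; rewrite (der0 dK).
have fD xs := foldr_morph xs dD.
rewrite foldrKM rmorphM evK ratr_nat.
have -> : (\prod_(i <- rev I) i = \prod_(i <- I) i)%N.
  by apply: perm_big; rewrite perm_rev.
rewrite (big_morph _ (fD _) (foldr0 _)) rmorph_sum /=.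
pose G z := Tcoef (rev I) z * ((\prod_(j <- J) j)%:R * Snum J (unzip1 z) (unzip2 z)).
transitivity ((\prod_(i <- I) i)%:R * (\sum_(0 <= m < N.+1)
    wsum (words N) m (fun z => ratr (G z))) *
    tau t ^ ((sumn I)%:Z - (size I + size J)%:Z + 2)).
  rewrite -mulrA; congr (_ * _); rewrite big_distrl /=; apply: eq_bigr => m _.
  rewrite (wsum_morph _ _ _ (foldr0 _) (fD _)).
  rewrite (wsum_morph _ _ _ (rmorph0 _) (rmorphD _)) mulr_wsuml.
  apply: eq_wsum => z szz hz /=; rewrite foldrKM rmorphM evK.
  have [ha|ha] := boolP (admissible (rev I) z); last first.
    by rewrite /G /Tcoef (negPf ha) mul0r rmorph0 !mul0r.
  rewrite [ratr (G z)]rmorphM -mulrA; congr (_ * _).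
  move: ha; rewrite /admissible sumn_rev size_rev => /andP[/eqP a1 /eqP a2].
  rewrite prod_pairs.
  apply: (ev_distribution t (s := unzip1 z) (l := unzip2 z)) => //.
  - by apply/allP => a /mapP[q qz ->]; move/allP: hz => /(_ _ qz);
      rewrite inE mem_words => /andP[/andP[]].
  - by rewrite !size_map.
  (* The word length cancels in E: (|z| from the s-row) - (|z| + |I| - 2 from the l-row), so all
     words give the same power of tau. *)
  - have e2 : sumn (unzip2 z) = (size z + size I - 2)%N.
      by apply/eqP; rewrite -(eqn_add2r 2) a2 subnK//; lia.
    rewrite size_map a1 e2.
    by move: (size z) => k; lia.
congr (_ * _).
have [eIJ|neIJ] := eqVneq (sumn I) (sumn J).
  rewrite (Nnum_words sI Ipos eIJ) rmorphM rmorph_nat rmorph_sum; congr (_ * _).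
  apply: eq_bigr => m _ /=.
  by rewrite (wsum_morph _ _ _ (rmorph0 _) (rmorphD _)).
(* With unequal sums no distribution of J can fill blocks whose sums add up to [sumn I], so S
   vanishes for each admissible word. *)
rewrite /Nnum eqxx eq_sym (negPf neIJ) rmorph0 [X in _ * X]big1 ?mulr0// => m _.
apply: wsum0 => z _ _; rewrite /G.
have [ha|ha] := boolP (admissible (rev I) z); last first.
  by rewrite /Tcoef (negPf ha) mul0r rmorph0.
rewrite /Snum [X in _ * (_ * X)]big1 ?mulr0 ?rmorph0// => e /forallP he.
case/eqP: neIJ; move: ha; rewrite /admissible sumn_rev => /andP[/eqP <- _].
rewrite [RHS]sumnE (big_nth 0%N) big_mkord (partition_big e xpredT)//=.
rewrite sumnE (big_nth 0%N) big_mkord; apply: eq_bigr => p _.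
by rewrite (eqP (he p)).
Qed.

End Evaluation.

(** * Logarithms of formal power series *)

Local Open Scope complex_scope.

Section Series.
Context {R : realType}.
Local Notation C := R[i].
Implicit Types f g h : @series2 R.

Lemma mul2E f g a b : mul2 f g a b =
  \sum_(0 <= i < a.+1) \sum_(0 <= j < b.+1) f i j * g (a - i)%N (b - j)%N.
Proof. by rewrite big_mkord; apply: eq_bigr => i _; rewrite big_mkord. Qed.

Definition spow f n : @series2 R := iter n (mul2 f) (const2 1).

Lemma spowS f n : spow f n.+1 = mul2 f (spow f n). Proof. by []. Qed.

(** Truncation to a polynomial in x over polynomials in y. In low degrees [mul2] becomes the product
    of a ring, in which derivatives and geometric sums can be used. *)
Definition tpoly (N : nat) f : {poly {poly C}} :=
  \poly_(i < N) \poly_(j < N) f i j.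

Lemma coef_tpoly N f i j : (i < N)%N -> (j < N)%N -> (tpoly N f)`_i`_j = f i j.
Proof. by move=> iN jN; rewrite coef_poly iN coef_poly jN. Qed.

Lemma coef11 i j : (1 : {poly {poly C}})`_i`_j = const2 1 i j.
Proof.
rewrite /const2; case: i => [|i]; rewrite coef1; last by rewrite mulr0n coef0.
by rewrite mulr1n coef1; case: j.
Qed.

Lemma coef_spow N f n i j : (i < N)%N -> (j < N)%N ->
  (tpoly N f ^+ n)`_i`_j = spow f n i j.
Proof.
elim: n i j => [|n IH] i j iN jN.
  by rewrite expr0 coef11.
rewrite exprS coefM coef_sum spowS; apply: eq_bigr => k _.
rewrite coefM; apply: eq_bigr => l _.
rewrite coef_tpoly ?IH//; first exact: leq_ltn_trans (leq_subr _ _) iN.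
- exact: leq_ltn_trans (leq_subr _ _) jN.
- exact: leq_ltn_trans (leq_ord k) iN.
- exact: leq_ltn_trans (leq_ord l) jN.
Qed.

Lemma tpoly_X N f : (forall b, f 0%N b = 0) -> exists p, tpoly N f = 'X * p.
Proof.
move=> f0; exists (\poly_(i < N.-1) \poly_(j < N) f i.+1 j).
apply/polyP => i; rewrite coefXM coef_poly.
case: i => [|i] /=.
  case: ifP => // _; apply/polyP => j; rewrite coef_poly coef0.
  by case: ifP.
by rewrite coef_poly ltn_predRL.
Qed.

Lemma coef_tpoly_small N f n i : (forall b, f 0%N b = 0) -> (i < n)%N ->
  (tpoly N f ^+ n)`_i = 0.
Proof.
move=> f0 ilt; have [p ->] := tpoly_X N f0.
by rewrite exprMn coefXnM ilt.
Qed.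

Lemma spow_small f n i j : (forall b, f 0%N b = 0) -> (i < n)%N -> spow f n i j = 0.
Proof.
move=> f0 ilt; rewrite -(coef_spow (N := (i + j).+1)) ?ltnS ?leq_addr ?leq_addl//.
by rewrite coef_tpoly_small// coef0.
Qed.

Lemma cexp0 : cexp 0 = 1 :> C.
Proof.
by rewrite /cexp /= expR0 cos0 sin0 mul1r.
Qed.

(** As f has no term of x-degree 0, powers beyond the x-degree do not contribute, and the
    exponential may be cut at any N >= a. *)
Lemma exp2E N f a b : (forall b, f 0%N b = 0) -> (a <= N)%N ->
  exp2 f a b = \sum_(0 <= n < N.+1) n`!%:R^-1 * spow f n a b.
Proof.
move=> f0 aN; rewrite /exp2 f0 cexp0 mul1r.
have -> : f - const2 0 = f.
  by apply/funext => i; apply/funext => j; rewrite !fctE /const2 if_same subr0.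
rewrite -(big_mkord xpredT (fun n => n`!%:R^-1 * iter n (mul2 f) (const2 1) a b)).
have trim M : (a <= M)%N -> \sum_(0 <= n < M.+1) n`!%:R^-1 * spow f n a b =
    \sum_(0 <= n < a.+1) n`!%:R^-1 * spow f n a b.
  by move=> aM; rewrite (big_nat_trim (n := a.+1))// => k ak; rewrite spow_small// mulr0.
by rewrite trim// [LHS]trim// leq_addr.
Qed.

(** With ' the derivative in x and e = exp2 f = 1 + g, one has e f' = e', hence
    (1 + g) f' = g' = (1 + g) (log (1 + g))', and 1 + g is invertible.  The
    argument takes place in the polynomial ring, modulo high powers of x. *)
Lemma log_exp2 f g : (forall b, f 0%N b = 0) -> (forall b, g 0%N b = 0) ->
  exp2 f = const2 1 + g ->
  forall N a b, (a <= N)%N -> f a b =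
  \sum_(1 <= k < N.+1) ((-1) ^+ k.+1 / k%:R) * spow g k a b.
Proof.
move=> f0 g0 efg N a b aN.
pose Q := (N + b).+1.
pose p := tpoly Q f; pose q := tpoly Q g.
pose c (x : C) : {poly {poly C}} := x%:P%:P.
have cM x (s : {poly {poly C}}) i j : (c x * s)`_i`_j = x * s`_i`_j.
  by rewrite /c coefCM coefCM.
pose e := \sum_(0 <= n < Q.+1) c n`!%:R^-1 * p ^+ n.
pose L := \sum_(1 <= k < Q.+1) c ((-1) ^+ k.+1 / k%:R) * q ^+ k.
have he i j : (i < Q)%N -> (j < Q)%N -> e`_i`_j = (1 + q)`_i`_j.
  move=> iQ jQ; rewrite /e !coef_sum.
  under eq_bigr => n _ do rewrite cM coef_spow//.
  rewrite -exp2E//; last exact: ltnW.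
  by rewrite efg !coefD coef_tpoly// coef11 !fctE.
have dc x (s : {poly {poly C}}) : (c x * s)^`() = c x * s^`().
  by rewrite derivM /c derivC mul0r add0r.
have cn (n : nat) : c n%:R = n%:R by rewrite /c polyC_natr polyC_natr.
have d1 : (1 : {poly {poly C}})^`() = 0 by rewrite -polyC1 derivC.
have dX (s : {poly {poly C}}) n : (s ^+ n.+1)^`() = c n.+1%:R * s ^+ n * s^`().
  by rewrite deriv_exp -mulr_natl -cn mulrA [RHS]mulrAC.
have cN1 n : c ((-1) ^+ n) = (-1) ^+ n.
  elim: n => [|n IH]; first by rewrite !expr0; exact: etrans (congr1 (@polyC _) (@polyC1 C)) (@polyC1 _).
  by rewrite exprS [RHS]exprS -IH mulN1r mulN1r /c polyCN polyCN.
(* The truncated exponential satisfies e' = e p' up to the contribution of its last term, of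
   x-degree at least Q. *)
have de : e^`() = (e - c Q`!%:R^-1 * p ^+ Q) * p^`().
  rewrite /e [in RHS]big_nat_recr//= addrK big_nat_recl//.
  rewrite derivD dc expr0 d1 mulr0 add0r raddf_sum big_distrl /=.
  apply: eq_bigr => n _; rewrite dc dX !mulrA; congr (_ * _ * _).
  rewrite /c -!polyCM factS natrM invfM mulrAC mulVf ?mul1r//.
(* The derivative of the truncated logarithm is q' times a geometric sum in - q. *)
have dL : (1 + q) * L^`() = (1 - (- q) ^+ Q) * q^`().
  have -> : 1 - (- q) ^+ Q = (1 + q) * \sum_(n < Q) (- q) ^+ n.
    by rewrite -opprB subrX1 -mulNr opprB opprK.
  rewrite /L big_add1 raddf_sum /= -mulrA; congr (_ * _).
  rewrite big_distrl /= big_mkord; apply: eq_bigr => n _.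
  rewrite dc dX !mulrA; congr (_ * _).
  rewrite [(- q) ^+ _]exprNn; congr (_ * _).
  rewrite /c -!polyCM divfK ?pnatr_eq0// !exprS mulrA mulrNN !mul1r.
  exact: cN1.
have cX f' (s : {poly {poly C}}) i : (forall b, f' 0%N b = 0) -> (i < Q)%N ->
    (tpoly Q f' ^+ Q * s)`_i = 0.
  move=> f'0 iQ; rewrite coefM big1// => k _.
  by rewrite coef_tpoly_small ?mul0r//; exact: leq_ltn_trans (leq_ord k) iQ.
pose D := p^`() - L^`().
have h1D i j : (i < Q.-1)%N -> (j < Q)%N -> ((1 + q) * D)`_i`_j = 0.
  move=> iQ jQ; have iQ' : (i.+1 < Q)%N by rewrite -ltn_predRL.
  have h1 : ((1 + q) * p^`())`_i`_j = (e^`())`_i`_j.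
    rewrite de mulrBl coefB coefB -[c _ * _ * _]mulrA.
    rewrite cM cX ?(ltnW iQ')// coef0 mulr0 subr0.
    rewrite !coefM !coef_sum; apply: eq_bigr => k _; rewrite !coefM.
    apply: eq_bigr => l _; rewrite he//.
    - exact: leq_ltn_trans (leq_ord k) (ltnW iQ').
    - exact: leq_ltn_trans (leq_ord l) jQ.
  rewrite mulrBr coefB coefB h1 dL mulrBl mul1r !coefB.
  rewrite [(- q) ^+ _]exprNn -cN1 -[c _ * _ * _]mulrA cM cX ?(ltnW iQ')//.
  rewrite coef0 mulr0 subr0.
  rewrite !coef_deriv !coefMn he// coefD coefD coef11.
  by rewrite /const2 /= add0r subrr.
have [q1 hq1] := tpoly_X Q g0.
(* Division by 1 + q is done by induction on the x-degree: since q = X q1, subtracting (1 + q) D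
   leaves only coefficients of D of lower degree. *)
have D0 i j : (i < Q.-1)%N -> (j < Q)%N -> D`_i`_j = 0.
  elim/ltn_ind: i j => i IH j iQ jQ.
  have -> : D = (1 + q) * D - 'X * (q1 * D).
    by rewrite mulrA -hq1 mulrDl mul1r addrK.
  rewrite coefB coefB h1D// sub0r coefXM; apply/eqP; rewrite oppr_eq0; apply/eqP.
  case: i IH iQ => [|i] IH iQ /=; first by rewrite coef0.
  rewrite coefM coef_sum big1// => k _; rewrite coefM big1// => l _.
  rewrite IH ?mulr0//.
  - by rewrite ltnS leq_subr.
  - by apply: leq_ltn_trans iQ; apply: leqW; rewrite leq_subr.
  - exact: leq_ltn_trans (leq_subr _ _) jQ.
have spow0 k : (0 < k)%N -> spow g k 0%N b = 0 by move=> k0; rewrite spow_small.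
case: a aN => [|a] aN.
  rewrite f0 big_nat big1// => k /andP[k0 _]; by rewrite spow0 ?mulr0.
have bQ : (b < Q)%N by rewrite ltnS leq_addl.
have aQ : (a.+1 < Q)%N by rewrite ltnS (leq_trans aN)// leq_addr.
have hD : D`_a`_b = 0 by apply: D0; rewrite ?ltn_predRL.
move/eqP: hD.
rewrite coefB coefB !coef_deriv !coefMn -mulrnBl mulrn_eq0 /= subr_eq0.
rewrite coef_tpoly// => /eqP ->.
rewrite /L !coef_sum (big_cat_nat (n := N.+1))//=; last by rewrite /Q ltnS leqW// leq_addr.
rewrite [X in _ + X]big_nat [X in _ + X]big1 ?addr0; last first.
  move=> k /andP[Nk _]; rewrite cM coef_spow// spow_small ?mulr0//.
  exact: leq_ltn_trans aN Nk.
by apply: eq_bigr => k _; rewrite cM coef_spow.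
Qed.

End Series.

(** * Second derivatives from the Hirota equations *)

Lemma wsumS (A : nmodType) (T : Type) (X : seq T) m (F : seq T -> A) :
  wsum X m.+1 F = \sum_(x <- X) wsum X m (fun z => F (x :: z)).
Proof. by []. Qed.

Lemma iota_pos N s : all (mem (iota 1 N)) s -> all (leq 1) s.
Proof. by apply: sub_all => a; rewrite inE mem_iota => /andP[]. Qed.

Definition blocksums (n p : seq nat) := [seq (sumn b).-1 | b <- reshape n p].

Lemma sumn_blocksums n p : (sumn (blocksums n p) <= sumn p)%N.
Proof.
elim: n p => [|a n IH] p //=.
rewrite -[in X in (_ <= X)%N](cat_take_drop a p) sumn_cat.
exact: leq_add (leq_pred _) (IH _).
Qed.

Lemma PnumE i j r : Pnum i j r = (\sum_(c <- compositions i (size r)) all2 leq c r)%N.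
Proof. by rewrite /Pnum size_filter -sum1_count big_mkcond. Qed.

Lemma Pnum0 i j : Pnum i j [::] = (i == 0%N).
Proof. by rewrite PnumE (big_compositions0 _ (fun c => all2 leq c [::] : nat)); case: eqP. Qed.

Lemma PnumS i j x r :
  Pnum i j (x :: r) = (\sum_(1 <= a < i.+1) (a <= x)%N * Pnum (i - a) j r)%N.
Proof.
rewrite PnumE (big_compositionsS _ _ (fun c => all2 leq c (x :: r) : nat)).
apply: eq_bigr => a _; rewrite PnumE big_distrr /=; apply: eq_bigr => c _.
by rewrite mulnb.
Qed.

Lemma Pnum_small i j r : (sumn r < i)%N -> Pnum i j r = 0%N.
Proof.
move=> h; rewrite PnumE big_seq big1// => c; rewrite mem_compositions.
move=> /and3P[_ _ /eqP ci]; case: (boolP (all2 leq c r)) => // le.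
suff : (sumn c <= sumn r)%N by rewrite ci leqNgt h.
by elim: c r le {h ci} => [|x c IH] [|y r]//= /andP[xy /IH]; exact: leq_add.
Qed.

Section HirotaSeries.
Context {R : realType}.
Local Notation C := R[i].
Implicit Types f g h : @series2 R.
Variable w : nat -> C.

(** For c >= 1, the coefficient of x^c in exp (- sum_a w_a x^a); in the application w_a = d_0 d_a v
    / a. *)
Definition ghat (c : nat) : C := \sum_(1 <= n < c.+1)
  (-1) ^+ n / n`!%:R * \sum_(p <- compositions c n) \prod_(a <- p) w a.

(** Dividing y x^c - x y^c by y - x gives minus the sum of the x^a y^b with a + b = c and a, b >= 1.
    Hence (y - x) e^f = y e^(-W(x)) - x e^(-W(y)), with W(x) = sum_a w_a x^a, means e^f = 1 -
    [gser]. *)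
Definition gser : @series2 R := fun a b =>
  if (0 < a)%N && (0 < b)%N then ghat (a + b) else 0.

Lemma spow_onevar F n a b :
  (forall a b, F a b = if (0 < a)%N && (b == 0%N) then - w a else 0) ->
  spow F n a b = if b == 0%N then
    (-1) ^+ n * \sum_(p <- compositions a n) \prod_(x <- p) w x else 0.
Proof.
move=> FE; elim: n a b => [|n IH] a b.
  rewrite big_compositions0 expr0 mul1r big_nil /spow /= /const2.
  by case: (b == 0%N); rewrite ?andbT ?andbF.
rewrite spowS mul2E.
transitivity (\sum_(0 <= i < a.+1) F i 0%N * spow F n (a - i)%N b).
  apply: eq_bigr => i _; rewrite big_nat_recl// subn0 [X in _ + X]big1 ?addr0//.
  by move=> j _; rewrite FE andbF mul0r.
rewrite big_nat_recl// FE mul0r add0r big_compositionsS.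
case: eqP => b0; last by rewrite big1// => i _; rewrite IH; case: eqP; rewrite ?mulr0.
rewrite [in RHS]big_add1 /= big_distrr /=; apply: eq_bigr => i _.
rewrite FE IH b0 /= exprS.
under [in RHS]eq_bigr => p _ do rewrite big_cons.
by rewrite -big_distrr /=; ring.
Qed.

Lemma exp2_onevar F a b :
  (forall a b, F a b = if (0 < a)%N && (b == 0%N) then - w a else 0) ->
  exp2 F a b = if b == 0%N then (if a == 0%N then 1 else ghat a) else 0.
Proof.
move=> FE; rewrite (exp2E (N := a))//.
under eq_bigr => n _ do rewrite (spow_onevar _ _ _ FE).
case: eqP => b0; last by rewrite big1// => n _; rewrite mulr0.
rewrite big_nat_recl// big_compositions0 expr0 mul1r big_nil invr1 mul1r.
case: eqP => [->|a0]; first by rewrite big_geq// addr0.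
rewrite add0r /ghat big_add1; apply: eq_bigr => n _.
by rewrite mulrA [_^-1 * _]mulrC.
Qed.

Lemma spow_tr f n a b : spow (fun a b => f b a) n a b = spow f n b a.
Proof.
elim: n a b => [|n IH] a b; first by rewrite /spow /= /const2 andbC.
rewrite !spowS !mul2E exchange_big /=.
by apply: eq_bigr => i _; apply: eq_bigr => j _; rewrite IH.
Qed.

Lemma exp2_tr f a b : exp2 (fun a b => f b a) a b = exp2 f b a.
Proof.
rewrite /exp2; congr (_ * _); rewrite addnC; apply: eq_bigr => n _; congr (_ * _).
rewrite -[RHS]/(spow (f - const2 (f 0%N 0%N)) n b a) -spow_tr; congr (iter n (mul2 _) _ _ _).
by apply/funext => i; apply/funext => j; rewrite !fctE /const2 andbC.
Qed.

Lemma spowN f n a b : spow (- f) n a b = (-1) ^+ n * spow f n a b.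
Proof.
elim: n a b => [|n IH] a b; first by rewrite expr0 mul1r.
rewrite !spowS !mul2E big_distrr /=; apply: eq_bigr => i _.
rewrite big_distrr /=; apply: eq_bigr => j _; rewrite IH !fctE exprS.
by rewrite mulN1r !mulNr mulrCA.
Qed.

(** Compare coefficients instead of dividing by y - x: off the axes the coefficients of e^f are
    constant along a + b, and the equation next to the axis y = 0 fixes that constant as minus
    [ghat (a + b)]. *)
Lemma hirota_exp2 f Fx Fy :
  (forall a b, Fx a b = if (0 < a)%N && (b == 0%N) then - w a else 0) ->
  (forall a b, Fy a b = if (a == 0%N) && (0 < b)%N then - w b else 0) ->
  muly (exp2 f) - mulx (exp2 f) = muly (exp2 Fx) - mulx (exp2 Fy) ->
  exp2 f = const2 1 + (- gser).
Proof.
move=> hx hy H.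
have e1 a b := exp2_onevar a b hx.
have e2 a b : exp2 Fy a b = if a == 0%N then (if b == 0%N then 1 else ghat b) else 0.
  rewrite -(exp2_tr Fy) (exp2_onevar (F := fun a b => Fy b a))// => i j.
  by rewrite hy andbC.
have Hab a b := congr1 (fun s : @series2 R => s a b) H.
have E0 a : exp2 f a 0%N = if a == 0%N then 1 else 0.
  have := Hab a.+1 0%N; rewrite !fctE /= !sub0r => /oppr_inj ->.
  by rewrite e2.
have E1 b : exp2 f 0%N b = if b == 0%N then 1 else 0.
  have := Hab 0%N b.+1; rewrite !fctE /= !subr0 => ->.
  by rewrite e1.
have E2 b a : exp2 f a.+1 b.+1 = - ghat (a.+1 + b.+1).
  elim: b a => [|b IH] a.
    have := Hab a.+2 1%N; rewrite !fctE /= E0 e1 e2 /= subr0 sub0r addn1.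
    by move=> /eqP; rewrite eqr_oppLR => /eqP.
  have := Hab a.+2 b.+2; rewrite !fctE /= e1 e2 /= subr0 IH => /eqP.
  by rewrite subr_eq0 => /eqP <-; rewrite addSnnS.
apply/funext => a; apply/funext => b; rewrite !fctE /gser /const2.
case: a => [|a]; first by rewrite E1 oppr0 addr0.
case: b => [|b]; first by rewrite E0 oppr0 addr0.
by rewrite E2 add0r.
Qed.

Lemma hirota_log f Fx Fy N a b :
  (forall b, f 0%N b = 0) ->
  (forall a b, Fx a b = if (0 < a)%N && (b == 0%N) then - w a else 0) ->
  (forall a b, Fy a b = if (a == 0%N) && (0 < b)%N then - w b else 0) ->
  muly (exp2 f) - mulx (exp2 f) = muly (exp2 Fx) - mulx (exp2 Fy) ->
  (a <= N)%N ->
  f a b = - \sum_(1 <= k < N.+1) k%:R^-1 * spow gser k a b.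
Proof.
move=> f0 hx hy /(hirota_exp2 hx hy) E aN.
rewrite (log_exp2 f0 _ E _ aN); last by move=> j; rewrite fctE /gser oppr0.
rewrite -sumrN; apply: eq_bigr => k _; rewrite spowN exprS.
by rewrite mulN1r !mulNr mulrACA -expr2 sqrr_sign mul1r.
Qed.

Variable N : nat.
Local Notation pw p := (\prod_(a <- p) w a).
Local Notation sgnfact n := ((-1) ^+ sumn n / (\prod_(x <- n) x`!)%:R : C).

(** The coefficient of x^i y^j in the k-th power of [gser], fully expanded: n records how many
    factors w each of the k coefficients [ghat] contributes, p lists all their indices, and P counts
    the ways to split the x-exponent i among the k series. *)
Definition blocked (k i j : nat) : C := wsum (iota 1 N) k (fun n =>
  wsum (iota 1 N) (sumn n) (fun p => if sumn p == (i + j)%N then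
    sgnfact n * ((Pnum i 0 (blocksums n p))%:R * pw p) else 0)).

Lemma ghat_wsum c : (c <= N)%N -> ghat c = \sum_(n <- iota 1 N)
  (-1) ^+ n / n`!%:R * wsum (iota 1 N) n (fun p => if sumn p == c then pw p else 0).
Proof.
move=> cN; rewrite /ghat.
have -> : iota 1 N = index_iota 1 N.+1 by rewrite /index_iota subn1.
rewrite !big_add1 /= [RHS](big_nat_trim (n := c))//; last first.
  move=> k ck; rewrite /index_iota subn1 /= wsum0 ?mulr0// => p sp hp.
  case: eqP => // e; have := size_le_sumn (iota_pos hp).
  by rewrite sp e; lia.
apply: eq_bigr => n _; rewrite /index_iota subn1 /=.
by rewrite (sum_compositions _ _ cN).
Qed.

Lemma spow_gser k i j : (i + j <= N)%N -> spow gser k i j = blocked k i j.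
Proof.
elim: k i j => [|k IH] i j ijN.
  rewrite /blocked /wsum /= Pnum0 !big_nil expr0 invr1 !mul1r mulr1.
  by rewrite /spow /= /const2; case: i {ijN} => [|i]; case: j => [|j].
rewrite spowS mul2E.
transitivity (\sum_(1 <= a < i.+1) \sum_(1 <= b < j.+1)
    ghat (a + b) * blocked k (i - a) (j - b)).
  rewrite big_nat_recl// [X in X + _]big1 ?add0r; last by move=> b _; rewrite mul0r.
  rewrite [in RHS]big_add1 /= big_nat [RHS]big_nat; apply: eq_bigr => a /andP[_ ai].
  rewrite big_nat_recl// {1}/gser mul0r add0r [RHS]big_add1 /=.
  rewrite big_nat [RHS]big_nat; apply: eq_bigr => b /andP[_ bj].
  by rewrite IH//; lia.
pose G n1 p1 := \sum_(1 <= a < i.+1) \sum_(1 <= b < j.+1)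
  if sumn p1 == (a + b)%N then
   (-1) ^+ n1 / n1`!%:R * pw p1 * blocked k (i - a) (j - b) else 0.
transitivity (\sum_(n1 <- iota 1 N) wsum (iota 1 N) n1 (G n1)).
  under [RHS]eq_bigr => n1 _ do rewrite wsum_sum.
  rewrite [RHS]exchange_big /=; rewrite big_nat [RHS]big_nat; apply: eq_bigr => a /andP[a1 ai].
  under [RHS]eq_bigr => n1 _ do rewrite wsum_sum.
  rewrite [RHS]exchange_big /=; rewrite big_nat [RHS]big_nat; apply: eq_bigr => b /andP[b1 bj].
  rewrite ghat_wsum; last by lia.
  rewrite big_distrl /=; apply: eq_bigr => n1 _.
  rewrite [X in X * _]mulr_wsumr mulr_wsuml; apply: eq_wsumr => p1.
  by case: eqP => // _; rewrite mulr0 mul0r.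
rewrite [RHS]/blocked wsumS; apply: eq_bigr => n1 _.
transitivity (wsum (iota 1 N) k (fun n => wsum (iota 1 N) n1 (fun p1 =>
  wsum (iota 1 N) (sumn n) (fun p => if sumn (p1 ++ p) == (i + j)%N then
    sgnfact (n1 :: n) * ((Pnum i 0 (blocksums (n1 :: n) (p1 ++ p)))%:R * pw (p1 ++ p)) else 0)))); last first.
  by apply: eq_wsumr => n; rewrite [in RHS]/= wsum_cat.
rewrite wsum_exchange; apply: eq_wsum => p1 sz1 hp1.
rewrite /G.
transitivity (\sum_(1 <= a < i.+1) wsum (iota 1 N) k (fun n => wsum (iota 1 N) (sumn n)
  (fun p => if (sumn p1 + sumn p == i + j)%N then
   if (a <= (sumn p1).-1)%N then sgnfact (n1 :: n) * ((Pnum (i - a) 0 (blocksums n p))%:R * (pw p1 * pw p))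
   else 0 else 0))); last first.
  rewrite -wsum_sum; apply: eq_wsumr => n; rewrite -wsum_sum; apply: eq_wsumr => p.
  rewrite sumn_cat; case: eqP => _; last by rewrite big1.
  rewrite /blocksums /= take_size_cat// drop_size_cat// -/(blocksums n p).
  rewrite PnumS natr_sum big_cat /= big_distrl big_distrr /=; apply: eq_bigr => a _.
  by case: ifP => _; rewrite ?mul1n// mul0n mul0r mulr0.
rewrite big_nat [RHS]big_nat; apply: eq_bigr => a /andP[a1 ai].
(* The y-exponent of the first factor is [sumn p1 - a]. That it is at least 1 is the upper bound on
   a in the definition of P. *)
have [ale|agt] := leqP a (sumn p1).-1; last first.
  rewrite big_nat big1; last by move=> b /andP[b1 _]; rewrite ifF//; lia.
  by rewrite wsum0// => n _ _; rewrite wsum0// => p _ _; rewrite if_same.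
(* If the first factor uses more than j powers of y, the remaining indices sum to less than i - a,
   and P vanishes. *)
have [bj|bj] := leqP (sumn p1 - a) j; last first.
  rewrite big_nat big1; last by move=> b /andP[b1 bj']; rewrite ifF//; lia.
  rewrite wsum0// => n _ _; rewrite wsum0// => p _ _; case: eqP => // e.
  rewrite Pnum_small ?mul0r ?mulr0//.
  by apply: leq_ltn_trans (sumn_blocksums _ _) _; lia.
rewrite (bigD1_seq (sumn p1 - a)%N) ?iota_uniq ?mem_index_iota//=; last by lia.
rewrite ifT; last by lia.
rewrite [X in _ + X]big1 ?addr0; last first.
  by move=> b hb; rewrite ifF//; lia.
rewrite /blocked mulr_wsumr; apply: eq_wsumr => n.
rewrite mulr_wsumr; apply: eq_wsumr => p.
have -> : (sumn p == i - a + (j - (sumn p1 - a)))%N = (sumn p1 + sumn p == i + j)%N.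
  by lia.
case: ifP => _; last by rewrite mulr0.
rewrite /= big_cons natrM invfM exprD; ring.
Qed.

(** Grouping by the total length m of the blocks brings the word p outside, as T_ij requires; words
    longer than N cannot have sum N = i + j. *)
Lemma blocked_compositions k i j : (i + j = N)%N -> (0 < k)%N -> blocked k i j =
  \sum_(m <- iota 1 N) wsum (iota 1 N) m (fun p => if sumn p == (i + j)%N then
    \sum_(n <- compositions m k) sgnfact n * ((Pnum i 0 (blocksums n p))%:R * pw p)
    else 0).
Proof.
move=> ijN k0.
pose Fp n p := if sumn p == (i + j)%N then
  sgnfact n * ((Pnum i 0 (blocksums n p))%:R * pw p) else 0.
transitivity (\sum_(m <- iota 1 N) wsum (iota 1 N) k (fun n =>
    if sumn n == m then wsum (iota 1 N) m (Fp n) else 0)); last first.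
  rewrite big_seq [RHS]big_seq; apply: eq_bigr => m; rewrite mem_iota => /andP[m1 mN].
  rewrite -(@sum_compositions _ m k N (fun n => wsum (iota 1 N) m (Fp n))); last by lia.
  rewrite -wsum_sum; apply: eq_wsumr => p; rewrite /Fp.
  by case: eqP => // _; rewrite big1.
rewrite -wsum_sum; apply: eq_wsum => n szn hn.
have n0 : (0 < sumn n)%N.
  by have := size_le_sumn (iota_pos hn); rewrite szn; exact: leq_trans.
have [le|gt] := leqP (sumn n) N.
  have hin : sumn n \in iota 1 N by rewrite mem_iota n0.
  rewrite (bigD1_seq _ hin) ?iota_uniq//=.
  rewrite eqxx [X in _ + X]big1 ?addr0// => m hm.
  by rewrite eq_sym (negPf hm).
rewrite [RHS]big_seq [RHS]big1; last first.
  by move=> m; rewrite mem_iota => hm; rewrite ifF//; lia.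
rewrite wsum0// => p sp hp; case: eqP => // e.
by have := size_le_sumn (iota_pos hp); rewrite sp e; lia.
Qed.

(** Collect in log (1 - [gser]) = - sum_k [gser]^k / k the terms with the same word p. The sign of
    the logarithm and the signs of the k exponentials combine to (-1)^(m+1), and the n_r! come from
    the exponential series: this is the formula for T_ij. *)
Lemma Tnum_expansion i j : (i + j = N)%N ->
  \sum_(1 <= m < N.+1) \sum_(p <- compositions N m) ratr (Tnum i j p) * pw p =
  - \sum_(1 <= k < N.+1) k%:R^-1 * spow gser k i j.
Proof.
move=> ijN.
transitivity (- \sum_(1 <= k < N.+1) k%:R^-1 * \sum_(m <- iota 1 N)
  wsum (iota 1 N) m (fun p => if sumn p == (i + j)%N then
    \sum_(n <- compositions m k) sgnfact n * ((Pnum i 0 (blocksums n p))%:R * pw p)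
    else 0)); last first.
  congr (- _); rewrite big_nat [RHS]big_nat; apply: eq_bigr => k /andP[k1 _].
  by rewrite -blocked_compositions// spow_gser// ijN.
under [in RHS]eq_bigr => k _ do rewrite big_distrr /=.
rewrite exchange_big /= -sumrN.
have -> : iota 1 N = index_iota 1 N.+1 by rewrite /index_iota subn1.
rewrite big_nat [RHS]big_nat; apply: eq_bigr => m /andP[m1 mN].
rewrite (@sum_compositions _ N m N)//.
under [in RHS]eq_bigr => k _ do rewrite mulr_wsumr.
rewrite -wsum_sum.
rewrite (wsum_morph (h := -%R)) ?oppr0//; last by move=> ? ?; rewrite opprD.
rewrite /index_iota subn1 /=; apply: eq_wsum => p szp hp /=; rewrite ijN.
case: eqP => _; last by rewrite big1 ?oppr0// => k _; rewrite mulr0.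
rewrite /Tnum szp (rmorph_sum (ratr : {rmorphism rat -> C})) big_distrl /= -sumrN.
have -> : iota 1 N = index_iota 1 N.+1 by rewrite /index_iota subn1.
rewrite [RHS](big_cat_nat (n := m.+1))//=.
rewrite [X in _ = _ + X]big_nat [X in _ = _ + X]big1 ?addr0; last first.
  move=> k /andP[mk _]; rewrite big_seq big1 ?mulr0 ?oppr0// => n.
  rewrite mem_compositions => /and3P[/eqP sn np /eqP e].
  by have := size_le_sumn np; rewrite sn e; lia.
rewrite big_nat [RHS]big_nat; apply: eq_bigr => k /andP[k1 km].
rewrite rmorph_sum big_distrl /= big_distrr /= -sumrN.
rewrite big_seq [RHS]big_seq; apply: eq_bigr => n.
rewrite mem_compositions => /and3P[_ _ /eqP e].
rewrite -[Pnum i j _]/(Pnum i 0 (blocksums n p)) e.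
rewrite !rmorphM !fmorphV !rmorph_nat rmorphXn rmorphN1 exprS.
by rewrite !mulN1r !mulNr; congr (- _); ring.
Qed.

End HirotaSeries.

Section HirotaPoint.
Context {R : realType}.
Local Notation C := R[i].
Implicit Types (v : (nat -> C) -> C) (p : nat -> C).

Lemma hirota_same_second c v p i j : (0 < i)%N -> (0 < j)%N ->
  hirota_same c v p ->
  partials [:: (c, i); (c, j)] v p = (i * j)%:R *
    \sum_(1 <= m < (i + j).+1) \sum_(q <- compositions (i + j) m)
      ratr (Tnum i j q) *
      \prod_(a <- q) (a%:R^-1 * partials [:: (false, 0%N); (c, a)] v p).
Proof.
move=> i0 j0 H.
pose w a := a%:R^-1 * partials [:: (false, 0%N); (c, a)] v p.
have := @hirota_log R w (DD c c v p) (- D0x c v p) (- D0y c v p) (i + j) i j.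
rewrite -(Tnum_expansion w (erefl (i + j)%N)) /DD i0 j0 /= => <-//.
- rewrite natrM mulrA divff ?mul1r// mulf_neq0 ?pnatr_eq0 -?lt0n//.
- by move=> a b; rewrite !fctE /D0x; case: ifP; rewrite ?oppr0.
- by move=> a b; rewrite !fctE /D0y; case: ifP; rewrite ?oppr0.
- exact: leq_addr.
Qed.

(** When all d_0 d_a v and d_0 dbar_a v vanish, the right side of the mixed equation is t x y with t
    = e^(d_0^2 v). So - D Dbar v = log (1 - t x y), whose only nonzero coefficients are the - t^i /
    i on the diagonal. *)
Lemma hirota_mixed_second v p (t : C) i j : (0 < i)%N -> (0 < j)%N ->
  (forall c a, (0 < a)%N -> partials [:: (false, 0%N); (c, a)] v p = 0) ->
  cexp (partials [:: (false, 0%N); (false, 0%N)] v p) = t ->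
  hirota_mixed v p ->
  partials [:: (false, i); (true, j)] v p = if i == j then i%:R * t ^+ i else 0.
Proof.
move=> i0 j0 D0 ht H.
pose G : @series2 R := fun a b => if (a == 1%N) && (b == 1%N) then - t else 0.
have spowG n a b : spow G n a b = if (a == n) && (b == n) then (- t) ^+ n else 0.
  elim: n a b => [|n IH] a b; first by [].
  have G0 l : G 0%N l = 0 by [].
  have Gk0 k : G k 0%N = 0 by rewrite /G andbF.
  have GSS k l : G k.+2 l = 0 by [].
  have G1SS l : G 1%N l.+2 = 0 by [].
  rewrite spowS mul2E; case: a => [|a].
    by rewrite big_nat1 big1// => k _; rewrite G0 mul0r.
  case: b => [|b].
    by rewrite andbF big1// => k _; rewrite big_nat1 Gk0 mul0r.
  rewrite big_nat_recl// [X in X + _]big1 ?add0r; last by move=> k _; rewrite G0 mul0r.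
  rewrite big_nat_recl// [X in _ + X]big1 ?addr0; last first.
    by move=> k _; rewrite big1// => l _; rewrite GSS mul0r.
  rewrite big_nat_recl// Gk0 mul0r add0r.
  rewrite big_nat_recl// [X in _ + X]big1 ?addr0; last first.
    by move=> k _; rewrite G1SS mul0r.
  rewrite IH !subSS !subn0 !eqSS exprS.
  by case: ifP; rewrite ?mulr0.
have E : exp2 (- DD false true v p) = const2 1 + G.
  have e0 : const2 (partials [:: (false, 0%N); (false, 0%N)] v p)
     + D0x false v p + D0y true v p =
     const2 (partials [:: (false, 0%N); (false, 0%N)] v p).
    apply/funext => a; apply/funext => b; rewrite !fctE /D0x /D0y.
    case: ifP => [/andP[a0 _]|_]; rewrite ?(D0 _ _ a0) ?mulr0 addr0.
      by case: ifP => [/andP[_ b0]|_]; rewrite ?(D0 _ _ b0) ?mulr0 addr0.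
    by case: ifP => [/andP[_ b0]|_]; rewrite ?(D0 _ _ b0) ?mulr0 addr0.
  have ec a b : exp2 (const2 (partials [:: (false, 0%N); (false, 0%N)] v p)) a b =
      t * const2 1 a b.
    rewrite /exp2 {1 3}/const2 /= ht; congr (_ * _).
    rewrite big_ord_recl fact0 invr1 mul1r /= big1 ?addr0// => n _.
    rewrite /bump /= ?add1n ?iterS mul2E [X in _ * X]big1 ?mulr0// => k _.
    by rewrite big1// => l _; rewrite !fctE subrr mul0r.
  apply/funext => a; apply/funext => b.
  have := congr1 (fun s : @series2 R => s a b) H; rewrite e0 !fctE => h.
  rewrite -[LHS](subKr (const2 1 a b)) h {h}; congr (_ + _).
  case: a => [|a]; first by rewrite oppr0.
  case: b => [|b]; first by rewrite /= oppr0 /G andbF.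
  by rewrite /= ec /G !eqSS /const2; case: ifP; rewrite ?mulr1 ?mulr0 ?oppr0.
have DD0 b : (- DD false true v p) 0%N b = 0 by rewrite fctE /DD oppr0.
have G0 b : G 0%N b = 0 by [].
have := log_exp2 DD0 G0 E j (leqnn i).
under eq_bigr => k _ do rewrite spowG.
rewrite !fctE /DD /= i0 j0 /= => h.
have ij0 : i%:R * j%:R != 0 :> C by rewrite mulf_neq0// pnatr_eq0 -lt0n.
apply: (mulfI (invr_neq0 ij0)); apply: oppr_inj; rewrite h.
case: eqP => [ij|ij]; last first.
  rewrite mulr0 oppr0 big1// => k _; rewrite ifF ?mulr0//.
  by apply/negP => /andP[/eqP ? /eqP ?]; subst.
have hin : i \in index_iota 1 i.+1 by rewrite mem_index_iota i0 ltnSn.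
rewrite (bigD1_seq _ hin) ?iota_uniq//= [X in _ + X]big1 ?addr0; last first.
  by move=> k hk; rewrite eq_sym (negPf hk) mulr0.
have e : (-1) ^+ i.+1 / i%:R * (- t) ^+ i = - (t ^+ i / i%:R).
  rewrite [(- t) ^+ i]exprNn exprS mulN1r !mulNr mulrACA -expr2 sqrr_sign.
  by rewrite mul1r mulrC.
rewrite -ij !eqxx /= e; congr (- _).
by rewrite invfM -mulrA mulKf ?pnatr_eq0 -?lt0n// mulrC.
Qed.

End HirotaPoint.

(** * The ring of differential polynomials in v *)

Local Open Scope classical_set_scope.
Local Open Scope complex_scope.

Section PathDerivative.
Context {R : realType}.
Local Notation C := R[i].
Implicit Types f g : R -> C.

Definition path_derivable f :=
  derivable (fun s : R => complex.Re (f s)) 0 1 /\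
  derivable (fun s : R => complex.Im (f s)) 0 1.

Definition path_derive f : C :=
  derive1 (fun s : R => complex.Re (f s)) 0 +i*
  derive1 (fun s : R => complex.Im (f s)) 0.

Lemma ReD (x y : C) : complex.Re (x + y) = complex.Re x + complex.Re y.
Proof. by case: x y => [a b] [c d]. Qed.

Lemma ImD (x y : C) : complex.Im (x + y) = complex.Im x + complex.Im y.
Proof. by case: x y => [a b] [c d]. Qed.

Lemma ReM (x y : C) : complex.Re (x * y) =
  complex.Re x * complex.Re y - complex.Im x * complex.Im y.
Proof. by case: x y => [a b] [c d]. Qed.

Lemma ImM (x y : C) : complex.Im (x * y) =
  complex.Re x * complex.Im y + complex.Im x * complex.Re y.
Proof. by case: x y => [a b] [c d]. Qed.

Lemma near_path_derivable f g : (\forall s \near (0 : R), f s = g s) ->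
  path_derivable f -> path_derivable g.
Proof.
move=> fg [h1 h2]; split; [move: h1|move: h2]; apply: near_eq_derivable;
  by near=> s; congr (_ _); near: s.
Unshelve. all: by end_near. Qed.

Lemma near_path_derive f g : (\forall s \near (0 : R), f s = g s) ->
  path_derive f = path_derive g.
Proof.
move=> fg; rewrite /path_derive !derive1E; congr Complex;
  by apply: near_eq_derive; near=> s; congr (_ _); near: s.
Unshelve. all: by end_near. Qed.

Lemma path_derivable_cst (c : C) : path_derivable (fun=> c).
Proof. by split; exact: derivable_cst. Qed.

Lemma path_derive_cst (c : C) : path_derive (fun=> c) = 0.
Proof. by rewrite /path_derive !derive1_cst. Qed.

Lemma Re_pathD f g : (fun s => complex.Re (f s + g s)) =
  (fun s => complex.Re (f s)) + (fun s => complex.Re (g s)).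
Proof. by apply/funext => s; rewrite ReD. Qed.

Lemma Im_pathD f g : (fun s => complex.Im (f s + g s)) =
  (fun s => complex.Im (f s)) + (fun s => complex.Im (g s)).
Proof. by apply/funext => s; rewrite ImD. Qed.

Lemma Re_pathM f g : (fun s => complex.Re (f s * g s)) =
  (fun s => complex.Re (f s)) * (fun s => complex.Re (g s))
  - (fun s => complex.Im (f s)) * (fun s => complex.Im (g s)).
Proof. by apply/funext => s; rewrite ReM. Qed.

Lemma Im_pathM f g : (fun s => complex.Im (f s * g s)) =
  (fun s => complex.Re (f s)) * (fun s => complex.Im (g s))
  + (fun s => complex.Im (f s)) * (fun s => complex.Re (g s)).
Proof. by apply/funext => s; rewrite ImM. Qed.

Lemma path_derivableD f g : path_derivable f -> path_derivable g ->
  path_derivable (fun s => f s + g s).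
Proof.
move=> [f1 f2] [g1 g2]; rewrite /path_derivable Re_pathD Im_pathD.
split; [exact: (derivableD f1 g1)|exact: (derivableD f2 g2)].
Qed.

Lemma path_deriveD f g : path_derivable f -> path_derivable g ->
  path_derive (fun s => f s + g s) = path_derive f + path_derive g.
Proof.
move=> [f1 f2] [g1 g2]; rewrite /path_derive !derive1E Re_pathD Im_pathD.
by rewrite (deriveD f1 g1) (deriveD f2 g2).
Qed.

Lemma path_derivableM f g : path_derivable f -> path_derivable g ->
  path_derivable (fun s => f s * g s).
Proof.
move=> [f1 f2] [g1 g2]; rewrite /path_derivable Re_pathM Im_pathM; split.
  exact: (derivableB (derivableM f1 g1) (derivableM f2 g2)).
exact: (derivableD (derivableM f1 g2) (derivableM f2 g1)).
Qed.

Lemma complex_leibniz (a b a' b' c e c' e' : R) :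
  (a *: c' + c *: a' - (b *: e' + e *: b')) +i* (a *: e' + e *: a' + (b *: c' + c *: b'))
  = (a' +i* b') * (c +i* e) + (a +i* b) * (c' +i* e').
Proof.
rewrite /GRing.scale /=.
by apply/eqP; rewrite eq_complex /=; apply/andP; split; apply/eqP; ring.
Qed.

Lemma path_deriveM f g : path_derivable f -> path_derivable g ->
  path_derive (fun s => f s * g s) = path_derive f * g 0 + f 0 * path_derive g.
Proof.
move=> [f1 f2] [g1 g2]; rewrite /path_derive !derive1E Re_pathM Im_pathM.
rewrite (deriveB (derivableM f1 g1) (derivableM f2 g2)).
rewrite (deriveD (derivableM f1 g2) (derivableM f2 g1)).
rewrite (deriveM f1 g1) (deriveM f2 g2) (deriveM f1 g2) (deriveM f2 g1).
by case: (f 0) (g 0) => [a b] [c e]; exact: complex_leibniz.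
Qed.

End PathDerivative.

Section DifferentialPolynomials.
Context {R : realType}.
Local Notation C := R[i].
Local Notation point := (nat -> C).
Variables (U : set point) (v : point -> C).

(** The increments used by [partial]; t_0 is only moved along the reals. *)
Definition direction (k : nat) (w : C) := w = 1 \/ (k != 0%N /\ w = 'i).

Hypothesis U_open : forall p k w, U p -> direction k w ->
  \forall s \near (0 : R), U (move p k w s).
Hypothesis v_smooth : has_all_partials U v.

Lemma move0 p k (w : C) : move p k w 0 = p.
Proof. by apply/funext => j; rewrite /move mul0r addr0 if_same. Qed.

(** The differential polynomials in [v]: the functions on which the partial
    derivatives of [has_all_partials] obey the rules of calculus. *)
Inductive dpoly : (point -> C) -> Prop :=
| dpoly_partials xs : dpoly (partials xs v)
| dpoly_cst c : dpoly (fun=> c)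
| dpolyD F G : dpoly F -> dpoly G -> dpoly (fun p => F p + G p)
| dpolyM F G : dpoly F -> dpoly G -> dpoly (fun p => F p * G p)
| dpoly_eq F G : (forall p, U p -> F p = G p) -> dpoly F -> dpoly G.

(** The clause [dpoly_eq] is where [U_open] enters: equality on U carries over to derivatives
    because U contains a short segment about p in each direction. *)
Lemma dpoly_derivable F p k w : dpoly F -> U p -> direction k w ->
  path_derivable (fun s => F (move p k w s)).
Proof.
move=> dF Up dir; elim: dF => {F}.
- move=> xs; have [h1 h2] := v_smooth.1 xs p k Up.
  by case: dir => [->//|[k0 ->]]; exact: h2.
- by move=> c; exact: path_derivable_cst.
- by move=> F G _ hF _ hG; exact: path_derivableD.
- by move=> F G _ hF _ hG; exact: path_derivableM.
- move=> F G FG _; apply: near_path_derivable.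
  by have := U_open Up dir; apply: filterS => s; exact: FG.
Qed.

Lemma derivative_alongE (F : point -> C) p k w :
  derivative_along F p k w = path_derive (fun s => F (move p k w s)).
Proof. by []. Qed.

Lemma derivative_along_eq (F G : point -> C) p k w : (forall p, U p -> F p = G p) ->
  U p -> direction k w -> derivative_along F p k w = derivative_along G p k w.
Proof.
move=> FG Up dir; apply: near_path_derive.
by have := U_open Up dir; apply: filterS => s; exact: FG.
Qed.

Lemma derivative_alongD F G p k w : dpoly F -> dpoly G -> U p -> direction k w ->
  derivative_along (fun p => F p + G p) p k w =
  derivative_along F p k w + derivative_along G p k w.
Proof. by move=> dF dG Up dir; apply: path_deriveD; exact: dpoly_derivable. Qed.

Lemma derivative_alongM F G p k w : dpoly F -> dpoly G -> U p -> direction k w ->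
  derivative_along (fun p => F p * G p) p k w =
  derivative_along F p k w * G p + F p * derivative_along G p k w.
Proof.
move=> dF dG Up dir; rewrite derivative_alongE path_deriveM ?move0//;
  exact: dpoly_derivable.
Qed.

Lemma derivative_along_cst (c : C) p k w : derivative_along (fun=> c) p k w = 0.
Proof. exact: path_derive_cst. Qed.

Lemma dir1 k : direction k 1. Proof. by left. Qed.

Lemma diri k : k != 0%N -> direction k 'i. Proof. by right. Qed.

Lemma partial_eq x (F G : point -> C) p : (forall p, U p -> F p = G p) -> U p ->
  partial x F p = partial x G p.
Proof.
case: x => c k FG Up; rewrite /partial.
rewrite (derivative_along_eq FG Up (dir1 k)).
by case: eqP => // /eqP k0; rewrite (derivative_along_eq FG Up (diri k0)).
Qed.

Lemma partialD x F G p : dpoly F -> dpoly G -> U p ->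
  partial x (fun p => F p + G p) p = partial x F p + partial x G p.
Proof.
case: x => c k dF dG Up; rewrite /partial.
rewrite (derivative_alongD dF dG Up (dir1 k)).
case: eqP => // /eqP k0; rewrite (derivative_alongD dF dG Up (diri k0)).
by case: c; ring.
Qed.

Lemma partialM x F G p : dpoly F -> dpoly G -> U p ->
  partial x (fun p => F p * G p) p = partial x F p * G p + F p * partial x G p.
Proof.
case: x => c k dF dG Up; rewrite /partial.
rewrite (derivative_alongM dF dG Up (dir1 k)).
case: eqP => // /eqP k0; rewrite (derivative_alongM dF dG Up (diri k0)).
by case: c; ring.
Qed.

Lemma partial_cst x (c : C) p : partial x (fun=> c) p = 0.
Proof.
case: x => b k; rewrite /partial !derivative_along_cst.
by rewrite mulr0 addr0 subr0 mulr0 !if_same.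
Qed.

Lemma dpoly_partial x F : dpoly F -> dpoly (partial x F).
Proof.
elim=> {F}.
- by move=> xs; exact: (dpoly_partials (x :: xs)).
- move=> c; apply: (@dpoly_eq (fun=> 0)); last exact: dpoly_cst.
  by move=> p Up; rewrite partial_cst.
- move=> F G dF hF dG hG.
  apply: (@dpoly_eq (fun p => partial x F p + partial x G p)).
    by move=> p Up; rewrite partialD.
  exact: dpolyD.
- move=> F G dF hF dG hG.
  apply: (@dpoly_eq (fun p => partial x F p * G p + F p * partial x G p)).
    by move=> p Up; rewrite partialM.
  by apply: dpolyD; apply: dpolyM.
- move=> F G FG dF; apply: dpoly_eq => p Up.
  exact: partial_eq.
Qed.

End DifferentialPolynomials.

Section DifferentialRing.
Context {R : realType}.
Local Notation C := R[i].
Local Notation point := (nat -> C).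
Variables (U : set point) (v : point -> C).

(** Restricting to U identifies functions that agree there, so rules valid at the points of U become
    identities in a ring. *)
Definition dpoly_on : {pred ({p | U p} -> C)} :=
  fun f => `[< exists2 F, dpoly U v F & f = F \o sval >].

Lemma dpoly_on_subring : GRing.subring_closed dpoly_on.
Proof.
split.
- by apply/asboolP; exists (fun=> 1); [exact: dpoly_cst|].
- move=> f g /asboolP[F dF ->] /asboolP[G dG ->]; apply/asboolP.
  exists (fun p => F p + (-1) * G p).
    by apply: dpolyD => //; apply: dpolyM => //; exact: dpoly_cst.
  by apply/funext => t; rewrite !fctE /= mulN1r.
- move=> f g /asboolP[F dF ->] /asboolP[G dG ->]; apply/asboolP.
  by exists (fun p => F p * G p); [exact: dpolyM|].
Qed.

HB.instance Definition _ :=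
  GRing.isSubringClosed.Build ({p | U p} -> C) dpoly_on dpoly_on_subring.

Definition dring := {f : {p | U p} -> C | dpoly_on f}.

HB.instance Definition _ := [isSub of dring for @sval _ _].
HB.instance Definition _ := [Choice of dring by <:].
HB.instance Definition _ :=
  GRing.SubChoice_isSubComPzRing.Build _ _ dring dpoly_on_subring.

Definition dring_of F (dF : dpoly U v F) : dring :=
  exist _ (F \o sval) (introT (asboolP _) (ex_intro2 _ _ F dF erefl)).

Definition evaluate p (Up : U p) (f : dring) : C := val f (exist _ p Up).

Lemma evaluateB p (Up : U p) : {morph evaluate Up : f g / f - g}.
Proof. by move=> f g; rewrite /evaluate rmorphB. Qed.

Lemma evaluate1M p (Up : U p) : monoid_morphism (evaluate Up).
Proof.
by split; [rewrite /evaluate rmorph1 | move=> f g; rewrite /evaluate rmorphM].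
Qed.

HB.instance Definition _ p (Up : U p) :=
  GRing.isZmodMorphism.Build dring C (evaluate Up) (evaluateB Up).
HB.instance Definition _ p (Up : U p) :=
  GRing.isMonoidMorphism.Build dring C (evaluate Up) (evaluate1M Up).

Lemma evaluate_inj f g : (forall p (Up : U p), evaluate Up f = evaluate Up g) -> f = g.
Proof.
move=> fg; apply: val_inj; apply/funext => -[p Up]; exact: fg.
Qed.

Lemma evaluate_of F (dF : dpoly U v F) p (Up : U p) : evaluate Up (dring_of dF) = F p.
Proof. by []. Qed.

(** [partial] acts on functions of all points. The value 0 outside U is a default that derivatives
    at points of U do not see. *)
Definition extend (f : dring) : point -> C := fun p =>
  if pselect (U p) is left Up then evaluate Up f else 0.

Lemma extendE f p (Up : U p) : extend f p = evaluate Up f.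
Proof.
by rewrite /extend; case: pselect => // Up'; congr (evaluate _ f); exact: Prop_irrelevance.
Qed.

Lemma dpoly_extend f : dpoly U v (extend f).
Proof.
case: f => f df; have /asboolP[F dF fE] := df.
apply: dpoly_eq dF => p Up; rewrite (extendE _ Up) /evaluate /=.
by rewrite fE.
Qed.

Definition dconst (q : rat) : dring := dring_of (dpoly_cst U v (ratr q)).

Lemma dconstB : {morph dconst : x y / x - y}.
Proof.
move=> x y; apply: evaluate_inj => p Up.
by rewrite rmorphB /= /dconst !evaluate_of rmorphB.
Qed.

Lemma dconst1M : monoid_morphism dconst.
Proof.
split; first by apply: evaluate_inj => p Up; rewrite rmorph1 evaluate_of rmorph1.
move=> x y; apply: evaluate_inj => p Up.
by rewrite rmorphM /= /dconst !evaluate_of rmorphM.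
Qed.

HB.instance Definition _ := GRing.isZmodMorphism.Build rat dring dconst dconstB.
HB.instance Definition _ := GRing.isMonoidMorphism.Build rat dring dconst dconst1M.

Lemma evaluateD p (Up : U p) f g :
  evaluate Up (f + g) = evaluate Up f + evaluate Up g.
Proof. exact: (rmorphD (evaluate Up)). Qed.

Lemma evaluateM p (Up : U p) f g :
  evaluate Up (f * g) = evaluate Up f * evaluate Up g.
Proof. exact: (rmorphM (evaluate Up)). Qed.

Lemma evaluate_sum p (Up : U p) (I : Type) (r : seq I) P (F : I -> dring) :
  evaluate Up (\sum_(i <- r | P i) F i) = \sum_(i <- r | P i) evaluate Up (F i).
Proof. exact: (rmorph_sum (evaluate Up)). Qed.

Lemma evaluate_prod p (Up : U p) (I : Type) (r : seq I) P (F : I -> dring) :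
  evaluate Up (\prod_(i <- r | P i) F i) = \prod_(i <- r | P i) evaluate Up (F i).
Proof. exact: (rmorph_prod (evaluate Up)). Qed.

Lemma evaluate_const p (Up : U p) q : evaluate Up (dconst q) = ratr q.
Proof. by []. Qed.

Hypothesis U_open : forall p k w, U p -> direction k w ->
  \forall s \near (0 : R), U (move p k w s).
Hypothesis v_smooth : has_all_partials U v.

Definition dder x (f : dring) : dring :=
  dring_of (dpoly_partial U_open v_smooth x (dpoly_extend f)).

Lemma evaluate_dder x f p (Up : U p) : evaluate Up (dder x f) = partial x (extend f) p.
Proof. by []. Qed.

Lemma dderD x : {morph dder x : f g / f + g}.
Proof.
move=> f g; apply: evaluate_inj => p Up.
have key : partial x (extend (f + g)) p = partial x (extend f) p + partial x (extend g) p.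
  rewrite -(partialD U_open v_smooth _ (dpoly_extend f) (dpoly_extend g) Up).
  apply: (partial_eq U_open) => // q Uq.
  by rewrite !(extendE _ Uq) evaluateD.
exact: (etrans key (esym (evaluateD Up (dder x f) (dder x g)))).
Qed.

Lemma dderM x f g : dder x (f * g) = dder x f * g + f * dder x g.
Proof.
apply: evaluate_inj => p Up.
have key : partial x (extend (f * g)) p =
    partial x (extend f) p * evaluate Up g + evaluate Up f * partial x (extend g) p.
  rewrite -!extendE -(partialM U_open v_smooth _ (dpoly_extend f) (dpoly_extend g) Up).
  apply: (partial_eq U_open) => // q Uq.
  by rewrite !(extendE _ Uq) evaluateM.
have e : evaluate Up (dder x f * g + f * dder x g) =
    evaluate Up (dder x f) * evaluate Up g + evaluate Up f * evaluate Up (dder x g).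
  exact: etrans (evaluateD _ _ _) (congr2 +%R (evaluateM _ _ _) (evaluateM _ _ _)).
exact: (etrans key (esym e)).
Qed.

Lemma dder_const x c : dder x (dconst c) = 0.
Proof.
apply: evaluate_inj => p Up; rewrite rmorph0 evaluate_dder.
rewrite -[RHS](partial_cst x (ratr c : C) p).
by apply: (partial_eq U_open) => // q Uq; rewrite (extendE _ Uq) evaluate_of.
Qed.

Definition dgen : dring := dring_of (dpoly_partials U v [::]).

Lemma evaluate_partials xs p (Up : U p) :
  evaluate Up (foldr dder dgen xs) = partials xs v p.
Proof.
elim: xs p Up => [|x xs IH] p Up; first by rewrite /= evaluate_of.
rewrite /= evaluate_dder; apply: (partial_eq U_open) => // q Uq.
by rewrite extendE.
Qed.

Lemma dgen_perm xs ys : perm_eq xs ys -> foldr dder dgen xs = foldr dder dgen ys.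
Proof.
move=> xy; apply: evaluate_inj => p Up; rewrite !evaluate_partials.
exact: v_smooth.2.
Qed.

Hypothesis hirota : dispersionless_hirota U v.

Lemma dgen_second c i j : (0 < i)%N -> (0 < j)%N ->
  foldr dder dgen [:: (c, i); (c, j)] =
  dconst (i * j)%:R * \sum_(1 <= m < (i + j).+1) \sum_(q <- compositions (i + j) m)
     dconst (Tnum i j q) *
       \prod_(a <- q) dfactor dconst dder (false, 0%N) (fun k => (c, k)) dgen (a, 1%N).
Proof.
move=> i0 j0; apply: evaluate_inj => p Up; rewrite evaluate_partials.
have H : hirota_same c v p by case: (hirota Up); case: c.
rewrite (hirota_same_second i0 j0 H) evaluateM evaluate_const ratr_nat.
congr (_ * _); rewrite evaluate_sum; apply: eq_bigr => m _.
rewrite evaluate_sum; apply: eq_bigr => q _.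
rewrite evaluateM evaluate_const evaluate_prod; congr (_ * _).
apply: eq_bigr => a _; rewrite evaluateM evaluate_const fmorphV rmorph_nat.
by rewrite -(evaluate_partials _ Up).
Qed.

End DifferentialRing.

(** * Circles centred at the origin *)

Section CircleContours.
Context {R : realType}.
Local Notation C := R[i].
Local Notation mu := (@lebesgue_measure R).

Definition cis (x : R) : C := cos x +i* sin x.

Lemma cisD x y : cis (x + y) = cis x * cis y.
Proof.
rewrite /cis cosD sinD; apply/eqP; rewrite eq_complex /=.
by apply/andP; split; apply/eqP; ring.
Qed.

Lemma cis0 : cis 0 = 1. Proof. by rewrite /cis cos0 sin0. Qed.

Lemma cisX x k : cis x ^+ k = cis (k%:R * x).
Proof.
elim: k => [|k IH]; first by rewrite expr0 mul0r cis0.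
by rewrite exprS IH -cisD -natr1 mulrDl mul1r addrC.
Qed.

Lemma circleE (r s : R) : circle r s = r%:C * cis s.
Proof.
by rewrite /circle /cis; apply/eqP; rewrite eq_complex /= !mul0r subr0 addr0 !eqxx.
Qed.

Lemma derive1_circle (r s : R) : velocity (circle r) s = r%:C * 'i%C * cis s.
Proof.
rewrite /velocity /circle /=.
rewrite !derive1E.
have -> : 'D_1 (fun u : R => r * cos u) s = - (r * sin s).
  by rewrite derive_val /GRing.scale /=; ring.
have -> : 'D_1 (fun u : R => r * sin u) s = r * cos s.
  by rewrite derive_val /GRing.scale /=; ring.
by apply/eqP; rewrite eq_complex /=; apply/andP; split; apply/eqP; ring.
Qed.

Lemma cos_sin_nat2pi k : cos (k%:R * (2 * pi)) = 1 :> R /\ sin (k%:R * (2 * pi)) = 0 :> R.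
Proof.
elim: k => [|k [c s]]; first by rewrite mul0r cos0 sin0.
rewrite -natr1 mulrDl mul1r cosD sinD c s mulr_natl cos2pi sin2pi; split; ring.
Qed.

(** On |z| = r the form conj(z) dz is i r^2 ds, so the contour integrals reduce to integrals of
    e^(iks) or e^(-iks) over a period. *)
Lemma conj_circle_velocity (r s : R) :
  (circle r s)^*%C * velocity (circle r) s = (r ^+ 2)%:C * 'i%C.
Proof.
have cs := cos2Dsin2 s.
rewrite derive1_circle /circle; apply/eqP; rewrite eq_complex /=.
apply/andP; split; apply/eqP; first by ring.
transitivity (r ^+ 2 * (cos s ^+ 2 + sin s ^+ 2)); first by ring.
by rewrite cs; ring.
Qed.

Lemma FTC_global (f F : R -> R) (a b : R) : a < b ->
  (forall x : R, derivable F x 1 /\ 'D_1 F x = f x) -> continuous f ->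
  (\int[mu]_(x in `[a, b]) (f x)%:E = (F b - F a)%:E)%E.
Proof.
move=> ab dF cf.
have cF : continuous F.
  move=> x; apply: differentiable_continuous; apply/derivable1_diffP.
  by have [] := dF x.
rewrite (continuous_FTC2 (F := F) ab)//.
- exact: continuous_subspaceT.
- split=> [x _||]; first by have [] := dF x.
    exact/cvg_at_right_filter/cF.
  exact/cvg_at_left_filter/cF.
- by move=> x _; rewrite derive1E; have [] := dF x.
Qed.

Lemma RFTC_global (f F : R -> R) (a b : R) : a < b ->
  (forall x : R, derivable F x 1 /\ 'D_1 F x = f x) -> continuous f ->
  \int[mu]_(x in `[a, b]) f x = F b - F a.
Proof. by move=> ab dF cf; rewrite /Rintegral (FTC_global ab dF cf). Qed.

Lemma Rintegral_sin_nat (k : nat) (c : R) : (0 < k)%N ->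
  \int[mu]_(s in `[0, 2 * pi]) (c * sin (k%:R * s)) = 0.
Proof.
move=> k0; have kn : k%:R != 0 :> R by rewrite pnatr_eq0 -lt0n.
rewrite (RFTC_global (F := fun s => - (c / k%:R) * cos (k%:R * s))).
- by have [-> _] := cos_sin_nat2pi k; rewrite mulr0 cos0 subrr.
- by rewrite mulr_gt0// pi_gt0.
- move=> x; split; first exact: ex_derive.
  by rewrite derive_val /GRing.scale /=; field.
- move=> x; apply/differentiable_continuous/derivable1_diffP.
  exact: ex_derive.
Qed.

Lemma Rintegral_cos_nat (k : nat) (c : R) : (0 < k)%N ->
  \int[mu]_(s in `[0, 2 * pi]) (c * cos (k%:R * s)) = 0.
Proof.
move=> k0; have kn : k%:R != 0 :> R by rewrite pnatr_eq0 -lt0n.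
rewrite (RFTC_global (F := fun s => c / k%:R * sin (k%:R * s))).
- by have [_ ->] := cos_sin_nat2pi k; rewrite !mulr0 sin0 mulr0 subrr.
- by rewrite mulr_gt0// pi_gt0.
- move=> x; split; first exact: ex_derive.
  by rewrite derive_val /GRing.scale /=; field.
- move=> x; apply/differentiable_continuous/derivable1_diffP.
  exact: ex_derive.
Qed.

Lemma contour_circle_pos (r : R) k : (0 < k)%N ->
  contour_integral (circle r) (fun z => z ^+ k * z^*%C) = 0.
Proof.
move=> k0; rewrite /contour_integral.
have E s : circle r s ^+ k * (circle r s)^*%C * velocity (circle r) s =
    (- (r ^+ (k + 2)) * sin (k%:R * s)) +i* (r ^+ (k + 2) * cos (k%:R * s)).
  rewrite -mulrA conj_circle_velocity circleE exprMn cisX -rmorphXn.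
  by apply/eqP; rewrite eq_complex /= exprD; apply/andP; split; apply/eqP; ring.
under eq_Rintegral do rewrite E /=.
rewrite Rintegral_sin_nat//.
under eq_Rintegral do rewrite E /=.
by rewrite Rintegral_cos_nat.
Qed.

Lemma contour_circle_neg (r : R) k : 0 < r -> (0 < k)%N ->
  contour_integral (circle r) (fun z => z ^- k * z^*%C) = 0.
Proof.
move=> r0 k0; rewrite /contour_integral.
have E s : circle r s ^- k * (circle r s)^*%C * velocity (circle r) s =
    (r ^+ 2 / r ^+ k * sin (k%:R * s)) +i* (r ^+ 2 / r ^+ k * cos (k%:R * s)).
  rewrite -mulrA conj_circle_velocity circleE exprMn cisX -rmorphXn.
  have -> : ((r ^+ k)%:C * cis (k%:R * s))^-1 = (r ^- k)%:C * cis (- (k%:R * s)).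
    apply: mulr1_eq; rewrite mulrACA -rmorphM -cisD subrr cis0 divff.
      by rewrite rmorph1 mulr1.
    by rewrite expf_neq0// gt_eqF.
  rewrite /cis cosN sinN.
  by apply/eqP; rewrite eq_complex /=; apply/andP; split; apply/eqP; ring.
under eq_Rintegral do rewrite E /=.
rewrite Rintegral_sin_nat//.
under eq_Rintegral do rewrite E /=.
by rewrite Rintegral_cos_nat.
Qed.

End CircleContours.

(** * The domain bounded by a circle *)

Section CircleInterior.
Context {R : realType}.
Implicit Types (r : R) (z : R * R).

Definition sqnorm z : R := z.1 ^+ 2 + z.2 ^+ 2.

Definition disc r : set (R * R) := [set z | sqnorm z < r ^+ 2].

Lemma continuous_sqnorm : continuous sqnorm.
Proof.
move=> z; apply: cvgD.
  apply: (cvg_comp fst (fun x : R => x ^+ 2)); first exact: cvg_fst.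
  exact: exprn_continuous.
apply: (cvg_comp snd (fun x : R => x ^+ 2)); first exact: cvg_snd.
exact: exprn_continuous.
Qed.

Lemma trace_circle r : 0 < r ->
  Defs.trace (circle r) = [set z | sqnorm z = r ^+ 2].
Proof.
move=> r0; apply/seteqP; split => [z [s _ <-]|[x y]] /=.
  rewrite /sqnorm /circle /= !exprMn -mulrDr cos2Dsin2 mulr1//.
rewrite /sqnorm /= => h.
have xr : -1 <= x / r <= 1.
  rewrite ler_pdivlMr// ler_pdivrMr// mulN1r mul1r -ler_norml.
  rewrite -(ger0_norm (ltW r0)) -ler_sqr ?nnegrE// -!normrX.
  by rewrite !ger0_norm ?sqr_ge0// -h lerDl sqr_ge0.
have sy : r * Num.sqrt (1 - (x / r) ^+ 2) = `|y|.
  rewrite -sqrtr_sqr -{1}(ger0_norm (ltW r0)) -sqrtr_sqr -sqrtrM ?sqr_ge0//.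
  congr Num.sqrt; rewrite mulrBr mulr1 expr_div_n mulrC divfK ?expf_neq0 ?gt_eqF//.
  by rewrite -h addrC addKr.
have [y0|y0] := leP 0 y.
  exists (acos (x / r)) => //; rewrite /circle /= acosK ?in_itv//= sin_acos//.
  by rewrite sy ger0_norm// mulrC divfK ?gt_eqF.
exists (- acos (x / r)) => //; rewrite /circle /= cosN sinN acosK ?in_itv//= sin_acos//.
by rewrite mulrN sy ltr0_norm// opprK mulrC divfK ?gt_eqF.
Qed.

(** From a point outside, the ray s z with s >= 1 avoids the circle and is unbounded, so its
    component is unbounded. From a point inside, the image of its component under [sqnorm] is an
    interval that misses r^2, so the component stays in the disc. *)
Lemma interior_circle r : 0 < r -> interior_domain (circle r) = disc r.
Proof.
move=> r0; rewrite /interior_domain trace_circle//; apply/seteqP.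
set T := [set z | sqnorm z = r ^+ 2].
split=> z /=.
  move=> [Tz bz]; rewrite /disc /= ltNge; apply/negP => rz.
  have rz' : r ^+ 2 < sqnorm z by rewrite lt_neqAle rz andbT eq_sym; apply/eqP.
  pose ray := (fun s : R => (s * z.1, s * z.2)) @` `[1, +oo[.
  have rayC : ray `<=` connected_component (~` T) z.
    apply: connected_component_max.
    - exists 1; first by rewrite /= in_itv /= lexx.
      by rewrite !mul1r -surjective_pairing.
    - move=> _ [s hs <-] /= Ts.
      have s1 : 1 <= s by move: hs; rewrite /= in_itv /= andbT.
      move: rz'; rewrite -Ts /sqnorm /= !exprMn -mulrDr -/(sqnorm z).
      apply/negP; rewrite -leNgt ler_peMl ?addr_ge0 ?sqr_ge0//.
      by rewrite exprn_ege1.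
    - apply: connected_continuous_connected.
        by apply/connected_intervalP; exact: interval_is_interval.
      exact/continuous_subspaceT/(scalel_continuous (x := z)).
  have [M [_ hM]] := bz.
  pose M' := Num.max M 0 + 1.
  have /hM {}hM : M < M' by rewrite /M' ltr_pwDr// le_max lexx.
  have z0 : 0 < `|z|.
    rewrite normr_gt0; apply/eqP => z0; move: rz'; rewrite z0 /sqnorm /=.
    by rewrite expr0n addr0 ltNge sqr_ge0.
  pose s := Num.max 1 ((M' + 1) / `|z|).
  have ray_s : ray (s * z.1, s * z.2).
    by exists s => //; rewrite /= in_itv /= andbT le_max lexx.
  have := hM _ (rayC _ ray_s); apply/negP; rewrite -ltNge.
  have -> : (s * z.1, s * z.2) = s *: z by [].
  rewrite normrZ.
  have s0 : 0 < s by rewrite lt_max ltr01.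
  rewrite (gtr0_norm s0); apply: (@lt_le_trans _ _ (M' + 1)); first by rewrite ltrDl.
  by rewrite -ler_pdivrMr// le_max lexx orbT.
move=> rz; split; first by move=> Tz; move: rz; rewrite /disc /= Tz ltxx.
have sub : connected_component (~` T) z `<=` disc r.
  move=> w Cw; rewrite /disc /= ltNge; apply/negP => rw.
  have : is_interval (sqnorm @` connected_component (~` T) z).
    apply/connected_intervalP; apply: connected_continuous_connected.
      exact: component_connected.
    exact/continuous_subspaceT/continuous_sqnorm.
  move=> itv; have [|||y Cy yr] := itv (sqnorm z) (sqnorm w) _ _ (r ^+ 2).
  - exists z => //; apply: connected_component_refl => Tz.
    by move: rz; rewrite /disc /= Tz ltxx.
  - by exists w.
  - by rewrite (ltW rz) rw.
  - by have := connected_component_sub Cy; apply.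
exists r; split; first exact: num_real.
move=> M rM w /sub; rewrite /disc /= => wr.
have hc (a b : R) : a ^+ 2 + b ^+ 2 < r ^+ 2 -> `|a| <= M.
  move=> h; apply: le_trans (ltW rM); rewrite -(ger0_norm (ltW r0)).
  rewrite -ler_sqr ?nnegrE// -!normrX !ger0_norm ?sqr_ge0//.
  by apply: le_trans (ltW h); rewrite lerDl sqr_ge0.
rewrite /= prod_normE /= ge_max (hc _ _ wr) /= (hc w.2 w.1)//.
by rewrite addrC.
Qed.

End CircleInterior.

(** * The area of a disc *)

Section DiscArea.
Context {R : realType}.
Implicit Types (r : R) (z : R * R).
Local Notation mu := (@lebesgue_measure R).
Local Notation mu2 := (mu \x mu)%E.

Lemma measurable_sqnorm : measurable_fun setT (@sqnorm R).
Proof.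
apply: measurable_funD; apply: measurable_funX.
  exact: measurable_fst.
exact: measurable_snd.
Qed.

Lemma measurable_disc r : measurable (disc r).
Proof.
have -> : disc r = setT `&` (@sqnorm R) @^-1` `]-oo, r ^+ 2[.
  by rewrite setTI; apply/seteqP; split => z; rewrite /disc /= in_itv.
exact: measurable_sqnorm.
Qed.

Lemma xsection_disc r (x : R) : xsection (disc r) x =
  `]- Num.sqrt (r ^+ 2 - x ^+ 2), Num.sqrt (r ^+ 2 - x ^+ 2)[%classic.
Proof.
apply/seteqP; split => y; rewrite /xsection /= in_itv /= -ltr_norml ?inE /disc /sqnorm /=.
  move=> h; rewrite -sqrtr_sqr ltr_sqrt; first by rewrite ltrBrDl.
  by rewrite subr_gt0 (le_lt_trans _ h)// lerDl sqr_ge0.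
rewrite -sqrtr_sqr => h.
have h0 : 0 < r ^+ 2 - x ^+ 2.
  rewrite ltNge; apply/negP => /ler0_sqrtr e.
  by move: h; rewrite e ltNge sqrtr_ge0.
by move: h; rewrite ltr_sqrt// ltrBrDl.
Qed.

(** Valid for |x| > r too: the section is empty and [Num.sqrt] of a negative number is 0. *)
Lemma measure_chord r (x : R) :
  mu (xsection (disc r) x) = (2 * Num.sqrt (r ^+ 2 - x ^+ 2))%R%:E.
Proof.
rewrite xsection_disc lebesgue_measure_itv /= lte_fin.
have := sqrtr_ge0 (r ^+ 2 - x ^+ 2); rewrite le_eqVlt => /orP[/eqP <-|s0].
  by rewrite oppr0 ltxx mulr0.
by rewrite gtrN// -EFinB opprK mulr_natl mulr2n.
Qed.

Lemma integral_cos2 r :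
  (\int[mu]_(x in `[(- (pi / 2))%R, (pi / 2)%R]) (2 * r ^+ 2 * cos x ^+ 2)%R%:E
   = (pi * r ^+ 2)%R%:E)%E.
Proof.
rewrite (FTC_global (F := fun s => r ^+ 2 * (s + sin s * cos s))).
- by rewrite sinN cosN cos_pihalf; congr EFin; field.
- by rewrite gtrN// divr_gt0// pi_gt0.
- move=> x; split; first exact: ex_derive.
  rewrite derive_val /GRing.scale /=.
  transitivity (r ^+ 2 * (1 + cos x ^+ 2 - sin x ^+ 2)); first by ring.
  have -> : sin x ^+ 2 = 1 - cos x ^+ 2 by rewrite -(cos2Dsin2 x) addrC addKr.
  by ring.
- move=> x; apply/differentiable_continuous/derivable1_diffP.
  exact: ex_derive.
Qed.

(** The substitution x = r sin s turns the half chord into r cos s, which is nonnegative on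
    [-pi/2, pi/2]. *)
Lemma integral_chord r : 0 < r ->
  (\int[mu]_(x in `[(- r)%R, r]) (2 * Num.sqrt (r ^+ 2 - x ^+ 2))%R%:E
   = (pi * r ^+ 2)%R%:E)%E.
Proof.
move=> r0.
pose F (x : R) := r * sin x.
have dF x : F^`() x = r * cos x.
  by rewrite derive1E derive_val /GRing.scale /=; ring.
have dF' : F^`() = fun x => r * cos x by apply/funext.
have Fa : F (- (pi / 2)) = - r by rewrite /F sinN sin_pihalf mulrN mulr1.
have Fb : F (pi / 2) = r by rewrite /F sin_pihalf mulr1.
have cdF : continuous (fun x : R => r * cos x).
  move=> x; apply/differentiable_continuous/derivable1_diffP.
  exact: ex_derive.
have cF : continuous F.
  move=> x; apply/differentiable_continuous/derivable1_diffP.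
  exact: ex_derive.
have S := @integration_by_substitution_increasing R F
  (fun x => 2 * Num.sqrt (r ^+ 2 - x ^+ 2)) (- (pi / 2)) (pi / 2).
rewrite Fa Fb in S; rewrite S {S}.
- rewrite -(integral_cos2 r); apply: eq_integral => x.
  rewrite inE /= in_itv /= => xp; congr EFin.
  rewrite !fctE dF /F.
  have -> : r ^+ 2 - (r * sin x) ^+ 2 = (r * cos x) ^+ 2.
    by rewrite !exprMn cos2sin2; ring.
  rewrite sqrtr_sqr ger0_norm; first by ring.
  by rewrite mulr_ge0 ?(ltW r0)// cos_ge0_pihalf.
- by rewrite ge0_cp// divr_ge0// pi_ge0.
- move=> x y xp yp xy; rewrite /F ltr_pM2l//.
  by rewrite ltr_sin.
- by rewrite dF' => x _; exact: cdF.
- by rewrite dF'; apply/cvg_ex; exists (r * cos (- (pi / 2))); exact/cvg_at_right_filter/cdF.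
- by rewrite dF'; apply/cvg_ex; exists (r * cos (pi / 2)); exact/cvg_at_left_filter/cdF.
- split=> [x _||]; first exact: ex_derive.
    exact/cvg_at_right_filter/cF.
  exact/cvg_at_left_filter/cF.
- apply: continuous_subspaceT => x.
  apply: cvgM; first exact: cvg_cst.
  apply: (cvg_comp (fun x => r ^+ 2 - x ^+ 2) Num.sqrt).
    by apply: cvgB; [exact: cvg_cst|exact: exprn_continuous].
  exact: sqrt_continuous.
Qed.

Lemma measure_disc r : 0 < r -> mu2 (disc r) = (pi * r ^+ 2)%:E.
Proof.
move=> r0; rewrite /product_measure1 /=.
rewrite -(integral_chord r0) [RHS]integral_mkcond.
apply: eq_integral => x _ /=; rewrite measure_chord patchE.
case: ifPn => //; rewrite notin_setE /= in_itv /= => /negP.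
rewrite -ler_norml -ltNge => xr; congr EFin.
rewrite ler0_sqrtr ?mulr0// subr_le0 -(ger0_norm (ltW r0)).
by rewrite -[x ^+ 2]ger0_norm ?sqr_ge0// normrX ler_sqr ?nnegrE// (ger0_norm (ltW r0)) ltW.
Qed.

End DiscArea.

(** * The integral of log |z| over a disc *)

Section LogIntegral.
Context {R : realType}.
Implicit Types (r t : R) (z : R * R).
Local Notation mu := (@lebesgue_measure R).
Local Notation mu2 := (mu \x mu)%E.

Definition modulus z : R := Num.sqrt (sqnorm z).

Lemma modulus_lt z t : 0 < t -> (modulus z < t) = (sqnorm z < t ^+ 2).
Proof.
move=> t0; rewrite -[in LHS](ger0_norm (ltW t0)) -sqrtr_sqr ltr_sqrt//.
by rewrite exprn_gt0.
Qed.

Lemma modulus_gt0 z : (0 < modulus z) = (z != (0, 0)).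
Proof.
rewrite sqrtr_gt0 /sqnorm; case: z => x y /=.
rewrite lt_neqAle addr_ge0 ?sqr_ge0// andbT eq_sym paddr_eq0 ?sqr_ge0//.
by rewrite !sqrf_eq0 xpair_eqE.
Qed.

Lemma measurable_modulus : measurable_fun setT modulus.
Proof.
have h : measurable_fun setT (Num.sqrt \o @sqnorm R).
  apply: measurableT_comp; last exact: measurable_sqnorm.
  by apply: continuous_measurable_fun; exact: sqrt_continuous.
exact: h.
Qed.

(** A null set, removed because ln r - ln |z| is a nonnegative radial integral only for z different
    from 0. *)
Definition origin_set : set (R * R) := [set (0, 0)].

Lemma origin_setX : origin_set = [set 0] `*` [set 0].
Proof. by apply/seteqP; split => [_ ->//|[x y] [/= -> ->]]. Qed.

Lemma not_origin z : (~ origin_set z) = (0 < modulus z).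
Proof. by rewrite modulus_gt0; apply/propext; split => /eqP. Qed.

Lemma measure_origin : mu2 origin_set = 0%E.
Proof.
rewrite origin_setX.
rewrite product_measure1E//.
have e : lebesgue_measure [set (0 : R)] = 0%E by exact: lebesgue_measure_set1.
by rewrite [X in (X * _)%E]e mul0e.
Qed.

Lemma measurable_origin : measurable origin_set.
Proof.
rewrite origin_setX.
exact: measurableX.
Qed.

Lemma measure_punctured_disc t : 0 < t ->
  mu2 (disc t `\` origin_set) = (pi * t ^+ 2)%:E.
Proof.
move=> t0.
have mD := measurable_disc t; have mO := measurable_origin.
have I0 : mu2 (disc t `&` origin_set) = 0%E.
  apply/eqP; rewrite -measure_le0 -[leRHS]measure_origin.
  by apply: le_measure; rewrite ?inE//=; exact: measurableI.
have e : mu2 (disc t `\` origin_set) = (mu2 (disc t) - mu2 (disc t `&` origin_set))%E.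
  apply: measureD => //.
  by rewrite [X in (X < _)%E](measure_disc t0) ltry.
by rewrite e I0 sube0 measure_disc.
Qed.

(** The integral of ln r - ln |z| over the disc is computed by Tonelli's theorem
    from ln r - ln |z| = int_(|z| < t <= r) dt / t. *)
Definition radial_region r : set (R * R * R) :=
  [set p | 0 < modulus p.1 /\ modulus p.1 < p.2 /\ p.2 <= r].

Lemma measurable_radial_region r : measurable (radial_region r).
Proof.
have m1 : measurable_fun setT (fun p : R * R * R => modulus p.1).
  by apply: measurableT_comp; [exact: measurable_modulus|exact: measurable_fst].
have m2 : measurable_fun setT (fun p : R * R * R => p.2) by exact: measurable_snd.
have mc (c : R) : measurable_fun setT (fun p : R * R * R => c) by exact: measurable_cst.
have bset (b : R * R * R -> bool) : measurable_fun setT b -> measurable [set p | b p].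
  by move=> mb; rewrite -[X in measurable X]setTI; exact: (mb measurableT [set true]).
apply: measurableI; first by apply: bset; apply: measurable_fun_ltr.
apply: measurableI; apply: bset.
  exact: measurable_fun_ltr.
exact: measurable_fun_ler.
Qed.

(** For t > 0, [expR (- ln t)] is 1 / t; in this form it is visibly measurable. *)
Definition radial_kernel r (p : R * R * R) : R :=
  expR (- ln p.2) * \1_(radial_region r) p.

Lemma measurable_inv_ln : measurable_fun setT (fun t : R => expR (- ln t)).
Proof.
apply: (measurableT_comp (f := expR)); first exact: measurable_expR.
by apply: measurable_funN; exact: measurable_ln.
Qed.

Lemma measurable_radial_kernel r : measurable_fun setT (EFin \o radial_kernel r).
Proof.
apply/measurable_EFinP; apply: measurable_funM.
  apply: (measurableT_comp (f := fun t : R => expR (- ln t))).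
    exact: measurable_inv_ln.
  exact: measurable_snd.
apply: measurable_indic; exact: measurable_radial_region.
Qed.

Lemma integral_inv (a r : R) : 0 < a -> a < r ->
  (\int[mu]_(t in `]a, r]) (expR (- ln t))%:E = (ln r - ln a)%:E)%E.
Proof.
move=> a0 ar; rewrite integral_itv_obnd_cbnd; last first.
  apply: measurable_funTS; apply/measurable_EFinP; exact: measurable_inv_ln.
have gt x : a <= x -> 0 < x by exact: lt_le_trans.
have cln x : 0 < x -> {for x, continuous (@ln R)}.
  by move=> x0; exact: continuous_ln.
rewrite (continuous_FTC2 (F := @ln R) ar)//.
- apply: continuous_in_subspaceT => x; rewrite inE /= in_itv /= => /andP[/gt x0 _].
  apply: (continuous_comp (f := fun t => - ln t) (g := expR)).
    by apply: cvgN; exact: cln.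
  exact: continuous_expR.
- split=> [x xar||].
  + move: xar; rewrite in_itv /= => /andP[/ltW/gt x0 _].
    by apply: ex_derive; exact: is_derive1_ln.
  + exact/cvg_at_right_filter/cln.
  + exact/cvg_at_left_filter/cln/(lt_trans a0).
- move=> x; rewrite in_itv /= => /andP[/ltW/gt x0 _].
  have := is_derive1_ln x0; rewrite derive1E => d; rewrite derive_val.
  by rewrite expRN lnK.
Qed.

Lemma integral_radial_t r z : 0 < r -> (\int[mu]_t (radial_kernel r (z, t))%:E =
  ((fun z => (ln r - ln (modulus z))%:E) \_ (disc r `\` origin_set)) z)%E.
Proof.
move=> r0; rewrite patchE; case: ifPn => [|].
  rewrite inE => -[]; rewrite not_origin /disc /= -modulus_lt// => zr z0.
  rewrite -(integral_inv z0 zr) [RHS]integral_mkcond.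
  apply: eq_integral => t _; rewrite patchE /radial_kernel /= indicE.
  case: ifPn => [|]; rewrite ?inE ?notin_setE /= in_itv /=.
    by move=> /andP[zt tr]; rewrite mem_set ?mulr1.
  by move=> tr; rewrite memNset ?mulr0// => -[_ [zt tr']]; apply: tr; rewrite zt.
rewrite notin_setE => nz; rewrite integral0_eq// => t _.
rewrite /radial_kernel /= indicE memNset ?mulr0// => -[/= z0 [zt tr]].
apply: nz; split; last by rewrite not_origin.
by rewrite /disc /= -modulus_lt//; exact: lt_le_trans tr.
Qed.

(** For fixed t in ]0, r] the region is the punctured disc of radius t, of area pi t^2, and the
    kernel is 1/t on it. *)
Lemma integral_radial_z r t : (\int[mu2]_z (radial_kernel r (z, t))%:E =
  ((fun t => (pi * t)%:E) \_ `]0%R, r]) t)%E.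
Proof.
rewrite patchE; case: ifPn => [|].
  rewrite inE /= in_itv /= => /andP[t0 tr].
  have E z : (radial_kernel r (z, t))%:E =
      ((t^-1)%:E * (\1_(disc t `\` origin_set) z)%:E)%E.
    rewrite /radial_kernel /= expRN lnK// EFinM; congr (_ * (_%:R)%:E)%E.
    congr nat_of_bool; apply/idP/idP; rewrite !inE.
      move=> [/= z0 [zt _]]; split; last by rewrite not_origin.
      by rewrite /disc /= -modulus_lt.
    by move=> []; rewrite not_origin /disc /= -modulus_lt// => ? ?; split.
  under eq_integral do rewrite E.
  have mD : measurable (disc t `\` origin_set).
    by apply: measurableD; [exact: measurable_disc|exact: measurable_origin].
  rewrite ge0_integralZl//; last 2 first.
  - by apply/measurable_EFinP; exact: measurable_indic.
  - by rewrite lee_fin invr_ge0 ltW.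
  rewrite integral_indic// setIT [X in (_ * X)%E](measure_punctured_disc t0).
  rewrite -EFinM; congr EFin.
  by field; rewrite gt_eqF.
rewrite notin_setE /= in_itv /= => tr; rewrite integral0_eq// => z _.
rewrite /radial_kernel /= indicE memNset ?mulr0// => -[/= z0 [zt tr']].
by apply: tr; rewrite tr' (lt_trans z0 zt).
Qed.

(** A named copy of the product measure, which can carry a sigma-finiteness
    instance. *)
Definition planar_measure := mu2.

HB.instance Definition _ := Measure.on planar_measure.

Lemma planar_measure_sigma_finite : sigma_finite setT planar_measure.
Proof.
exists (fun n => disc (n.+1%:R : R)).
  apply/esym; apply/seteqP; split => // z _; exists (Num.bound (sqnorm z)) => //.
  have s0 : 0 <= sqnorm z by rewrite addr_ge0 ?sqr_ge0.
  rewrite /disc /=; apply: (lt_trans (archi_boundP s0)).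
  apply: (@lt_le_trans _ _ (Num.bound (sqnorm z)).+1%:R); first by rewrite ltr_nat.
  by rewrite -[leLHS]expr1 ler_weXn2l// ler1n.
move=> n; split; first exact: measurable_disc.
by rewrite [X in (X < _)%E](@measure_disc R n.+1%:R) ?ltr0n// ltry.
Qed.

HB.instance Definition _ :=
  Measure_isSigmaFinite.Build _ _ _ planar_measure planar_measure_sigma_finite.

Lemma integral_log_deficit r : 0 < r ->
  (\int[mu2]_(z in disc r `\` origin_set) (ln r - ln (modulus z))%:E =
   (pi * r ^+ 2 / 2)%:E)%E.
Proof.
move=> r0; rewrite integral_mkcond.
have F := fubini_tonelli (m1 := planar_measure) (m2 := mu) (EFin \o radial_kernel r)
  (measurable_radial_kernel r).
transitivity (\int[planar_measure]_z \int[mu]_t (EFin \o radial_kernel r) (z, t))%E.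
  by apply: eq_integral => z _; rewrite -integral_radial_t.
rewrite F; last by move=> p; rewrite lee_fin mulr_ge0// expR_ge0.
transitivity (\int[mu]_(t in `]0%R, r]) (pi * t)%R%:E)%E.
  rewrite [RHS]integral_mkcond; apply: eq_integral => t _.
  exact: integral_radial_z.
rewrite integral_itv_obnd_cbnd; last first.
  apply: measurable_funTS; apply/measurable_EFinP.
  by apply: measurable_funM => //; exact: measurable_cst.
rewrite (FTC_global (F := fun t => pi * t ^+ 2 / 2)) //.
- by rewrite expr0n /= mulr0 mul0r subr0.
- move=> x; split; first exact: ex_derive.
  by rewrite derive_val /GRing.scale /=; field.
- by move=> x; apply: cvgM; [exact: cvg_cst|exact: cvg_id].
Qed.

(** ln |z| may change sign, so Tonelli's theorem is applied to h = ln r - ln |z|, nonnegative off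
    the origin. This makes h integrable, and the constant ln r is integrated separately. *)
Lemma area_integral_log r : 0 < r ->
  area_integral (disc r) (fun z => ln (Num.sqrt (z.1 ^+ 2 + z.2 ^+ 2))) =
  pi * r ^+ 2 * ln r - pi * r ^+ 2 / 2.
Proof.
move=> r0; rewrite /area_integral.
change (\int[planar_measure]_(z in disc r) ln (Num.sqrt (z.1 ^+ 2 + z.2 ^+ 2)) =
  pi * r ^+ 2 * ln r - pi * r ^+ 2 / 2).
have m0 : planar_measure origin_set = 0%E by exact: measure_origin.
have md : planar_measure (disc r) = (pi * r ^+ 2)%:E by exact: measure_disc.
have id : (\int[planar_measure]_(z in disc r `\` origin_set) (ln r - ln (modulus z))%:E
   = (pi * r ^+ 2 / 2)%:E)%E by exact: integral_log_deficit.
pose h z := ln r - ln (modulus z).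
have mD := measurable_disc r; have mO := measurable_origin.
have mh : measurable_fun setT h.
  apply: measurable_funB; first exact: measurable_cst.
  by apply: (measurableT_comp (f := @ln R)); [exact: measurable_ln|exact: measurable_modulus].
have h0 z : (disc r `\` origin_set) z -> 0 <= h z.
  move=> [zr]; rewrite not_origin => z0.
  by rewrite subr_ge0 ler_ln ?posrE// ltW// modulus_lt.
have ih : planar_measure.-integrable (disc r) (EFin \o h).
  apply/integrableP; split.
    by apply: measurable_funTS; apply/measurable_EFinP.
  have e : (\int[planar_measure]_(z in disc r) `|(EFin \o h) z| =
      \int[planar_measure]_(z in disc r `\` origin_set) `|(EFin \o h) z|)%E.
    apply: ge0_negligible_integral => //.
    by apply: measurable_funTS; apply: measurableT_comp => //; apply/measurable_EFinP.
  have e' : (\int[planar_measure]_(z in disc r `\` origin_set) `|(EFin \o h) z| =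
      (pi * r ^+ 2 / 2)%:E)%E.
    rewrite -id; apply: eq_integral => z; rewrite inE => /h0 hz.
    by rewrite /= ger0_norm.
  by rewrite [X in (X < _)%E]e [X in (X < _)%E]e' ltry.
have -> : (fun z : R * R => ln (Num.sqrt (z.1 ^+ 2 + z.2 ^+ 2))) = (fun z => ln r - h z).
  by apply/funext => z; rewrite /h subKr.
rewrite RintegralB//; last first.
  apply/integrableP; split; first exact: measurable_cst.
  by rewrite integral_cst// [X in (_ * X < _)%E]md -EFinM ltry.
rewrite Rintegral_cst//; congr (_ - _).
  by rewrite [X in _ * fine X]md /= mulrC.
have e : (\int[planar_measure]_(z in disc r) (h z)%:E =
    \int[planar_measure]_(z in disc r `\` origin_set) (h z)%:E)%E.
  exact: negligible_integral.
by rewrite /Rintegral e id.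
Qed.

End LogIntegral.

(** * Derivatives at the origin *)

Section OriginLine.
Context {R : realType}.
Local Notation C := R[i].
Local Notation point := (nat -> C).

Lemma move_origin (t s : R) : move (origin t) 0 1 s = origin (t + s).
Proof.
apply/funext => j; rewrite /move /origin mulr1.
by case: j => [|j] //=; rewrite rmorphD.
Qed.

Lemma is_derive_shift (g : R -> R) (t s dg : R) :
  is_derive (s + t) 1 g dg -> is_derive s 1 (fun u => g (u + t)) dg.
Proof.
move=> d; have := @is_derive1_comp R g (fun u => u + t) s dg 1 d _.
by rewrite mulr1; apply; apply: is_derive_eq; rewrite addr0.
Qed.

(** Moving t_0 does not leave the line t_k = 0, so d_0 of F on the line depends only on the values
    of F there. *)
Lemma partial0_origin (F : point -> C) (a : C) (g : R -> R) (t dg : R) :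
  (forall s, 0 < s -> F (origin s) = a * (g s)%:C) -> 0 < t ->
  is_derive t 1 g dg -> partial (false, 0%N) F (origin t) = a * dg%:C.
Proof.
move=> Fg t0 d; rewrite /partial /= derivative_alongE.
have dt : is_derive (0 : R) 1 (fun s => g (s + t)) dg.
  by apply: is_derive_shift; rewrite add0r.
have h1 : path_derivable (fun s => (g (s + t))%:C).
  by split; [exact: ex_derive|exact: derivable_cst].
have e1 : path_derive (fun s => (g (s + t))%:C) = dg%:C.
  by rewrite /path_derive /= derive1_cst derive1E derive_val.
transitivity (path_derive (fun s => a * (g (s + t))%:C)).
  apply: near_path_derive; apply: filterS (nbhs0_lt t0) => s st.
  by rewrite move_origin addrC Fg//; move: st; rewrite ltr_norml; lra.
rewrite path_deriveM ?path_derive_cst ?mul0r ?add0r ?e1//.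
Qed.

End OriginLine.

Section Circles.
Context {R : realType}.
Local Notation C := R[i].

Lemma moment_circle (r : R) : 0 < r -> moment (circle r) = origin (r ^+ 2).
Proof.
move=> r0; apply/funext => -[|k]; rewrite /moment /origin.
  rewrite interior_circle// /area_integral Rintegral_cst; last exact: measurable_disc.
  rewrite [X in fine X]measure_disc//= mul1r mulKf//.
  by rewrite gt_eqF// pi_gt0.
by rewrite contour_circle_neg// mulr0.
Qed.

Lemma normc_direction k (w : C) (s : R) : direction k w -> `|s%:C * w| = `|s|%:C.
Proof.
move=> dir; rewrite normrM normc_def /= expr0n addr0 sqrtr_sqr.
suff -> : `|w| = 1 by rewrite mulr1.
by case: dir => [->|[_ ->]]; [exact: normr1|exact: normCi].
Qed.

(** The freedom to vary finitely many moments, taken with n = k, yields a segment in direction w;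
    for k = 0 [direction] keeps t_0 real, as that freedom requires. *)
Lemma moments_open (X : set (R -> C)) p k w : moments_are_coordinates X ->
  [set moment g | g in X] p -> direction k w ->
  \forall s \near (0 : R), [set moment g | g in X] (move p k w s).
Proof.
move=> [_ _ _ Xo] [g Xg <-] dir; have [e e0 He] := Xo g k Xg.
apply: filterS (nbhs0_lt e0) => s se.
have [|||h Xh hE] := He (move (moment g) k w s); last by exists h.
- rewrite /move; case: eqP => // k0.
  case: dir => [->|[/eqP]]; last by rewrite -k0.
  by rewrite mulr1 ImD /= addr0.
- move=> j _; rewrite /move; case: eqP => _; last by rewrite subrr normr0 ltcR.
  by rewrite addrC addKr (normc_direction _ dir) ltcR.
- by move=> j kj; rewrite /move gtn_eqF.
Qed.

End Circles.

Section LogTauDerivatives.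
Context {R : realType}.
Local Notation C := R[i].
Variables (X : set (R -> C)) (v : (nat -> C) -> C).
Hypothesis X_coord : moments_are_coordinates X.
Hypothesis v_der : log_tau_derivatives X v.
Local Notation U := [set moment g | g in X].

Lemma origin_moment (t : R) : 0 < t -> origin t = moment (circle (Num.sqrt t)).
Proof.
by move=> t0; rewrite moment_circle ?sqrtr_gt0// sqr_sqrtr// ltW.
Qed.

Lemma X_circle (t : R) : 0 < t -> X (circle (Num.sqrt t)).
Proof. by move=> t0; have [_ + _ _] := X_coord; apply; rewrite sqrtr_gt0. Qed.

Lemma U_origin (t : R) : 0 < t -> U (origin t).
Proof.
by move=> t0; exists (circle (Num.sqrt t)); [exact: X_circle|rewrite -origin_moment].
Qed.

Lemma partial_origin c k (t : R) : 0 < t -> (0 < k)%N -> partial (c, k) v (origin t) = 0.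
Proof.
move=> t0 k0; rewrite (origin_moment t0).
have [_ /(_ k k0) [h1 h2]] := v_der (X_circle t0).
have h : partial (false, k) v (moment (circle (Num.sqrt t))) = 0.
  by rewrite h1 contour_circle_pos// mulr0.
by case: c => //; rewrite h2 h conjc0.
Qed.

Lemma partial0_v (t : R) : 0 < t ->
  partial (false, 0%N) v (origin t) = (t * ln t - t)%:C.
Proof.
move=> t0; rewrite (origin_moment t0); have [-> _] := v_der (X_circle t0).
have s0 : 0 < Num.sqrt t by rewrite sqrtr_gt0.
rewrite interior_circle// area_integral_log// sqr_sqrtr ?ltW//.
have lt : ln t = ln (Num.sqrt t) + ln (Num.sqrt t).
  by rewrite -mulr2n -lnXn// sqr_sqrtr ?ltW.
have p0 : pi != 0 :> R by rewrite gt_eqF// pi_gt0.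
rewrite lt; move: (pi : R) p0 => p p0; apply: (congr1 (fun x : R => x%:C)).
by field.
Qed.

End LogTauDerivatives.

(** * Recovering v on the line from d_0 v *)

Section VanishingPrimitive.
Context {R : realType}.

Lemma is_derive0_pos_cst (f : R -> R) : (forall t : R, 0 < t -> is_derive t 1 f 0) ->
  forall a b : R, 0 < a -> 0 < b -> f a = f b.
Proof.
move=> f0; have ab : forall a b : R, 0 < a -> a < b -> f a = f b.
  move=> a b a0 ab.
  have [||c _] := @MVT R f (fun=> 0) a b ab.
  - by move=> x; rewrite in_itv /= => /andP[ax _]; apply: f0; lra.
  - apply: derivable_within_continuous => x; rewrite in_itv /= => /andP[ax _].
    by have d := f0 x (lt_le_trans a0 ax); exact: ex_derive.
  - by rewrite mul0r => /eqP; rewrite subr_eq0 => /eqP.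
by move=> a b a0 b0; case: (ltgtP a b) => [||->//]; [|move=> ?; apply/esym]; exact: ab.
Qed.

Lemma is_derive0_pos_eq0 (f : R -> R) : (forall t : R, 0 < t -> is_derive t 1 f 0) ->
  f s @[s --> 0^'+] --> (0 : R) -> forall t : R, 0 < t -> f t = 0.
Proof.
move=> f0 fl t t0.
have ft : f s @[s --> 0^'+] --> f t.
  apply: cvg_near_cst; apply: filterS (nbhs_right_gt 0) => s s0.
  exact: is_derive0_pos_cst.
exact: (cvg_unique _ ft fl).
Qed.

(** From ln (1/s) <= 1/s one gets |s^2 ln s| <= s for s in ]0, 1[. *)
Lemma cvg_sqr_ln : (s ^+ 2 * ln s) @[s --> 0^'+] --> (0 : R).
Proof.
apply/norm_cvg0P.
apply: (@squeeze_cvgr _ _ _ _ (fun=> 0) id); last 2 first.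
- exact: cvg_cst.
- by apply: cvg_at_right_filter; exact: cvg_id.
near=> s.
have s0 : 0 < s by near: s; exact: nbhs_right_gt.
have s1 : s < 1 by near: s; exact: nbhs_right_lt.
have l0 : ln s <= 0 by apply: ln_le0; exact: ltW.
rewrite normr_ge0 normrM ger0_norm ?sqr_ge0// ler0_norm//=.
have si : 0 < s^-1 by rewrite invr_gt0.
have := ln_sublinear si; rewrite lnV ?posrE// => h.
rewrite expr2 -mulrA ger_pMr// -ler_pdivlMl// mulr1.
exact: ltW.
Unshelve. all: by end_near. Qed.

End VanishingPrimitive.

Section LogTauValue.
Context {R : realType}.
Local Notation C := R[i].
Variables (X : set (R -> C)) (v : (nat -> C) -> C).
Hypothesis X_coord : moments_are_coordinates X.
Hypothesis v_der : log_tau_derivatives X v.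
Local Notation U := [set moment g | g in X].
Hypothesis v_smooth : has_all_partials U v.

Lemma is_derive_v_origin (t : R) : 0 < t ->
  is_derive t 1 (fun s => complex.Re (v (origin s))) (t * ln t - t) /\
  is_derive t 1 (fun s => complex.Im (v (origin s))) 0.
Proof.
move=> t0; have [[h1 h2] _] := v_smooth.1 [::] (origin t) 0%N (U_origin X_coord t0).
have := partial0_v X_coord v_der t0; rewrite /partial /= /derivative_along => -[e1 e2].
have shift f df : derivable (fun s : R => f (v (move (origin t) 0 1 s)) : R) 0 1 ->
    (fun s : R => f (v (move (origin t) 0 1 s)))^`() 0 = df ->
    is_derive t 1 (fun s => f (v (origin s))) df.
  move=> fd fe.
  have -> : (fun s => f (v (origin s))) =
      (fun s => (fun u => f (v (move (origin t) 0 1 u))) (s + - t)).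
    by apply/funext => s; rewrite move_origin [t + _]addrC subrK.
  apply: (@is_derive_shift R (fun u => f (v (move (origin t) 0 1 u))) (- t) t).
  rewrite subrr.
  by apply: DeriveDef => //; rewrite -derive1E.
by split; exact: shift.
Qed.

Hypothesis v_norm : log_tau_normalized v.

(** The explicit function g is a primitive of t ln t - t that tends to 0 at 0. The difference Re v -
    g and Im v thus have derivative 0 for t > 0 and, by the normalization, limit 0. *)
Lemma v_origin (t : R) : 0 < t ->
  v (origin t) = (2^-1 * t ^+ 2 * ln t - 3 / 4 * t ^+ 2)%:C.
Proof.
move=> t0.
have Re_le (z : C) : `|complex.Re z| <= complex.Re `|z|.
  by have := normc_ge_Re z; rewrite lecE => /andP[].
have Im_le (z : C) : `|complex.Im z| <= complex.Re `|z|.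
  rewrite normc_def /= -sqrtr_sqr ler_sqrt ?lerDr ?sqr_ge0//.
  by rewrite addr_ge0 ?sqr_ge0.
have cRe : complex.Re (v (origin s)) @[s --> 0^'+] --> (0 : R).
  apply/norm_cvg0P; apply: (squeeze_cvgr _ (cvg_cst 0) v_norm).
  by near=> s; rewrite normr_ge0 Re_le.
have cIm : complex.Im (v (origin s)) @[s --> 0^'+] --> (0 : R).
  apply/norm_cvg0P; apply: (squeeze_cvgr _ (cvg_cst 0) v_norm).
  by near=> s; rewrite normr_ge0 Im_le.
pose g (s : R) := 2^-1 * (s ^+ 2 * ln s) - 3 / 4 * s ^+ 2.
have cg : g s @[s --> 0^'+] --> (0 : R).
  have c2 : (s ^+ 2) @[s --> 0^'+] --> (0 : R).
    apply: cvg_at_right_filter; rewrite -[X in _ --> X](expr0n _ 2).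
    exact: exprn_continuous.
  rewrite -[X in _ --> X](_ : 2^-1 * 0 - 3 / 4 * 0 = 0); last by rewrite !mulr0 subr0.
  exact: (cvgB (cvgM (cvg_cst _) cvg_sqr_ln) (cvgM (cvg_cst _) c2)).
have dg (s : R) : 0 < s -> is_derive s 1 g (s * ln s - s).
  move=> s0; have dl := is_derive1_ln s0.
  apply: is_derive_eq.
  by rewrite /GRing.scale /=; field; rewrite gt_eqF.
have e1 : complex.Re (v (origin t)) - g t = 0.
  apply: (@is_derive0_pos_eq0 R (fun s => complex.Re (v (origin s)) - g s)) => //.
    move=> s s0; have [d _] := is_derive_v_origin s0; have dgs := dg s s0.
    by apply: is_derive_eq; rewrite subrr.
  by rewrite -[X in _ --> X](subr0 0); exact: cvgB.
have e2 : complex.Im (v (origin t)) = 0.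
  apply: (@is_derive0_pos_eq0 R (fun s => complex.Im (v (origin s)))) => //.
  by move=> s s0; have [_] := is_derive_v_origin s0.
case: (v (origin t)) e1 e2 => a b /= /eqP; rewrite subr_eq0 => /eqP -> ->.
by rewrite /g mulrA.
Unshelve. all: by end_near. Qed.

End LogTauValue.

Section SecondDerivatives.
Context {R : realType}.
Local Notation C := R[i].
Variables (X : set (R -> C)) (v : (nat -> C) -> C).
Hypothesis X_coord : moments_are_coordinates X.
Hypothesis v_der : log_tau_derivatives X v.
Local Notation U := [set moment g | g in X].
Hypothesis v_hirota : dispersionless_hirota U v.

Lemma cexp_ln (t : R) : 0 < t -> cexp (ln t)%:C = t%:C.
Proof. by move=> t0; rewrite /cexp /= lnK// cos0 sin0 mulr1. Qed.

Lemma partials0_origin c k (t : R) : 0 < t -> (0 < k)%N ->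
  partials [:: (false, 0%N); (c, k)] v (origin t) = 0.
Proof.
move=> t0 k0; rewrite -[RHS](mul0r (0 : R)%:C).
apply: (@partial0_origin R (partial (c, k) v) 0 (fun=> 0) t 0) => //.
by move=> s s0; rewrite mul0r (partial_origin X_coord v_der).
Qed.

Lemma partials00_origin (t : R) : 0 < t ->
  partials [:: (false, 0%N); (false, 0%N)] v (origin t) = (ln t)%:C.
Proof.
move=> t0; rewrite -[RHS]mul1r; have dl := is_derive1_ln t0.
apply: (@partial0_origin R _ 1 (fun s => s * ln s - s) t) => //.
  by move=> s s0; rewrite mul1r (partial0_v X_coord v_der).
apply: is_derive_eq.
by rewrite /GRing.scale /=; field; rewrite gt_eqF.
Qed.

(** On the line d_0^2 v is the derivative ln t of t ln t - t, so e^(d_0^2 v) = t: this is where the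
    powers of t_0 come from. *)
Lemma mixed_second_origin (t : R) i j : 0 < t -> (0 < i)%N -> (0 < j)%N ->
  partials [:: (false, i); (true, j)] v (origin t) =
  if i == j then i%:R * t%:C ^+ i else 0.
Proof.
move=> t0 i0 j0; have [_ _ H] := v_hirota (U_origin X_coord t0).
apply: (hirota_mixed_second i0 j0 _ _ H); first by move=> c a; exact: partials0_origin.
by rewrite partials00_origin// cexp_ln.
Qed.

End SecondDerivatives.

(** * Monomials as lists of indices *)

Section Monomials.
Local Open Scope nat_scope.
Implicit Types m : seq (nat * nat).

Lemma size_spread m : size (spread m) = degree m.
Proof.
rewrite /spread /degree size_flatten /shape -map_comp sumnE big_map.
by apply: eq_bigr => x _ /=; rewrite size_nseq.
Qed.

Lemma sumn_spread m : sumn (spread m) = weight m.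
Proof.
rewrite /spread /weight sumn_flatten -map_comp sumnE big_map.
by apply: eq_bigr => x _ /=; rewrite sumn_nseq mulnC.
Qed.

Lemma spread_ge1 m : is_monomial m -> all (leq 1) (spread m).
Proof.
move=> /andP[_ /allP m1]; apply/allP => k /flattenP[_ /mapP[x xm ->]].
by rewrite mem_nseq => /andP[_ /eqP ->]; have /andP[] := m1 x xm.
Qed.

Lemma spread_gt0 x m : is_monomial (x :: m) -> 0 < size (spread (x :: m)).
Proof.
rewrite size_spread /degree big_cons => /andP[_ /= /andP[/andP[_ x0] _]].
by rewrite addn_gt0 x0.
Qed.

End Monomials.

(** * The Taylor coefficients of v *)

Theorem mainTheorem1 (R : realType) (X : set (R -> R[i]))
    (v : (nat -> R[i]) -> R[i]) :
  moments_are_coordinates X ->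
  has_all_partials [set moment g | g in X] v ->
  log_tau_derivatives X v ->
  log_tau_normalized v ->
  dispersionless_hirota [set moment g | g in X] v ->
  forall t0 : R, 0 < t0 ->
  forall m mb : seq (nat * nat), is_monomial m -> is_monomial mb ->
    taylor_coef v t0 m mb = expansion_coef t0 m mb.
Proof.
move=> X_coord v_smooth v_der v_norm hirota t0 t0_gt0 m mb m_mon mb_mon.
set U := [set moment g | g in X] in v_smooth hirota.
have U_open p k w : U p -> direction k w -> \forall s \near (0 : R), U (move p k w s).
  by move=> Up; exact: moments_open.
pose d := dder U_open v_smooth.
pose T := {t : R | 0 < t}.
pose tau (t : T) : R[i] := (sval t)%:C.
pose ev (t : T) : {rmorphism dring U v -> R[i]} :=
  evaluate (v := v) (U_origin X_coord (svalP t)).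
have evE t xs : ev t (foldr d (dgen U v) xs) = partials xs v (origin (sval t)).
  exact: evaluate_partials.
(* An element of the ring may be known only along the line; its d_0 there is still determined, by
   [partial0_origin]. *)
have ev_o f a n : (forall t, ev t f = a * tau t ^+ n) ->
    forall t, ev t (d (false, 0%N) f) = a *+ n * tau t ^+ n.-1.
  move=> fE t; rewrite [LHS]evaluate_dder.
  have t_gt0 := svalP t.
  have dn : is_derive (sval t) 1 (fun s : R => s ^+ n) (sval t ^+ n.-1 *+ n).
    apply: DeriveDef; first exact: exprn_derivable.
    by rewrite exp_derive /GRing.scale /= mulr1 mulr_natl.
  rewrite (@partial0_origin R _ a (fun s => s ^+ n) _ _ _ t_gt0 dn)//.
  - by rewrite rmorphMn rmorphXn mulrnAr mulrnAl.
  - move=> s s0; rewrite (extendE _ (U_origin X_coord s0)).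
    have := fE (exist _ s s0); rewrite /ev /tau rmorphXn /= => <-.
    by congr (evaluate _ f); exact: Prop_irrelevance.
have ev1 t c s : (0 < s)%N -> ev t (foldr d (dgen U v) [:: (c, s)]) = 0.
  move=> s0; apply: (etrans (evE t [:: (c, s)])).
  exact: (partial_origin X_coord v_der c (svalP t) s0).
have ev2 t i j : (0 < i)%N -> (0 < j)%N ->
    ev t (foldr d (dgen U v) [:: (false, i); (true, j)]) =
    if i == j then i%:R * tau t ^+ i else 0.
  move=> i0 j0; apply: (etrans (evE t [:: (false, i); (true, j)])).
  exact: (mixed_second_origin X_coord v_der hirota (svalP t) i0 j0).
have dD x : {morph d x : f g / f + g} by exact: dderD.
have dM x f g : d x (f * g) = d x f * g + f * d x g by exact: dderM.
have dK x c : d x (dconst U v c) = 0 by exact: dder_const.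
have d_perm := dgen_perm U_open v_smooth.
have d_second := dgen_second U_open v_smooth hirota.
have pure c (I : seq nat) : (0 < size I)%N -> all (leq 1) I ->
    partials [seq (c, i) | i <- I] v (origin t0) = 0.
  move=> I0 I1; apply: (etrans (esym (evE (exist _ t0 t0_gt0) _))).
  exact: (ev_pure (X := pair) dD dM dK d_perm d_second ev_o ev1).
(* Two empty monomials give the value of v on the line, one empty monomial a pure derivative, which
   vanishes, and two nonempty ones a mixed derivative. *)
case: m mb m_mon mb_mon => [|x m] [|y mb] m_mon mb_mon; rewrite /taylor_coef /=.
- by rewrite /factorials !big_nil invr1 mul1r (v_origin X_coord v_der v_smooth v_norm).
- by rewrite pure ?mulr0 ?spread_gt0 ?spread_ge1.
- by rewrite cats0 pure ?mulr0 ?spread_gt0 ?spread_ge1.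
rewrite -mulrA; congr (_ * _).
apply: (etrans (esym (evE (exist _ t0 t0_gt0) _))).
apply: (etrans (ev_mixed (X := pair) dD dM dK d_perm d_second ev_o ev1 ev2 _ _ _ _ _)).
- exact: spread_gt0.
- exact: spread_gt0.
- exact: spread_ge1.
- exact: spread_ge1.
by rewrite !size_spread sumn_spread /tau /= fmorphXz.
Qed.
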